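(* Assume the standing assumptions in the context, and assume there are constants $C>0$ and $\beta_1\in(0,1)$ such that for all $N$, all $L\ge N^{0.01}$ and all $|k|\le N$: $$|\mathfrak{m}_{k+L}(1)-\mathfrak{m}_{k-L}(1)-2L|\le CL^{1-\beta_1},\quad \Big|\sum_{j=k-L}^{k+L}\rho_j\mathbf{1}-2La\Big|\le CL^{1-\beta_1},\quad \Big|\sum_{j=k-L}^{k+L}\rho_j\mathfrak{q}_j-2Lb\Big|\le CL^{1-\beta_1},$$ for some constants $a,b>0$. Let $D=b/a$ and $\upsilon=\frac12\min\left(\frac14,\beta_1\right)$. Then for each $\varepsilon>0$ there is $C_\varepsilon$ such that $$\sup_x\left|\mathbb{P}\left(\frac{X_N}{\sqrt{DN}}\le x\right)-\Phi(x)\right|\le C_\varepsilon N^{-(\upsilon-\varepsilon)},$$ where $\Phi$ is the standard normal distribution function.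
   Context: Fix $m\ge1$, $\mathbb{S}=\mathbb{Z}\times\{1,\dots,m\}$. Environment $(P_n,Q_n,R_n)_{n\in\mathbb{Z}}$, nonnegative $m\times m$ with $(P_n+Q_n+R_n)\mathbf{1}=\mathbf{1}$. The walk $\xi_t=(X_t,Y_t)$ jumps from $(n,i)$ to $(n+1,j),(n,j),(n-1,j)$ with probabilities $P_n(i,j),R_n(i,j),Q_n(i,j)$; $\mathbb{P}$ is its law from $(0,\mathfrak{i})$. Norm $\|x\|=\max|x_i|$. Standing assumptions: (1) Ellipticity: $\bar\varepsilon>0$, $k_0$ with $\|R_n^{k_0}\|\le1-\bar\varepsilon$, $((I-R_n)^{-1}P_n)(i,j)\ge\bar\varepsilon$, $((I-R_n)^{-1}Q_n)(i,j)\ge\bar\varepsilon$. (2) Bounded potential: $\zeta_n=\lim_{a\to-\infty}\psi_{n,a}$ ($\psi_{a,a}$ any stochastic, $\psi_{n,a}=(I-R_n-Q_n\psi_{n-1,a})^{-1}P_n$), $A_n=(I-R_n-Q_n\zeta_{n-1})^{-1}Q_n$, $|\log\|A_n\cdots A_1\||\le C_P$ ($n\ge1$), $|\log\|A_0\cdots A_{n+1}\||\le C_P$ ($n\le-1$). (3) Column vectors $\mathfrak{m}_n$ with $\mathfrak{m}_n=P_n\mathfrak{m}_{n+1}+R_n\mathfrak{m}_n+Q_n\mathfrak{m}_{n-1}$, $|\mathfrak{m}_{n'}(i')-\mathfrak{m}_{n''}(i'')|\le K$ for $|n'-n''|\le1$, $\sum_j\mathfrak{m}_n(j)/n\to m$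 as $|n|\to\infty$. (4) $\zeta^-_n$ the unique stochastic sequence with $\zeta^-_n=(I-R_n-P_n\zeta^-_{n+1})^{-1}Q_n$, $\alpha_n=Q_{n+1}(I-R_n-Q_n\zeta_{n-1})^{-1}$; positive bounded row vectors $\rho_n$ with $\rho_n=\rho_{n-1}P_{n-1}+\rho_nR_n+\rho_{n+1}Q_{n+1}$, $\rho_n=\rho_{n+1}\alpha_n$, $\rho_nP_n(\mathfrak{m}_{n+1}-\zeta^-_{n+1}\mathfrak{m}_n)=\frac1{2m}$. $\mathfrak{q}_n(i)$ is the conditional expectation of $(\mathfrak{m}(\xi_{k+1})-\mathfrak{m}(\xi_k))^2$ given $\xi_k=(n,i)$, with $\mathfrak{m}(n,i)=\mathfrak{m}_n(i)$. *)

(* Defs.v *)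
From HB Require Import structures.
From mathcomp Require Import all_boot all_order all_algebra.
From mathcomp Require Import all_classical all_reals all_analysis.
Set Implicit Arguments. Unset Strict Implicit. Unset Printing Implicit Defensive.
Import Order.TTheory GRing.Theory Num.Theory numFieldNormedType.Exports.
Local Open Scope classical_set_scope.
Local Open Scope ring_scope.

Section Strip.
Variable R : realType.
(* the strip width is m = k.+1 (so m >= 1); the slice index i ranges over 'I_k.+1
   (0-based: the paper's index 1 is ord0) *)
Variable k : nat.
Notation M := 'M[R]_k.+1.
Notation cV := 'cV[R]_k.+1.
Notation rV := 'rV[R]_k.+1.

(* sup-norm on vectors, and the induced operator norm on matrices
   (max absolute row sum) *)
Definition mxnorm (A : M) : R := \big[Num.max/0]_(i < k.+1) \sum_(j < k.+1) `|A i j|.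

Definition nonneg_mx (A : M) : Prop := forall i j, 0 <= A i j.
Definition stochastic (A : M) : Prop :=
  nonneg_mx A /\ A *m (const_mx 1 : cV) = const_mx 1.

Variables (P Q Rm : int -> M).

(* psi_{n,a}: psiN init a j = psi_{a+j, a}, with psi_{a,a} = init a *)
Fixpoint psiN (init : int -> M) (a : int) (j : nat) : M :=
  match j with
  | 0 => init a
  | j'.+1 => let n := a + j'.+1%:Z in
      invmx (1 - Rm n - Q n *m psiN init a j') *m P n
  end.

Definition is_zeta (zeta : int -> M) : Prop :=
  forall init : int -> M, (forall a, stochastic (init a)) ->
  forall (n : int) (i j : 'I_k.+1),
    (fun t : nat => psiN init (n - t%:Z) t i j) @ \oo --> zeta n i j.

Definition Amx (zeta : int -> M) (n : int) : M :=
  invmx (1 - Rm n - Q n *m zeta (n - 1)) *m Q n.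

Fixpoint prodPos (zeta : int -> M) (j : nat) : M :=
  match j with 0 => 1 | j'.+1 => Amx zeta j'.+1%:Z *m prodPos zeta j' end.
Fixpoint prodNeg (zeta : int -> M) (j : nat) : M :=
  match j with 0 => 1 | j'.+1 => prodNeg zeta j' *m Amx zeta (- j'%:Z) end.

Definition alpha (zeta : int -> M) (n : int) : M :=
  Q (n + 1) *m invmx (1 - Rm n - Q n *m zeta (n - 1)).

Definition zetam_eq (zm : int -> M) : Prop :=
  forall n, zm n = invmx (1 - Rm n - P n *m zm (n + 1)) *m Q n.

(* q_n(i) = E[(m(xi_{t+1}) - m(xi_t))^2 | xi_t = (n,i)] *)
Definition qvec (mm : int -> cV) (n : int) : cV :=
  \col_(i < k.+1) \sum_(j < k.+1)
     (P n i j * (mm (n + 1) j 0 - mm n i 0) ^+ 2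
    + Rm n i j * (mm n j 0 - mm n i 0) ^+ 2
    + Q n i j * (mm (n - 1) j 0 - mm n i 0) ^+ 2).

(* law of the walk started at (0, i0): dist i0 t n j = P(xi_t = (n, j)),
   via the forward (Kolmogorov) equation *)
Fixpoint dist (i0 : 'I_k.+1) (t : nat) (n : int) : rV :=
  match t with
  | 0 => if n == 0 then delta_mx 0 i0 else 0
  | t'.+1 => dist i0 t' (n - 1) *m P (n - 1) + dist i0 t' n *m Rm n
             + dist i0 t' (n + 1) *m Q (n + 1)
  end.

(* P(X_N / sqrt(D N) <= x); X_N takes values in [-N, N] *)
Definition probX (i0 : 'I_k.+1) (N : nat) (D x : R) : R :=
  \sum_(l < (N + N).+1 | (l%:Z - N%:Z)%:~R / Num.sqrt (D * N%:R) <= x)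
     \sum_(j < k.+1) dist i0 N (l%:Z - N%:Z) 0 j.

End Strip.

Definition Phi {R : realType} (x : R) : R :=
  fine (normal_prob (0 : R) 1 `]-oo, x]).

(* Main.v *)
Require Import Defs.
From HB Require Import structures.
From mathcomp Require Import all_boot all_order all_algebra.
From mathcomp Require Import all_classical all_reals all_analysis.
From mathcomp Require Import measurable_realfun.
From mathcomp Require Import ring lra zify.
Set Implicit Arguments. Unset Strict Implicit. Unset Printing Implicit Defensive.
Import Order.TTheory GRing.Theory Num.Theory numFieldNormedType.Exports.
Local Open Scope classical_set_scope.
Local Open Scope ring_scope.

(** The potential [mm] makes the walk a martingale [M_t], and the theorem is a
    Lindeberg (heat kernel) argument for [M_t].  If [u t = D (N - t)], then
    [Phi ((x - M_t) / sqrt (s^2 + u t))] has drift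
    [1/2 (qvec - D) Phi''], which does not have a sign; it is cancelled by the
    corrector [- 1/2 Phi'' g], where [g] solves the Poisson equation
    [E[g(xi_1) - g(xi_0)] = qvec - D].  The second order operator factorises
    through [zeta] and [Amx], so [g] is obtained from two first order recursions,
    one forward and one backward, both contracting by ellipticity; the row vectors
    [lam n = rho (n + 1) Q (n + 1)] turn the solvability condition of the forward
    one into the assumed averaging of [rho qvec] and [rho 1].  On the scale [s] this makes
    [g] of size [s^(-beta) (s + |x - m|)^2], where [beta = min (1/4, beta1)]; the
    exponent 1/4 is the loss at the smallest scale [s = N^(1/4)].
    Summing the errors over time requires the local estimate
    [E[exp (- (x - M_N)^2 / (2 s^2))] <= A s / sqrt N], which the same argument with
    [Phi'] in place of [Phi] proves by induction on [N].  Finally [X_N] is compared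
    with [M_N] by the averaging of [mm]. *)

(** * The standard normal distribution function *)

(** Without a corrector the drift on scale [s] is of order [s^(-2)] per step, and its sum over the
    scales from [N^(1/4)] to [sqrt N] does not become small. The corrector improves each term by the
    factor [s^(-beta)], the only gain of the argument. Bounding the Gaussian expectations by 1 would
    then leave [s0^(-beta) = N^(-beta/4)] at the starting scale [s0 = N^(1/4)]; the local estimate
    weights a scale [v] by [v / sqrt N] instead, and the sum becomes [N^(-beta/2)], the claimed
    rate. In the proof of the local estimate the errors are expectations of the same kind, at
    earlier times or on larger scales, multiplied by [s^(-beta)], so the constant closes once [s]
    exceeds a fixed threshold; below it [N <= s^4] makes the estimate trivial. The condition
    [N <= s^4] also serves the averaging: on scale [s] windows are used from length about
    [sqrt s >= N^(1/8)] on, which is admissible, and shorter ones cost at most a multiple of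
    [sqrt s <= s^(1 - beta)]. *)

Section Phi.
Context {R : realType}.
Implicit Types x y w : R.
Notation mu := (@lebesgue_measure R).

Lemma Phi_ge0 x : 0 <= Phi x.
Proof. by rewrite /Phi fine_ge0// measure_ge0. Qed.

Lemma Phi_le1 x : Phi x <= 1.
Proof.
by rewrite /Phi -lee_fin fineK ?fin_num_measure// probability_le1.
Qed.

Lemma is_derive_Phi x : is_derive x 1 (Phi : R -> R) (normal_pdf 0 1 x).
Proof.
have ix : mu.-integrable [set` Interval -oo%O (BRight (x + 1))]
    (EFin \o normal_pdf (0 : R) 1).
  apply: (integrableS measurableT) => //; exact: integrable_normal_pdf.
have cx : {for x, continuous (normal_pdf (0 : R) 1)}.
  exact: (@continuous_normal_pdf _ 0 1 (oner_neq0 _) x).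
have xx1 : x < x + 1 by rewrite ltrDl.
have [d1 d2] := @continuous_FTC1 R (normal_pdf (0 : R) 1) -oo%O x (x + 1) xx1 ix (ltNyr _) cx.
have -> : (Phi : R -> R) = (fun y => (\int[mu]_(t in `]-oo, y]) (normal_pdf 0 1 t))%R).
  by apply/funext.
rewrite -d2 derive1E; exact: derivableP d1.
Qed.

(** The condition places [A] beyond [x] as seen from 0. There [y^2 >= x^2 + (y - x)^2], so the
    density is at most [exp (- x^2 / 2)] times the normal density centred at [x], which has mass
    1. *)
Let Phi_tail x (A : set (measurableTypeR R)) : measurable A ->
  (forall y, A y -> 0 <= x * (y - x)) ->
  (normal_prob (0 : R) 1 A <= (expR (- x ^+ 2 / 2))%:E)%E.
Proof.
move=> mA Ax.
have e0 : 0 <= expR (- x ^+ 2 / 2) by exact: expR_ge0.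
rewrite -[leRHS]mule1.
apply: (@le_trans _ _ ((expR (- x ^+ 2 / 2))%:E * normal_prob x 1 A)%E); last first.
  by rewrite lee_pmul2l// ?lte_fin ?expR_gt0// probability_le1.
rewrite /normal_prob -ge0_integralZl//; last 2 first.
- by apply/measurable_EFinP/measurable_funTS; exact: measurable_normal_pdf.
- by move=> y _; rewrite lee_fin normal_pdf_ge0.
apply: ge0_le_integral => //.
- by move=> y _; rewrite lee_fin normal_pdf_ge0.
- by apply/measurable_EFinP/measurable_funTS; exact: measurable_normal_pdf.
- apply: emeasurable_funM => //.
  by apply/measurable_EFinP/measurable_funTS; exact: measurable_normal_pdf.
- move=> y /Ax yx; rewrite -EFinM lee_fin !normal_pdfE ?oner_neq0//.
  rewrite mulrCA ler_wpM2l ?normal_peak_ge0// /normal_fun -expRD ler_expR.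
  rewrite expr1n subr0; nra.
Qed.

Lemma Phi_left_tail x : x <= 0 -> Phi x <= expR (- x ^+ 2 / 2).
Proof.
move=> x0; rewrite -lee_fin /Phi fineK ?fin_num_measure//.
apply: Phi_tail => //= y; rewrite in_itv/= => yx.
by rewrite -mulrNN mulr_ge0// ?oppr_ge0// subr_le0.
Qed.

Lemma Phi_right_tail x : 0 <= x -> 1 - Phi x <= expR (- x ^+ 2 / 2).
Proof.
move=> x0; rewrite -lee_fin EFinB /Phi fineK ?fin_num_measure//.
rewrite -probability_setC//; apply: Phi_tail => //=; first exact: measurableC.
move=> y; rewrite in_itv/= => /negP; rewrite -ltNge => xy.
by rewrite mulr_ge0// subr_ge0 ltW.
Qed.

End Phi.

(** * Heat kernels *)

Section Taylor.
Context {R : realType}.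

(** Since [t <= 1], this bound can be iterated with the same [M]; the Taylor estimates below are
    obtained so, without the factorials, only the order in [s] being of interest. *)
Lemma le_MVT01 (f df : R -> R) (M : R) :
  (forall t : R, 0 <= t <= 1 -> is_derive t 1 f (df t)) ->
  (forall t : R, 0 <= t <= 1 -> `|df t| <= M) ->
  forall t : R, 0 <= t <= 1 -> `|f t - f 0| <= M.
Proof.
move=> fdf dfM t /andP[t0 t1].
have M0 : 0 <= M by apply: le_trans (dfM 0 _); rewrite ?lexx ?ler01.
have sub s : s \in `[0, t]%R -> 0 <= s <= 1.
  by rewrite in_itv/= => /andP[-> /le_trans->].
have [||c ct ->] := @MVT_segment R f df 0 t t0.
- by move=> s st; apply: fdf; apply: sub; exact: subset_itv_oo_cc.
- apply: derivable_within_continuous => s st.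
  by have [] := fdf s (sub _ st).
rewrite subr0 normrM (ger0_norm t0).
by rewrite -[leRHS]mulr1 ler_pM// dfM// sub.
Qed.

Lemma le_Taylor2 (f f1 f2 : R -> R) (M : R) :
  (forall t : R, 0 <= t <= 1 -> is_derive t 1 f (f1 t)) ->
  (forall t : R, 0 <= t <= 1 -> is_derive t 1 f1 (f2 t)) ->
  (forall t : R, 0 <= t <= 1 -> `|f2 t| <= M) ->
  forall t : R, 0 <= t <= 1 -> `|f t - f 0 - t * f1 0| <= M.
Proof.
move=> ff1 f1f2 f2M t t01.
have := @le_MVT01 (fun t => f t - t * f1 0) (fun t => f1 t - f1 0) M _ _ t t01.
rewrite mul0r subr0 addrAC; apply.
- move=> s /ff1 ds.
  by apply: is_derive_eq; rewrite scaler0 add0r /GRing.scale/= mulr1.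
- exact: le_MVT01 f1f2 f2M.
Qed.

Lemma le_Taylor3 (f f1 f2 f3 : R -> R) (M : R) :
  (forall t : R, 0 <= t <= 1 -> is_derive t 1 f (f1 t)) ->
  (forall t : R, 0 <= t <= 1 -> is_derive t 1 f1 (f2 t)) ->
  (forall t : R, 0 <= t <= 1 -> is_derive t 1 f2 (f3 t)) ->
  (forall t : R, 0 <= t <= 1 -> `|f3 t| <= M) ->
  `|f 1 - f 0 - f1 0 - f2 0 / 2| <= M.
Proof.
move=> ff1 f1f2 f2f3 f3M.
have := @le_MVT01 (fun t => f t - t * f1 0 - t ^+ 2 * (f2 0 / 2))
  (fun t => f1 t - f1 0 - t * f2 0) M _ _ 1.
rewrite !mul1r expr1n mul1r mul0r expr0n/= mul0r !subr0.
have -> : f 1 - f1 0 - f2 0 / 2 - f 0 = f 1 - f 0 - f1 0 - f2 0 / 2 by ring.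
apply; last by rewrite ler01 lexx.
- move=> s /ff1 ds.
  apply: is_derive_eq; rewrite /GRing.scale/=; by field.
- exact: le_Taylor2 f1f2 f2f3 f3M.
Qed.

End Taylor.

(** * The derivatives of the smoothed distribution function *)

Section Heat.
Context {R : realType}.
Implicit Types (s u x z : R) (k : nat).

Definition gauss u z : R := expR (- z ^+ 2 / (2 * u)).

(* Normalised so that d/dz heat k = heat k.+1 and d/du heat k = 1/2 heat k.+2
   for every k; only used for 0 < u. *)
Fixpoint heat k u z : R :=
  match k with
  | 0 => Phi (z / Num.sqrt u) / normal_peak 1
  | k1.+1 => if k1 is k0.+1
             then - (z * heat k1 u z + k0%:R * heat k0 u z) / u
             else (Num.sqrt u)^-1 * gauss u z
  end.

Arguments heat : simpl never.

Lemma heatSS k u z : heat k.+2 u z = - (z * heat k.+1 u z + k%:R * heat k u z) / u.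
Proof. by []. Qed.

Lemma heat1 s z : 0 < s -> heat 1 (s ^+ 2) z = s^-1 * gauss (s ^+ 2) z.
Proof. by move=> s0; rewrite /heat sqrtr_sqr gtr0_norm. Qed.

Lemma heat0 s z : 0 < s -> heat 0 (s ^+ 2) z = Phi (z / s) / normal_peak 1.
Proof. by move=> s0; rewrite /heat sqrtr_sqr gtr0_norm. Qed.

(** Both rules, [d/dz heat k = heat k.+1] and [d/du heat k = 1/2 heat k.+2], in one chain rule, so
    that space and time can move together. *)
Lemma is_derive_heat k (u z : R -> R) (du dz t : R) :
  0 < u t -> is_derive t 1 u du -> is_derive t 1 z dz ->
  is_derive t 1 (fun t => heat k (u t) (z t))
    (dz * heat k.+1 (u t) (z t) + du / 2 * heat k.+2 (u t) (z t)).
Proof.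
move=> ut0 dut dzt.
have ut : u t != 0 by rewrite gt_eqF.
have st0 : 0 < Num.sqrt (u t) by rewrite sqrtr_gt0.
have st : Num.sqrt (u t) != 0 by rewrite gt_eqF.
have uE : u t = Num.sqrt (u t) ^+ 2 by rewrite sqr_sqrtr// ltW.
have ds : is_derive t 1 (fun t => Num.sqrt (u t)) (du / (2 * Num.sqrt (u t))).
  apply: (is_derive_eq (@is_derive1_comp R Num.sqrt u t _ _ (is_derive1_sqrt ut0) dut)).
  by rewrite /GRing.scale/=; field.
have dsV : is_derive t 1 (fun t => (Num.sqrt (u t))^-1) (- (u t)^-1 * (du / (2 * Num.sqrt (u t)))).
  have h := is_deriveV (f := fun t => Num.sqrt (u t)) st ds.
  suff -> : - (u t)^-1 * (du / (2 * Num.sqrt (u t))) =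
    - (Num.sqrt (u t)) ^- 2 *: (du / (2 * Num.sqrt (u t))) by [].
  by rewrite /GRing.scale/= sqr_sqrtr// ltW.
have duV : is_derive t 1 (fun t => (u t)^-1) (- (u t) ^- 2 * du).
  exact: (is_deriveV ut dut).
have d2u : is_derive t 1 (fun t => 2 * u t) (2 * du).
  by apply: is_derive_eq; rewrite /GRing.scale/=; ring.
have u2 : 2 * u t != 0 by rewrite mulf_neq0.
have d2uV := is_deriveV (f := fun t => 2 * u t) u2 d2u.
have dq : is_derive t 1 (fun t => - z t ^+ 2 / (2 * u t))
    (- (z t * dz) / u t + z t ^+ 2 * du / (2 * u t ^+ 2)).
  by apply: is_derive_eq; rewrite /GRing.scale/=; field.
have dg := is_derive1_comp (is_derive_expR _) dq.
have dgauss : is_derive t 1 (fun t => gauss (u t) (z t))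
   (gauss (u t) (z t) * (- (z t * dz) / u t + z t ^+ 2 * du / (2 * u t ^+ 2))) := dg.
(* Two consecutive orders are carried along because the recursion of [heat] has depth two. *)
suff H : (is_derive t 1 (fun t => heat k (u t) (z t))
    (dz * heat k.+1 (u t) (z t) + du / 2 * heat k.+2 (u t) (z t))) /\
  (is_derive t 1 (fun t => heat k.+1 (u t) (z t))
    (dz * heat k.+2 (u t) (z t) + du / 2 * heat k.+3 (u t) (z t))) by case: H.
elim: k => [|k [IH1 IH2]]; split.
- have dy : is_derive t 1 (fun t => z t / Num.sqrt (u t))
      (dz / Num.sqrt (u t) - z t * du / (2 * u t * Num.sqrt (u t))).
    by apply: is_derive_eq; rewrite /GRing.scale/=; field; rewrite ut st.
  have dPhi := is_derive1_comp (is_derive_Phi _) dy.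
  have np0 : normal_peak (1 : R) != 0 by rewrite gt_eqF// normal_peak_gt0// oner_neq0.
  have [c cE] : exists c, c = (normal_peak (1 : R))^-1 by eexists.
  rewrite /heat -cE.
  apply: (@is_derive_eq _ _ _ _ _ _ _ _ (is_deriveM dPhi (is_derive_cst _ _ _))).
  have -> : normal_pdf 0 1 (z t / Num.sqrt (u t)) = c^-1 * gauss (u t) (z t).
    rewrite normal_pdfE ?oner_neq0// /normal_fun/gauss cE invrK; congr (_ * expR _).
    rewrite subr0 expr1n exprMn exprVn (sqr_sqrtr (ltW ut0)); by field.
  have c0 : c != 0 by rewrite cE invr_eq0.
  rewrite /GRing.scale/=; field.
  by rewrite ut st c0.
- apply: (@is_derive_eq _ _ _ _ _ _ _ _ (is_deriveM dsV dgauss)).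
  rewrite /heat !mul0r !addr0 /GRing.scale/=; field.
  by rewrite st ut.
- exact: IH2.
- rewrite [X in is_derive _ _ X](_ : _ = (fun t => - (z t * heat k.+1 (u t) (z t) + k%:R * heat k (u t) (z t)) * (u t)^-1))//.
  apply: is_derive_eq.
  rewrite /GRing.scale/= !(heatSS k.+2) !(heatSS k.+1) !(heatSS k).
  rewrite -!natr1.
  field.
  by [].
Qed.

End Heat.

(** * Gaussian bounds for the kernels *)

Section HeatBounds.
Context {R : realType}.
Implicit Types (s u x z : R) (k : nat).

Lemma gauss_gt0 u z : 0 < gauss u z.
Proof. exact: expR_gt0. Qed.

Lemma gauss_le1 u z : 0 <= u -> gauss u z <= 1.
Proof.
move=> u0; rewrite -expR0 ler_expR mulNr oppr_le0.
by rewrite divr_ge0 ?sqr_ge0// mulr_ge0.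
Qed.

Lemma ler_gauss u v z : 0 < u -> u <= v -> gauss u z <= gauss v z.
Proof.
move=> u0 uv; rewrite ler_expR !mulNr lerN2 ler_wpM2l ?sqr_ge0//.
have v0 : 0 < v by exact: lt_le_trans uv.
by rewrite lef_pV2 ?posrE ?mulr_gt0// ler_pM2l.
Qed.

Lemma exprD1_le_expR n y : 0 <= y -> (1 + y) ^+ n <= expR (n%:R * y) :> R.
Proof.
move=> y0; rewrite mulr_natl -[y *+ n]mulr_natr expRM_natr lerXn2r// ?nnegrE ?expR_ge0//.
  by rewrite addr_ge0.
exact: expR_ge1Dx.
Qed.

(** With [y = |z| / s], the power is at most [exp (n y)], and [n y <= a n^2 + y^2 / (4 a)]: half of
    the Gaussian exponent pays for it, whence the doubled variance. *)
Lemma gauss_absorb n (a : R) : 0 < a -> exists2 C : R, 0 < C &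
  forall s z, 0 < s ->
    (s + `|z|) ^+ n * gauss (a * s ^+ 2) z <= C * s ^+ n * gauss (2 * a * s ^+ 2) z.
Proof.
move=> a0; exists (expR (a * n%:R ^+ 2)); first exact: expR_gt0.
move=> s z s0.
have sn0 : s != 0 by rewrite gt_eqF.
have an0 : a != 0 by rewrite gt_eqF.
pose y := `|z| / s.
have y0 : 0 <= y by rewrite divr_ge0// ltW.
have zE : z ^+ 2 = y ^+ 2 * s ^+ 2 by rewrite /y exprMn exprVn divfK ?expf_neq0// real_normK ?num_real.
have -> : s + `|z| = s * (1 + y) by rewrite /y; field.
 rewrite [leLHS](_ : _ = s ^+ n * ((1 + y) ^+ n * gauss (a * s ^+ 2) z)); last first.
  by rewrite exprMn; ring.
rewrite [leRHS](_ : _ = s ^+ n * (expR (a * n%:R ^+ 2) * gauss (2 * a * s ^+ 2) z)); last first.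
  by ring.
rewrite ler_wpM2l ?exprn_ge0 ?(ltW s0)//.
apply: le_trans (ler_wpM2r (ltW (gauss_gt0 _ _)) (exprD1_le_expR n y0)) _.
rewrite -!expRD ler_expR zE.
have -> : n%:R * y + - (y ^+ 2 * s ^+ 2) / (2 * (a * s ^+ 2)) = n%:R * y - y ^+ 2 / (2 * a).
  by field; rewrite sn0 an0.
have -> : a * n%:R ^+ 2 + - (y ^+ 2 * s ^+ 2) / (2 * (2 * a * s ^+ 2)) =
    a * n%:R ^+ 2 - y ^+ 2 / (4 * a).
  by field; rewrite sn0 an0.
rewrite -subr_ge0.
have -> : a * n%:R ^+ 2 - y ^+ 2 / (4 * a) - (n%:R * y - y ^+ 2 / (2 * a)) =
   (y - 2 * a * n%:R) ^+ 2 / (4 * a) by field.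
by rewrite divr_ge0 ?sqr_ge0// mulr_ge0// ltW.
Qed.

(** The form of the bound is the one that the recursion preserves: each order multiplies by
    [(s + |z|) / s^2], and the lower order term is smaller because [s <= s + |z|]. *)
Lemma heat_le k : exists2 C : R, 0 < C & forall s z, 0 < s ->
  `|heat k.+1 (s ^+ 2) z| <= C * s ^- (k.*2.+1) * (s + `|z|) ^+ k * gauss (s ^+ 2) z.
Proof.
suff [H _] : (exists2 C : R, 0 < C & forall s z, 0 < s ->
  `|heat k.+1 (s ^+ 2) z| <= C * s ^- (k.*2.+1) * (s + `|z|) ^+ k * gauss (s ^+ 2) z) /\
  (exists2 C : R, 0 < C & forall s z, 0 < s ->
  `|heat k.+2 (s ^+ 2) z| <= C * s ^- (k.+1.*2.+1) * (s + `|z|) ^+ k.+1 * gauss (s ^+ 2) z) by [].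
elim: k => [|k [[C C0 HC] [C' C'0 HC']]]; split.
- exists 1 => // s z s0; rewrite heat1//= expr1 expr0 mul1r mulr1.
  by rewrite normrM gtr0_norm ?invr_gt0// gtr0_norm ?gauss_gt0.
- exists 1 => // s z s0; rewrite heatSS mul0r addr0 heat1// mul1r expr1.
  have -> : - (z * (s^-1 * gauss (s ^+ 2) z)) / s ^+ 2 = - (s ^- 3 * z * gauss (s ^+ 2) z).
    by field; rewrite gt_eqF.
  rewrite normrN 2!normrM (gtr0_norm (gauss_gt0 _ _)) (gtr0_norm (x := s ^- 3)) ?invr_gt0 ?exprn_gt0//.
  rewrite ler_wpM2r ?(ltW (gauss_gt0 _ _))// ler_wpM2l ?invr_ge0 ?exprn_ge0 ?(ltW s0)//.
  by rewrite lerDr ltW.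
- by exists C'.
exists (C' + k.+1%:R * C); first by rewrite addr_gt0// mulr_gt0.
move=> s z s0; have sz0 : 0 < s + `|z| by rewrite ltr_wpDr.
have s20 : 0 < s ^+ 2 by rewrite exprn_gt0.
rewrite heatSS normrM normrN normfV (gtr0_norm s20) ler_pdivrMr//.
apply: le_trans (ler_normD _ _) _; rewrite (normrM z) (normrM k.+1%:R) normr_nat.
apply: (@le_trans _ _ ((s + `|z|) * (C' * s ^- (k.+1.*2.+1) * (s + `|z|) ^+ k.+1 * gauss (s ^+ 2) z) +
   k.+1%:R * (C * s ^- (k.*2.+1) * (s + `|z|) ^+ k * gauss (s ^+ 2) z))).
  rewrite lerD//; last by rewrite ler_wpM2l// HC.
  apply: ler_pM => //.
    by rewrite lerDr ltW.
  exact: HC'.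
have -> : (C' + k.+1%:R * C) * s ^- (k.+2.*2.+1) * (s + `|z|) ^+ k.+2 * gauss (s ^+ 2) z * s ^+ 2 =
   (s + `|z|) * (C' * s ^- (k.+1.*2.+1) * (s + `|z|) ^+ k.+1 * gauss (s ^+ 2) z) +
   k.+1%:R * (C * (s ^- (k.+1.*2.+1) * (s + `|z|) ^+ k.+2) * gauss (s ^+ 2) z).
  rewrite !doubleS !exprS; set a := s ^+ _; set b := (s + _) ^+ _; set g := gauss _ _.
  field; rewrite gt_eqF ?exprn_gt0//= gt_eqF//.
rewrite lerD2l ler_wpM2l// ler_wpM2r ?(ltW (gauss_gt0 _ _))//.
rewrite -[leLHS]mulrA ler_wpM2l ?(ltW C0)//.
rewrite !doubleS !exprS.
have -> : (s * (s * (s * s ^+ k.*2)))^-1 * ((s + `|z|) * ((s + `|z|) * (s + `|z|) ^+ k)) =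
  (s * s ^+ k.*2)^-1 * (((s + `|z|) / s) ^+ 2 * (s + `|z|) ^+ k).
  have sn0 : s != 0 by rewrite gt_eqF.
  by field; rewrite ?expf_neq0 ?sn0.
rewrite ler_wpM2l ?invr_ge0 ?mulr_ge0 ?exprn_ge0 ?(ltW s0)//.
rewrite ler_peMl ?exprn_ge0 ?(ltW sz0)// exprn_ege1// ler_pdivlMr// mul1r.
by rewrite lerDl.
Qed.

Lemma heat_gauss k : exists2 C : R, 0 < C & forall s z, 0 < s ->
  `|heat k.+1 (s ^+ 2) z| <= C * s ^- k.+1 * gauss (2 * s ^+ 2) z.
Proof.
have [C C0 HC] := heat_le k.
have [C' C'0 HC'] := gauss_absorb k (@ltr01 R).
exists (C * C'); first exact: mulr_gt0.
move=> s z s0; have := HC' s z s0; rewrite mul1r mulr1 => {}HC'.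
apply: le_trans (HC s z s0) _; rewrite -[leLHS]mulrA.
apply: le_trans (ler_wpM2l _ HC') _.
  by rewrite mulr_ge0 ?invr_ge0 ?exprn_ge0 ?(ltW C0) ?(ltW s0).
rewrite [leLHS]mulrA ler_wpM2r ?(ltW (gauss_gt0 _ _))//.
rewrite -addnn -addnS exprD.
have -> : C * (s ^+ k * s ^+ k.+1)^-1 * (C' * s ^+ k) = C * C' / s ^+ k.+1.
  by field; rewrite !expf_neq0 ?gt_eqF.
by [].
Qed.

End HeatBounds.

Lemma ler_normM (R : numDomainType) (x y a b : R) :
  `|x| <= a -> `|y| <= b -> `|x * y| <= a * b.
Proof. by move=> xa yb; rewrite normrM ler_pM. Qed.

(** * Kernels along one step of the walk *)

Section HeatPath.
Context {R : realType}.
Variables (K D : R).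
Hypotheses (K0 : 0 <= K) (D0 : 0 < D).
Implicit Types (s z d t : R) (k j : nat).

(** The segment from [(s^2, z)] to [(s^2 - D, z + d)] is what one step of the walk traverses. As
    [2 * D <= s^2], the variance stays above [s^2 / 2]; the shift by at most [K] costs a constant
    and another doubling of the variance. *)
Lemma heat_path k : exists2 C : R, 0 < C & forall s z d t,
  1 <= s -> 2 * D <= s ^+ 2 -> `|d| <= K -> 0 <= t <= 1 ->
  `|heat k.+1 (s ^+ 2 - t * D) (z + t * d)| <= C * s ^- k.+1 * gauss (4 * s ^+ 2) z.
Proof.
have [C C0 HC] := heat_gauss (R := R) k.
exists (C * 2 ^+ k.+1 * expR (K ^+ 2 / 4)).
  by rewrite !mulr_gt0 ?exprn_gt0 ?expR_gt0.
move=> s z d t s1 sD dK /andP[t0 t1].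
have s0 : 0 < s by exact: lt_le_trans s1.
have s20 : 0 < s ^+ 2 by rewrite exprn_gt0.
have tD : 0 <= t * D <= D by rewrite mulr_ge0 ?(ltW D0)//= ler_piMl ?(ltW D0).
have v0 : 0 < s ^+ 2 - t * D by lra.
set r := Num.sqrt (s ^+ 2 - t * D).
have r0 : 0 < r by rewrite sqrtr_gt0.
have vr : s ^+ 2 - t * D = r ^+ 2 by rewrite sqr_sqrtr// ltW.
have rs : s / 2 <= r.
  rewrite -(@ler_pXn2r _ 2) ?nnegrE ?divr_ge0 ?(ltW s0) ?(ltW r0)// -vr expr_div_n; lra.
rewrite vr; apply: le_trans (HC _ _ r0) _.
rewrite [leRHS](_ : _ = C * (2 ^+ k.+1 / s ^+ k.+1) *
   (expR (K ^+ 2 / 4) * gauss (4 * s ^+ 2) z)); last by ring.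
apply: ler_pM; rewrite ?mulr_ge0 ?invr_ge0 ?exprn_ge0 ?(ltW C0) ?(ltW r0) ?(ltW (gauss_gt0 _ _))//.
  rewrite ler_wpM2l ?(ltW C0)//.
  have -> : 2 ^+ k.+1 / s ^+ k.+1 = (s / 2) ^- k.+1.
    by rewrite exprMn exprVn invfM invrK mulrC.
  by rewrite lef_pV2 ?posrE ?exprn_gt0 ?divr_gt0// lerXn2r ?nnegrE ?divr_ge0 ?(ltW r0) ?(ltW s0).
apply: (@le_trans _ _ (gauss (2 * s ^+ 2) (z + t * d))).
  apply: ler_gauss; first by rewrite mulr_gt0 ?exprn_gt0.
  by rewrite ler_pM2l// -vr; lra.
rewrite -expRD ler_expR.
have -> : - (z + t * d) ^+ 2 / (2 * (2 * s ^+ 2)) = - (2 * (z + t * d) ^+ 2) / (8 * s ^+ 2).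
  by field; rewrite gt_eqF.
have -> : K ^+ 2 / 4 + - z ^+ 2 / (2 * (4 * s ^+ 2)) = (2 * K ^+ 2 * s ^+ 2 - z ^+ 2) / (8 * s ^+ 2).
  by field; rewrite gt_eqF.
rewrite ler_pM2r ?invr_gt0 ?mulr_gt0//.
have tdK : (t * d) ^+ 2 <= K ^+ 2.
  rewrite -real_normK ?num_real// lerXn2r ?nnegrE// normrM (ger0_norm t0).
  by rewrite (le_trans _ dK)// ler_piMl.
have s21 : 1 <= s ^+ 2 by rewrite exprn_ege1.
have Ks : K ^+ 2 <= K ^+ 2 * s ^+ 2 by rewrite ler_peMr ?sqr_ge0.
(* With [w = t * d] this square equals [2 (z + w)^2 - z^2 + 2 w^2]. *)
have := sqr_ge0 (z + 2 * (t * d)).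
move: (t * d) (s ^+ 2) (K ^+ 2) tdK Ks => w S L; nra.
Qed.

Lemma heat_path_up j k : exists2 C : R, 0 < C & forall s z d t,
  1 <= s -> 2 * D <= s ^+ 2 -> `|d| <= K -> 0 <= t <= 1 ->
  `|heat (j + k).+1 (s ^+ 2 - t * D) (z + t * d)| <= C * (s ^- k.+1 * gauss (4 * s ^+ 2) z).
Proof.
have [C C0 HC] := heat_path (j + k).
exists C => // s z d t s1 sD dK t01; apply: le_trans (HC _ _ _ _ s1 sD dK t01) _.
rewrite -[leLHS]mulrA ler_wpM2l ?(ltW C0)// ler_wpM2r ?(ltW (gauss_gt0 _ _))//.
have s0 : 0 < s by exact: lt_le_trans s1.
by rewrite lef_pV2 ?posrE ?exprn_gt0// ler_weXn2l// ltnS leq_addl.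
Qed.

Let is_derive_path k s z d t : 2 * D <= s ^+ 2 -> 0 <= t <= 1 ->
  is_derive t 1 (fun t => heat k (s ^+ 2 - t * D) (z + t * d))
   (d * heat k.+1 (s ^+ 2 - t * D) (z + t * d) - D / 2 * heat k.+2 (s ^+ 2 - t * D) (z + t * d)).
Proof.
move=> sD /andP[t0 t1].
have tD : t * D <= D by rewrite ler_piMl ?(ltW D0).
rewrite [X in is_derive _ _ _ X](_ : _ = d * heat k.+1 (s ^+ 2 - t * D) (z + t * d) +
  (- D) / 2 * heat k.+2 (s ^+ 2 - t * D) (z + t * d)); last by ring.
apply: is_derive_heat; first by have := D0; lra.
  by apply: is_derive_eq; rewrite /GRing.scale/=; ring.
by apply: is_derive_eq; rewrite /GRing.scale/=; ring.
Qed.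

(** At this precision the time derivative [- D / 2 * heat k.+2] is of the order of the remainder and
    is absorbed by it. *)
Lemma heat_Taylor2 k : exists2 C : R, 0 < C & forall s z d,
  1 <= s -> 2 * D <= s ^+ 2 -> `|d| <= K ->
  `|heat k (s ^+ 2 - D) (z + d) - heat k (s ^+ 2) z - d * heat k.+1 (s ^+ 2) z| <=
    C * (s ^- k.+2 * gauss (4 * s ^+ 2) z).
Proof.
have [C2 C20 H2] := heat_path_up 0 k.+1.
have [C3 C30 H3] := heat_path_up 1 k.+1.
have [C4 C40 H4] := heat_path_up 2 k.+1.
pose M := K ^+ 2 * C2 + K * D * C3 + D ^+ 2 / 4 * C4.
exists (M + D / 2 * C2).
  rewrite ltr_wpDl ?mulr_gt0 ?divr_gt0// /M.
  by rewrite !addr_ge0 ?mulr_ge0 ?divr_ge0 ?sqr_ge0 ?(ltW D0) ?(ltW C20) ?(ltW C30) ?(ltW C40).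
move=> s z d s1 sD dK; set g := _ * gauss _ _.
have g0 : 0 < g by rewrite mulr_gt0 ?gauss_gt0// invr_gt0 exprn_gt0// (lt_le_trans _ s1).
pose h j t := heat (j + k) (s ^+ 2 - t * D) (z + t * d).
have dh j t : 0 <= t <= 1 -> is_derive t 1 (h j) (d * h j.+1 t - D / 2 * h j.+2 t).
  exact: is_derive_path.
have t01 : 0 <= (0 : R) <= 1 by rewrite lexx ler01.
have h1 : h 0%N 1 = heat k (s ^+ 2 - D) (z + d) by rewrite /h !mul1r.
have h0 j : h j 0 = heat (j + k) (s ^+ 2) z by rewrite /h !mul0r subr0 addr0.
have hle j t C : 0 <= t <= 1 -> (forall s z d t,
    1 <= s -> 2 * D <= s ^+ 2 -> `|d| <= K -> 0 <= t <= 1 ->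
    `|heat (j + k.+1).+1 (s ^+ 2 - t * D) (z + t * d)| <=
    C * (s ^- k.+2 * gauss (4 * s ^+ 2) z)) -> `|h j.+2 t| <= C * g.
  by move=> t01' H; rewrite /h !addSn -addnS; exact: H.
have T : `|h 0%N 1 - h 0%N 0 - (d * h 1%N 0 - D / 2 * h 2%N 0)| <= M * g.
  have := @le_Taylor2 R (h 0%N) (fun t => d * h 1%N t - D / 2 * h 2%N t)
    (fun t => d * (d * h 2%N t - D / 2 * h 3%N t) - D / 2 * (d * h 3%N t - D / 2 * h 4%N t))
    (M * g) (dh 0%N) _ _ 1.
  rewrite mul1r; apply; last by rewrite ler01 lexx.
    move=> t t01'; have d1 := dh 1%N t t01'; have d2 := dh 2%N t t01'.
    by apply: is_derive_eq; rewrite /GRing.scale/=; ring.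
  move=> t t01'.
  have L2 := hle 0%N t C2 t01' H2; have L3 := hle 1%N t C3 t01' H3; have L4 := hle 2%N t C4 t01' H4.
  have -> : d * (d * h 2%N t - D / 2 * h 3%N t) - D / 2 * (d * h 3%N t - D / 2 * h 4%N t) =
    d ^+ 2 * h 2%N t + (- (D * d)) * h 3%N t + D ^+ 2 / 4 * h 4%N t by field.
  rewrite /M !(mulrDl _ _ g) -!(mulrA _ _ g); apply: le_trans (ler_normD _ _) _; apply: lerD; last first.
    apply: ler_normM => //.
    by rewrite ger0_norm// divr_ge0 ?sqr_ge0.
  apply: le_trans (ler_normD _ _) _; apply: lerD.
    apply: ler_normM => //.
    by rewrite normrX lerXn2r ?nnegrE.
  apply: ler_normM => //.
  by rewrite normrN mulrC; apply: ler_normM => //; rewrite ger0_norm ?(ltW D0).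
have h2 := hle 0%N 0 C2 t01 H2.
rewrite -h1 -(h0 0%N) -(h0 1%N).
have -> : h 0%N 1 - h 0%N 0 - d * h 1%N 0 =
  (h 0%N 1 - h 0%N 0 - (d * h 1%N 0 - D / 2 * h 2%N 0)) - D / 2 * h 2%N 0 by ring.
apply: le_trans (ler_normB _ _) _; rewrite (mulrDl _ _ g) -(mulrA _ _ g); apply: lerD => //.
by apply: ler_normM => //; rewrite ger0_norm// divr_ge0// ltW.
Qed.

(** A unit of time weighs as much as two space derivatives, hence the combination [d^2 - D]. The
    mixed term in [heat k.+3] and the second time derivative in [heat k.+4] go into the
    remainder. *)
Lemma heat_Taylor3 k : exists2 C : R, 0 < C & forall s z d,
  1 <= s -> 2 * D <= s ^+ 2 -> `|d| <= K ->
  `|heat k (s ^+ 2 - D) (z + d) - heat k (s ^+ 2) z - d * heat k.+1 (s ^+ 2) z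
     - (d ^+ 2 - D) / 2 * heat k.+2 (s ^+ 2) z| <=
    C * (s ^- k.+3 * gauss (4 * s ^+ 2) z).
Proof.
have [C3 C30 H3] := heat_path_up 0 k.+2.
have [C4 C40 H4] := heat_path_up 1 k.+2.
have [C5 C50 H5] := heat_path_up 2 k.+2.
have [C6 C60 H6] := heat_path_up 3 k.+2.
pose M := K ^+ 3 * C3 + 3 / 2 * D * K ^+ 2 * C4 + 3 / 4 * D ^+ 2 * K * C5 + D ^+ 3 / 8 * C6.
exists (M + D * K / 2 * C3 + D ^+ 2 / 8 * C4).
  rewrite ltr_wpDl ?mulr_gt0 ?divr_gt0 ?exprn_gt0// /M.
  by rewrite !addr_ge0 ?mulr_ge0 ?divr_ge0 ?exprn_ge0 ?(ltW D0) ?(ltW C50) ?(ltW C30) ?(ltW C40) ?(ltW C60).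
move=> s z d s1 sD dK; set g := _ * gauss _ _.
have g0 : 0 < g by rewrite mulr_gt0 ?gauss_gt0// invr_gt0 exprn_gt0// (lt_le_trans _ s1).
pose h j t := heat (j + k) (s ^+ 2 - t * D) (z + t * d).
have dh j t : 0 <= t <= 1 -> is_derive t 1 (h j) (d * h j.+1 t - D / 2 * h j.+2 t).
  exact: is_derive_path.
have t01 : 0 <= (0 : R) <= 1 by rewrite lexx ler01.
have h1 : h 0%N 1 = heat k (s ^+ 2 - D) (z + d) by rewrite /h !mul1r.
have h0 j : h j 0 = heat (j + k) (s ^+ 2) z by rewrite /h !mul0r subr0 addr0.
have hle j t C : 0 <= t <= 1 -> (forall s z d t,
    1 <= s -> 2 * D <= s ^+ 2 -> `|d| <= K -> 0 <= t <= 1 ->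
    `|heat (j + k.+2).+1 (s ^+ 2 - t * D) (z + t * d)| <=
    C * (s ^- k.+3 * gauss (4 * s ^+ 2) z)) -> `|h j.+3 t| <= C * g.
  have e : (j.+3 + k = (j + k.+2).+1)%N by rewrite !addSn !addnS.
  by move=> t01' H; rewrite /h e; exact: H.
have absD : `|D| <= D by rewrite ger0_norm ?(ltW D0).
have absX (x X : R) n : `|x| <= X -> `|x ^+ n| <= X ^+ n.
  by move=> xX; rewrite normrX lerXn2r ?nnegrE// (le_trans _ xX).
have absc (c : R) : 0 <= c -> `|c| <= c by move=> c0; rewrite ger0_norm.
have T : `|h 0%N 1 - h 0%N 0 - (d * h 1%N 0 - D / 2 * h 2%N 0)
   - (d * (d * h 2%N 0 - D / 2 * h 3%N 0) - D / 2 * (d * h 3%N 0 - D / 2 * h 4%N 0)) / 2| <= M * g.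
  apply: (@le_Taylor3 R (h 0%N) (fun t => d * h 1%N t - D / 2 * h 2%N t)
    (fun t => d * (d * h 2%N t - D / 2 * h 3%N t) - D / 2 * (d * h 3%N t - D / 2 * h 4%N t))
    (fun t => d * (d * (d * h 3%N t - D / 2 * h 4%N t) - D / 2 * (d * h 4%N t - D / 2 * h 5%N t))
      - D / 2 * (d * (d * h 4%N t - D / 2 * h 5%N t) - D / 2 * (d * h 5%N t - D / 2 * h 6%N t)))
    (M * g) (dh 0%N)) => t t01'.
  - have d1 := dh 1%N t t01'; have d2 := dh 2%N t t01'.
    by apply: is_derive_eq; rewrite /GRing.scale/=; ring.
  - have d2 := dh 2%N t t01'; have d3 := dh 3%N t t01'; have d4 := dh 4%N t t01'.
    by apply: is_derive_eq; rewrite /GRing.scale/=; ring.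
  have L3 := hle 0%N t C3 t01' H3; have L4 := hle 1%N t C4 t01' H4.
  have L5 := hle 2%N t C5 t01' H5; have L6 := hle 3%N t C6 t01' H6.
  rewrite [X in `|X|](_ : _ = d ^+ 3 * h 3%N t + (- (3 / 2 * D * d ^+ 2)) * h 4%N t
     + 3 / 4 * D ^+ 2 * d * h 5%N t - D ^+ 3 / 8 * h 6%N t); last by field.
  rewrite /M !(mulrDl _ _ g) -!(mulrA _ _ g); apply: le_trans (ler_normB _ _) _; apply: lerD; last first.
    by apply: ler_normM => //; apply: absc; rewrite divr_ge0 ?exprn_ge0 ?(ltW D0).
  apply: le_trans (ler_normD _ _) _; apply: lerD; last first.
    apply: ler_normM => //; apply: ler_normM => //; apply: ler_normM; last exact: absX.
    by apply: absc; rewrite divr_ge0.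
  apply: le_trans (ler_normD _ _) _; apply: lerD.
    by apply: ler_normM => //; exact: absX.
  apply: ler_normM => //; rewrite normrN; apply: ler_normM; last exact: absX.
  by apply: ler_normM => //; apply: absc; rewrite divr_ge0.
have L3 := hle 0%N 0 C3 t01 H3; have L4 := hle 1%N 0 C4 t01 H4.
rewrite -h1 -(h0 0%N) -(h0 1%N) -(h0 2%N).
rewrite [X in `|X|](_ : _ = h 0%N 1 - h 0%N 0 - (d * h 1%N 0 - D / 2 * h 2%N 0)
   - (d * (d * h 2%N 0 - D / 2 * h 3%N 0) - D / 2 * (d * h 3%N 0 - D / 2 * h 4%N 0)) / 2
   - D * d / 2 * h 3%N 0 + D ^+ 2 / 8 * h 4%N 0); last by field.
rewrite [leRHS](_ : _ = M * g + D * K / 2 * (C3 * g) + D ^+ 2 / 8 * (C4 * g)); last by ring.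
apply: le_trans (ler_normD _ _) _; apply: lerD; last first.
  by apply: ler_normM => //; apply: absc; rewrite divr_ge0 ?exprn_ge0 ?(ltW D0).
apply: le_trans (ler_normB _ _) _; apply: lerD => //.
apply: ler_normM => //; apply: ler_normM; first by apply: ler_normM.
by apply: absc; rewrite invr_ge0.
Qed.

End HeatPath.

(** * Elliptic environments *)

Section ContractiveMatrix.
Context {R : realType} {k : nat}.
Notation M := 'M[R]_k.+1.
Implicit Types B W : M.

Lemma nonneg_mulmx B W : nonneg_mx B -> nonneg_mx W -> nonneg_mx (B *m W).
Proof. by move=> B0 W0 i j; rewrite mxE sumr_ge0// => l _; rewrite mulr_ge0. Qed.

Lemma nonneg_exp B n : nonneg_mx B -> nonneg_mx (B ^+ n).
Proof.
move=> B0; elim: n => [|n IH]; first by move=> i j; rewrite expr0 mxE ler0n.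
by rewrite exprS; exact: nonneg_mulmx.
Qed.

Lemma mulmx1E B i : (B *m (const_mx 1 : 'cV_k.+1)) i 0 = \sum_j B i j.
Proof. by rewrite mxE; apply: eq_bigr => j _; rewrite mxE mulr1. Qed.

Lemma stochastic_sum B i : stochastic B -> \sum_j B i j = 1.
Proof. by move=> [_ B1]; rewrite -mulmx1E B1 mxE. Qed.

Lemma ler_mxnorm B i : nonneg_mx B -> \sum_j B i j <= mxnorm B.
Proof.
move=> B0; apply: (@le_trans _ _ (\sum_j `|B i j|)).
  by apply: ler_sum => j _; exact: ler_norm.
exact: (@le_bigmax _ _ _ _ (fun i => \sum_j `|B i j|)).
Qed.

(** A minimum principle: at a row where a column of [V] has a negative minimum, [B *m V] would be
    strictly larger than [V]. *)
Lemma contractive_ge0 p B (V : 'M[R]_(k.+1, p)) (e : R) : 0 < e -> nonneg_mx B ->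
  (forall i, \sum_j B i j <= 1 - e) ->
  (forall i j, 0 <= (V - B *m V) i j) -> forall i j, 0 <= V i j.
Proof.
move=> e0 B0 Be BV i j; pose i0 := [arg min_(i < ord0) V i j]%O.
have Vi0 l : V i0 j <= V l j.
  by rewrite /i0; case: arg_minP => // x _; apply.
apply: le_trans (Vi0 i); rewrite leNgt; apply/negP => V0.
have := BV i0 j; rewrite !mxE subr_ge0 leNgt => /negP; apply.
apply: (@lt_le_trans _ _ (\sum_l B i0 l * V i0 j)); last first.
  by apply: ler_sum => l _; rewrite ler_wpM2l.
rewrite -mulr_suml; have := Be i0; nra.
Qed.

Lemma unitmx_inj B : (forall v : 'cV_k.+1, B *m v = 0 -> v = 0) -> B \in unitmx.
Proof.
move=> Bv; rewrite -unitmx_tr -row_free_unit; apply/inj_row_free => v vB.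
by apply: trmx_inj; rewrite trmx0; apply: Bv; rewrite -[B]trmxK -trmx_mul vB trmx0.
Qed.

Lemma contractive_unit B (e : R) : 0 < e -> nonneg_mx B ->
  (forall i, \sum_j B i j <= 1 - e) -> 1 - B \in unitmx.
Proof.
move=> e0 B0 Be; apply: unitmx_inj => v; rewrite mulmxBl mul1mx => Bv.
have v0 := contractive_ge0 e0 B0 Be (V := v).
have v0' := contractive_ge0 e0 B0 Be (V := - v).
apply/colP => i; rewrite mxE; apply/eqP; rewrite eq_le; apply/andP; split.
  suff /(_ i 0) : forall i j, 0 <= (- v) i j by rewrite mxE oppr_ge0.
  by apply: v0' => l j; rewrite mulmxN opprK addrC -opprB Bv oppr0 mxE.
by apply: v0 => l j; rewrite Bv mxE.
Qed.

End ContractiveMatrix.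

(** * Resolvents with a stochastic matrix inside *)

Section Resolvent.
Context {R : realType} {k : nat}.
Notation M := 'M[R]_k.+1.
Variables (P Q Rm : M) (eps : R) (k0 : nat).
Hypotheses (P0 : nonneg_mx P) (Q0 : nonneg_mx Q) (R0 : nonneg_mx Rm).
Hypothesis PQR : (P + Q + Rm) *m (const_mx 1 : 'cV_k.+1) = const_mx 1.
Hypotheses (eps0 : 0 < eps) (Rk0 : mxnorm (Rm ^+ k0) <= 1 - eps).
Hypothesis GP : forall i j, eps <= (invmx (1 - Rm) *m P) i j.
Hypothesis GQ : forall i j, eps <= (invmx (1 - Rm) *m Q) i j.

Let Rk_sum i : \sum_j (Rm ^+ k0) i j <= 1 - eps.
Proof. exact: le_trans (ler_mxnorm _ (nonneg_exp k0 R0)) Rk0. Qed.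

(** Only the power [Rm ^+ k0] contracts, but a fixed vector of [Rm] is fixed by every power. *)
Lemma unitmx_1R : 1 - Rm \in unitmx.
Proof.
apply: unitmx_inj => v; rewrite mulmxBl mul1mx => /subr0_eq vR.
have : (1 - Rm ^+ k0) *m v = 0.
  rewrite mulmxBl mul1mx; apply/eqP; rewrite subr_eq0; apply/eqP.
  elim: k0 => [|n IH]; first by rewrite expr0 mul1mx.
  by rewrite exprS -[Rm * _]/(Rm *m _) -mulmxA -IH.
have u := contractive_unit eps0 (nonneg_exp k0 R0) Rk_sum.
by move/(congr1 (mulmx (invmx (1 - Rm ^+ k0)))); rewrite mulmxA mulVmx// mul1mx mulmx0.
Qed.

(** For the inverse [G], the difference [G - Rm ^+ n *m G] is the partial Neumann series, hence
    nonnegative; at [n = k0] the minimum principle applies. *)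
Lemma nonneg_inv_1R : nonneg_mx (invmx (1 - Rm)).
Proof.
set G := invmx _.
have GE : G - Rm *m G = 1%:M by rewrite -[X in X - _]mul1mx -mulmxBl mulmxV// unitmx_1R.
apply: (contractive_ge0 eps0 (nonneg_exp k0 R0) Rk_sum).
have H n i j : 0 <= (G - Rm ^+ n *m G) i j.
  elim: n i j => [|n IH] i j; first by rewrite expr0 mul1mx subrr mxE.
  have -> : G - Rm ^+ n.+1 *m G = 1%:M + Rm *m (G - Rm ^+ n *m G).
    by rewrite exprS -[Rm * _]/(Rm *m _) mulmxBr -GE mulmxA addrA subrK.
  rewrite mxE addr_ge0//; first by rewrite mxE ler0n.
  by apply: nonneg_mulmx.
exact: H.
Qed.

Variable W : M.
Hypothesis Wst : stochastic W.
Let G := invmx (1 - Rm).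
Let S := invmx (1 - Rm - Q *m W).

Let rowsum1 i : \sum_j (G *m P) i j + \sum_j (G *m Q) i j = 1.
Proof.
rewrite -!mulmx1E -mulmxA -(mulmxA G Q).
have e : P *m const_mx 1 + Q *m const_mx 1 = (1 - Rm) *m (const_mx 1 : 'cV[R]_k.+1).
  have h := PQR; rewrite !mulmxDl in h.
  by rewrite mulmxBl mul1mx -[X in _ = X - _]h addrK.
transitivity ((G *m (P *m const_mx 1 + Q *m const_mx 1) : 'cV[R]_k.+1) i 0).
  by rewrite mulmxDr [RHS]mxE.
by rewrite e mulmxA mulVmx ?unitmx_1R// mul1mx mxE.
Qed.

Let BW_ge0 : nonneg_mx (G *m Q *m W).
Proof.
by case: Wst => W0 _; apply: nonneg_mulmx => // i j; apply: le_trans (GQ i j); exact: ltW.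
Qed.

(** The rows of [G *m P] and [G *m Q] add up to 1 together, and ellipticity gives at least [eps] to
    the former; [W] does not change row sums. *)
Let BW_sum i : \sum_j (G *m Q *m W) i j <= 1 - eps.
Proof.
rewrite -mulmx1E -(mulmxA _ W) (proj2 Wst) mulmx1E -(rowsum1 i) addrAC ler_wpDl// subr_ge0.
apply: le_trans (GP i ord0) _; rewrite (bigD1 ord0)//= lerDl sumr_ge0// => j _.
by apply: le_trans (GP i j); exact: ltW.
Qed.

Let fact : 1 - Rm - Q *m W = (1 - Rm) *m (1 - G *m Q *m W).
Proof.
by rewrite mulmxBr mulmx1 -!mulmxA (mulmxA _ G) mulmxV ?unitmx_1R// mul1mx.
Qed.

Lemma unitmx_resolvent : 1 - Rm - Q *m W \in unitmx.
Proof.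
by rewrite fact unitmx_mul unitmx_1R (contractive_unit eps0 BW_ge0 BW_sum).
Qed.

(** A fixed point equation for [S *m F]. The minimum principle turns it into nonnegativity, and then
    into [S *m F >= G *m F], which transfers the ellipticity bounds from [G] to [S]. *)
Let resolventE (F : M) : S *m F - G *m Q *m W *m (S *m F) = G *m F.
Proof.
have h : (1 - Rm) *m ((1 - G *m Q *m W) *m S) = 1%:M.
  by rewrite mulmxA -fact mulmxV// unitmx_resolvent.
rewrite -[X in X - _]mul1mx -mulmxBl mulmxA; congr (_ *m _).
by rewrite -[RHS]mulmx1 -[X in _ = _ *m X]h [RHS]mulmxA mulVmx ?unitmx_1R// mul1mx.
Qed.

Let resolvent_mul_ge0 (F : M) : nonneg_mx F -> nonneg_mx (S *m F).
Proof.
move=> F0; apply: (contractive_ge0 eps0 BW_ge0 BW_sum) => i j.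
rewrite resolventE; apply: nonneg_mulmx => //; exact: nonneg_inv_1R.
Qed.

Lemma resolvent_ge0 : nonneg_mx S.
Proof. by rewrite -[S]mulmx1; apply: resolvent_mul_ge0 => i j; rewrite mxE ler0n. Qed.

Let resolvent_mul_ge (F : M) (e : R) : nonneg_mx F -> (forall i j, e <= (G *m F) i j) ->
  forall i j, e <= (S *m F) i j.
Proof.
move=> F0 GF i j; apply: le_trans (GF i j) _.
have := nonneg_mulmx BW_ge0 (resolvent_mul_ge0 F0) i j.
move=> h; rewrite -resolventE [leLHS]mxE [X in _ + X <= _]mxE.
by rewrite gerDl oppr_le0.
Qed.

Lemma resolventQ_ge i j : eps <= (S *m Q) i j.
Proof. exact: resolvent_mul_ge. Qed.

Lemma resolventP_ge i j : eps <= (S *m P) i j.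
Proof. exact: resolvent_mul_ge. Qed.

(** As [W] fixes the vector of ones, [P] and [1 - Rm - Q *m W] have the same row sums. *)
Lemma resolventP_stochastic : stochastic (S *m P).
Proof.
split; first exact: resolvent_mul_ge0.
have e : P *m const_mx 1 = (1 - Rm - Q *m W) *m (const_mx 1 : 'cV[R]_k.+1).
  have h := PQR; rewrite !mulmxDl in h.
  by rewrite !mulmxBl mul1mx -mulmxA (proj2 Wst) -[X in _ = X - _ - _]h !addrK.
by rewrite -mulmxA e mulmxA mulVmx ?unitmx_resolvent// mul1mx.
Qed.

End Resolvent.

Lemma cvg_sumr (R : realType) (I : Type) (r : seq I) (f : I -> nat -> R) (l : I -> R) :
  (forall i, f i @ \oo --> l i) ->
  (fun t => \sum_(i <- r) f i t) @ \oo --> \sum_(i <- r) l i.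
Proof.
move=> fl; elim: r => [|i r IH].
  rewrite big_nil; under eq_fun do rewrite big_nil; exact: cvg_cst.
rewrite big_cons; under eq_fun do rewrite big_cons.
by apply: cvgD => //; exact: fl.
Qed.

(** * The matrices of the environment and the fluxes *)

Section Environment.
Variables (R : realType) (k : nat).
Notation M := 'M[R]_k.+1.
Notation cV := 'cV[R]_k.+1.
Notation rV := 'rV[R]_k.+1.
Variables (P Q Rm zeta : int -> M) (eps : R) (k0 : nat).
Hypothesis env_ge0 : forall n, nonneg_mx (P n) /\ nonneg_mx (Q n) /\ nonneg_mx (Rm n).
Hypothesis env_sum : forall n, (P n + Q n + Rm n) *m (const_mx 1 : cV) = const_mx 1.
Hypothesis eps_gt0 : 0 < eps.
Hypothesis env_elliptic : forall n, mxnorm (Rm n ^+ k0) <= 1 - eps /\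
     (forall i j, eps <= (invmx (1 - Rm n) *m P n) i j) /\
     (forall i j, eps <= (invmx (1 - Rm n) *m Q n) i j).
Hypothesis zetaP : is_zeta P Q Rm zeta.

Let P_ge0 n : nonneg_mx (P n). Proof. by have [] := env_ge0 n. Qed.
Let Q_ge0 n : nonneg_mx (Q n). Proof. by have [_ []] := env_ge0 n. Qed.
Let R_ge0 n : nonneg_mx (Rm n). Proof. by have [_ []] := env_ge0 n. Qed.

Let Rk0 n : mxnorm (Rm n ^+ k0) <= 1 - eps. Proof. by have [] := env_elliptic n. Qed.
Let GP n : forall i j, eps <= (invmx (1 - Rm n) *m P n) i j.
Proof. by have [_ []] := env_elliptic n. Qed.
Let GQ n : forall i j, eps <= (invmx (1 - Rm n) *m Q n) i j.
Proof. by have [_ []] := env_elliptic n. Qed.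

Definition resolvent n := invmx (1 - Rm n - Q n *m zeta (n - 1)).

Let stochastic1 : stochastic (1 : M).
Proof. by split; [move=> i j; rewrite mxE ler0n|rewrite mul1mx]. Qed.

(** The limit [zeta] is the same for every stochastic start, and the identity matrix is taken.
    Counting from the right end [n] makes the recursion pass from [n - 1] to [n] with the left end
    unchanged. *)
Let psi n (t : nat) := psiN P Q Rm (fun=> 1) (n - t%:Z) t.

Let psiS n t : psi n t.+1 = invmx (1 - Rm n - Q n *m psi (n - 1) t) *m P n.
Proof.
have psiNS init a j : psiN P Q Rm init a j.+1 =
  invmx (1 - Rm (a + j.+1%:Z) - Q (a + j.+1%:Z) *m psiN P Q Rm init a j) *m P (a + j.+1%:Z) by [].
rewrite /psi psiNS subrK.
suff -> : n - t.+1%:Z = n - 1 - t%:Z by [].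
by rewrite -addn1 PoszD opprD addrA addrAC.
Qed.

Let psi_stochastic n t : stochastic (psi n t).
Proof.
elim: t n => [|t IH] n; first exact: stochastic1.
by rewrite psiS; exact: (resolventP_stochastic (P_ge0 n) (R_ge0 n) (env_sum n) eps_gt0 (Rk0 n) (GP n) (GQ n) (IH _)).
Qed.

Let psi_cvg n i j : (fun t => psi n t i j) @ \oo --> zeta n i j.
Proof. exact: zetaP. Qed.

Lemma zeta_stochastic n : stochastic (zeta n).
Proof.
split=> [i j|].
  apply: (cvgr_to_ge (@psi_cvg n i j)).
  apply: nearW => t.
  by have [] := psi_stochastic n t.
apply/colP => i; rewrite mulmx1E mxE.
have h := @cvg_sumr R _ (index_enum 'I_k.+1) (fun j t => psi n t i j) _ (@psi_cvg n i).
apply: (cvg_unique _ h); first exact: Rhausdorff.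
have -> : (fun t => \sum_j psi n t i j) = (fun=> 1).
  by apply/funext => t; rewrite stochastic_sum.
exact: cvg_cst.
Qed.

Lemma unitmx_resolventE n : 1 - Rm n - Q n *m zeta (n - 1) \in unitmx.
Proof. exact: (unitmx_resolvent (R_ge0 n) (env_sum n) eps_gt0 (Rk0 n) (GP n) (GQ n) (zeta_stochastic _)). Qed.

Let cvg_mulmx (A B : nat -> M) (A' B' : M) :
  (forall i j, (fun t => A t i j) @ \oo --> A' i j) ->
  (forall i j, (fun t => B t i j) @ \oo --> B' i j) ->
  forall i j, (fun t => (A t *m B t) i j) @ \oo --> (A' *m B') i j.
Proof.
move=> AA' BB' i j; rewrite mxE; under eq_fun do rewrite mxE.
by apply: (@cvg_sumr R _ _ (fun l t => A t i l * B t l j)) => l; exact: cvgM.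
Qed.

Lemma zetaE n : zeta n = resolvent n *m P n.
Proof.
(* The limit is taken in the recursion multiplied out, which involves only sums and products of
   entries; the inverse is formed afterwards. *)
have ueq : (1 - Rm n - Q n *m zeta (n - 1)) *m zeta n = P n.
  apply/matrixP => i j.
  have psiS_cvg i' j' : (fun t => psi n t.+1 i' j') @ \oo --> zeta n i' j'.
    by have := @psi_cvg n i' j'; rewrite -cvg_shiftS.
  have uS i' j' : (fun t => (1 - Rm n - Q n *m psi (n - 1) t) i' j') @ \oo -->
      (1 - Rm n - Q n *m zeta (n - 1)) i' j'.
    rewrite [X in _ --> X]mxE [X in _ --> _ + X]mxE.
    have -> : (fun t => (1 - Rm n - Q n *m psi (n - 1) t) i' j') =
        (fun t => (1 - Rm n) i' j' - (Q n *m psi (n - 1) t) i' j').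
      by apply/funext => t; rewrite [LHS]mxE [X in _ + X]mxE.
    apply: cvgB; first exact: cvg_cst.
    by apply: cvg_mulmx => // i'' j''; exact: cvg_cst.
  have h := @cvg_mulmx _ _ _ _ uS psiS_cvg i j.
  apply: (cvg_unique _ h); first exact: Rhausdorff.
  have -> : (fun t => ((1 - Rm n - Q n *m psi (n - 1) t) *m psi n t.+1) i j) = (fun=> P n i j).
    apply/funext => t; rewrite psiS mulmxA mulmxV ?mul1mx//.
    exact: (unitmx_resolvent (R_ge0 n) (env_sum n) eps_gt0 (Rk0 n) (GP n) (GQ n) (psi_stochastic _ _)).
  exact: cvg_cst.
by rewrite -ueq mulmxA mulVmx ?mul1mx// unitmx_resolventE.
Qed.

Lemma zeta_ge n i j : eps <= zeta n i j.
Proof.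
rewrite zetaE.
exact: (resolventP_ge (P_ge0 n) (R_ge0 n) (env_sum n) eps_gt0 (Rk0 n) (GP n) (GQ n) (zeta_stochastic _)).
Qed.

Lemma AmxE n : Amx Q Rm zeta n = resolvent n *m Q n. Proof. by []. Qed.

Lemma Amx_ge n i j : eps <= Amx Q Rm zeta n i j.
Proof. exact: (resolventQ_ge (Q_ge0 n) (R_ge0 n) (env_sum n) eps_gt0 (Rk0 n) (GP n) (GQ n) (zeta_stochastic _)). Qed.

Lemma resolventn_ge0 n : nonneg_mx (resolvent n).
Proof. exact: (resolvent_ge0 (R_ge0 n) (env_sum n) eps_gt0 (Rk0 n) (GP n) (GQ n) (zeta_stochastic _)). Qed.

Variables (zm : int -> M) (mm : int -> cV) (rho : int -> rV) (K B : R).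
Hypothesis mm_step : forall (n1 n2 : int) (i1 i2 : 'I_k.+1),
     `|n1 - n2| <= 1 -> `|mm n1 i1 0 - mm n2 i2 0| <= K.
Hypothesis zm_stochastic : forall n, stochastic (zm n).
Hypothesis rho_gt0 : forall n j, 0 < rho n 0 j.
Hypothesis rho_le : forall n j, rho n 0 j <= B.
Hypothesis rho_alpha : forall n, rho n = rho (n + 1) *m alpha Q Rm zeta n.
Hypothesis rho_norm : forall n, (rho n *m P n *m (mm (n + 1) - zm (n + 1) *m mm n)) 0 0
             = (2 * (k.+1)%:R)^-1.

(** The downward flux of the measure [rho] from layer [n + 1], split according to the entrance point
    in layer [n]. *)
Definition lam n : rV := rho (n + 1) *m Q (n + 1).

Lemma lam_resolvent n : lam n *m resolvent n = rho n.
Proof. by rewrite /lam -mulmxA -rho_alpha. Qed.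

Lemma lam_Amx n : lam n *m Amx Q Rm zeta n = lam (n - 1).
Proof. by rewrite AmxE mulmxA lam_resolvent /lam subrK. Qed.

Let lam_ge0 n i : 0 <= lam n 0 i.
Proof. by rewrite mxE sumr_ge0// => j _; rewrite mulr_ge0 ?(ltW (rho_gt0 _ _)) ?Q_ge0. Qed.

(** Downward and upward flux through the edge agree, because [zeta n = resolvent n *m P n] is
    stochastic. *)
Lemma lam_sum n : \sum_i lam n 0 i = \sum_i (rho n *m P n) 0 i.
Proof.
have E (v : rV) : \sum_i v 0 i = (v *m (const_mx 1 : cV)) 0 0.
  rewrite mxE; apply: eq_bigr => i _. by rewrite mxE mulr1.
rewrite !E -lam_resolvent -!mulmxA (mulmxA (resolvent n)) -zetaE.
by rewrite (proj2 (zeta_stochastic n)).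
Qed.

(** The entries of [mm (n + 1) - zm (n + 1) *m mm n] are averages of increments of [mm], hence at
    most [K], so the normalisation of [rho] bounds the flux from below. *)
Lemma lam_sum_ge n : (2 * (k.+1)%:R)^-1 <= K * \sum_i lam n 0 i.
Proof.
rewrite lam_sum -(rho_norm n) mxE mulr_sumr; apply: ler_sum => i _.
have v0 : 0 <= (rho n *m P n) 0 i.
  by rewrite mxE sumr_ge0// => j _; rewrite mulr_ge0 ?(ltW (rho_gt0 _ _)) ?P_ge0.
rewrite mulrC ler_wpM2r//.
have <- : \sum_j zm (n + 1) i j * (mm (n + 1) i 0 - mm n j 0) =
    (mm (n + 1) - zm (n + 1) *m mm n) i 0.
  rewrite !mxE; under eq_bigr do rewrite mulrBr.
  by rewrite sumrB -mulr_suml stochastic_sum// mul1r.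
rewrite -[leRHS]mul1r -(stochastic_sum i (zm_stochastic (n + 1))) mulr_suml.
apply: ler_sum => j _; rewrite ler_wpM2l//; first by have [] := zm_stochastic (n + 1).
by apply: le_trans (ler_norm _) (mm_step _ _ _); rewrite addrAC subrr add0r normr1.
Qed.

(** One application of [lam_Amx] spreads the total flux at [n + 1] over all entries at [n], those of
    the matrix being at least [eps]. *)
Lemma lam_ge n i : eps * (2 * (k.+1)%:R)^-1 <= K * lam n 0 i.
Proof.
rewrite -[X in lam X](addrK 1) -lam_Amx mxE.
apply: (@le_trans _ _ (K * (eps * \sum_j lam (n + 1) 0 j))).
  by rewrite mulrCA ler_wpM2l ?(ltW eps_gt0)// lam_sum_ge.
have K0 : 0 <= K by apply: le_trans (mm_step (n1 := 0) (n2 := 0) ord0 ord0 _); rewrite ?subrr ?normr0.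
rewrite ler_wpM2l// mulr_sumr; apply: ler_sum => j _.
by rewrite mulrC ler_wpM2l// Amx_ge.
Qed.

Lemma lam_le n i : lam n 0 i <= (k.+1)%:R * B.
Proof.
apply: (@le_trans _ _ (\sum_i lam n 0 i)).
  by rewrite (bigD1 i)//= lerDl sumr_ge0.
rewrite lam_sum; apply: (@le_trans _ _ (\sum_i \sum_j rho n 0 j * P n j i)).
  by apply: ler_sum => j _; rewrite mxE.
rewrite exchange_big/=.
apply: (@le_trans _ _ (\sum_(j < k.+1) B)); last by rewrite sumr_const card_ord mulr_natl.
apply: ler_sum => j _; rewrite -mulr_sumr.
apply: le_trans (rho_le n j); rewrite ler_piMr ?(ltW (rho_gt0 _ _))//.
have := congr1 (fun v : cV => v j 0) (env_sum n).
rewrite mulmx1E mxE => <-; apply: ler_sum => i' _; rewrite !mxE -addrA lerDl addr_ge0//.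
  exact: Q_ge0.
exact: R_ge0.
Qed.

End Environment.

(** * From window averages to increments *)

Lemma leq_half_of_ltn (m l : nat) : ((2 * m).+1 < l)%N -> (m <= l./2)%N.
Proof. lia. Qed.

Lemma ler_int_mid (N l : nat) (c : int) : (0 < N)%N -> `|c| <= (2 * N + 5)%N%:Z ->
  `|c + l%:Z| <= (2 * N + 5)%N%:Z -> `|c + (l./2)%:Z| <= (10 * N)%N%:Z.
Proof.
move=> N0 cN lN; have : (l./2 <= l)%N by rewrite leq_half_double -addnn; lia.
by move: (l./2) => L; lia.
Qed.

Lemma int_distD (n c : int) : c <= n -> n = c + `|n - c|%N%:Z.
Proof. lia. Qed.

Section Window.
Context {R : realType}.
Variables (beta : R).
Hypothesis beta01 : 0 < beta <= 4^-1.

Lemma powR_1B (x : R) : 0 < x -> x `^ (1 - beta) = x * x `^ (- beta).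
Proof.
by move=> x0; rewrite powRD ?(gt_eqF x0) ?implybT// powRr1// ltW.
Qed.

Lemma powRN_le1 (s : R) : 1 <= s -> 0 < s `^ (- beta) <= 1.
Proof.
move=> s1; have s0 : 0 < s by exact: lt_le_trans s1.
rewrite powR_gt0//= powRN invf_le1 ?powR_gt0//.
by rewrite -(powRr0 s) ler_powR// (ltW (proj1 (andP beta01))).
Qed.

Lemma ler_powRN (s x : R) : 0 < s -> s <= x -> x `^ (- beta) <= s `^ (- beta).
Proof.
move=> s0 sx; have x0 : 0 < x by exact: lt_le_trans sx.
have /andP[b0 _] := beta01.
by rewrite !powRN lef_pV2 ?posrE ?powR_gt0// ge0_ler_powR ?nnegrE ?(ltW s0) ?(ltW x0) ?(ltW b0).
Qed.

Lemma powR_1B_lin (s x : R) : 0 < s -> 0 < x -> x `^ (1 - beta) <= s `^ (- beta) * (s + x).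
Proof.
move=> s0 x0; have /andP[b0 b4] := beta01.
have h0 : 0 <= s `^ (- beta) by exact: powR_ge0.
have [xs|sx] := leP x s.
  apply: (@le_trans _ _ (s `^ (1 - beta))).
    by rewrite ge0_ler_powR ?nnegrE ?(ltW s0) ?(ltW x0)//; lra.
  by rewrite powR_1B// mulrC ler_wpM2l// lerDl ltW.
rewrite powR_1B// mulrC; apply: ler_pM; rewrite ?powR_ge0 ?(ltW x0)//.
  by rewrite ler_powRN// ltW.
by rewrite lerDr ltW.
Qed.

Lemma sqrt_le_powRN (s : R) : 1 <= s -> Num.sqrt s <= s `^ (- beta) * s.
Proof.
move=> s1; have s0 : 0 < s by exact: lt_le_trans s1.
have /andP[b0 b4] := beta01.
by rewrite mulrC -powR_1B// -powR12_sqrt ?(ltW s0)// ler_powR//; lra.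
Qed.

(** With [q = sqrt s] one has [N <= q^8]; if [L] is at least 2 and at least [q], then
    [10 N <= 2^92 q^8 <= L^100]. The factor 10 leaves room for the midpoints of the windows used
    below. *)
Lemma threshold (N : nat) (s : R) : 1 <= s -> N%:R <= s ^+ 4 ->
  exists2 L0 : nat, L0%:R <= 3 * Num.sqrt s & forall L, (L0 <= L)%N ->
    (0 < L)%N /\ ((10 * N)%N%:R : R) `^ (100%:R^-1) <= L%:R.
Proof.
move=> s1 Ns; have s0 : 0 < s by exact: lt_le_trans s1.
set q := Num.sqrt s.
have q0 : 0 <= q by rewrite sqrtr_ge0.
have q1 : 1 <= q by rewrite -sqrtr1 ler_sqrt// ltW.
have /andP[tq qt] := truncn_itv q0.
exists (Num.truncn q).+2; first by rewrite -[X in X <= _]/((Num.truncn q).+2)%:R -2!natr1; lra.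
move=> L L0L; split; first exact: leq_trans L0L.
have qL : q <= L%:R.
  by apply: le_trans (ltW qt) _; rewrite ler_nat (leq_trans _ L0L).
have L2 : 2 <= L%:R :> R by rewrite ler_nat (leq_trans _ L0L).
apply: (@le_trans _ _ ((L%:R ^+ 100) `^ (100%:R^-1))); last first.
  by rewrite -powR_mulrn// -powRrM divff// powRr1.
rewrite ge0_ler_powR ?nnegrE// natrM.
apply: (@le_trans _ _ (2 ^+ 92 * q ^+ 8)).
  apply: ler_pM => //; first by rewrite -natrX ler_nat; exact: isT.
  by rewrite (exprM q 2 4) sqr_sqrtr// ltW.
rewrite -[100%N]/(92 + 8)%N exprD; apply: ler_pM; rewrite ?exprn_ge0//.
  by rewrite lerXn2r ?nnegrE.
by rewrite lerXn2r ?nnegrE.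
Qed.

Variables (F : int -> R) (K C : R).
Hypothesis C0 : 0 <= C.
Hypothesis Fstep : forall n, `|F (n + 1) - F n| <= K.
Hypothesis Fwin : forall (N L : nat) (c : int), (0 < N)%N ->
  (N%:R : R) `^ (100%:R^-1) <= L%:R -> `|c| <= N%:Z ->
  `|F (c + L%:Z) - F (c - L%:Z)| <= C * L%:R `^ (1 - beta).

Let Fsteps n (l : nat) : `|F (n + l%:Z) - F n| <= K * l%:R.
Proof.
elim: l => [|l IH]; first by rewrite addr0 subrr normr0 mulr0.
rewrite -addn1 PoszD addrA natrD mulrDr mulr1.
have -> : F (n + l + 1) - F n = (F (n + l + 1) - F (n + l)) + (F (n + l) - F n) by ring.
by rewrite [leRHS]addrC (le_trans (ler_normD _ _))// lerD.
Qed.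

(** It serves twice: for [mm n - n] and for the primitive of [rho (qvec - D)]. An increment of
    length [l] is a window around its midpoint plus at most one step for parity; lengths below the
    threshold are bounded step by step. *)
Lemma window_bound : exists2 C' : R, 0 < C' & forall (N : nat) (s : R), (0 < N)%N ->
  1 <= s -> N%:R <= s ^+ 4 -> forall n c : int,
  `|n| <= (2 * N + 5)%N%:Z -> `|c| <= (2 * N + 5)%N%:Z ->
  `|F n - F c| <= C' * (s `^ (- beta) * (s + `|n - c|%:~R)).
Proof.
have K0 : 0 <= K by apply: le_trans (Fstep 0).
exists (8 * K + C + 1); first by rewrite ltr_wpDl// addr_ge0// mulr_ge0.
move=> N s N0 s1 Ns.
have s0 : 0 < s by exact: lt_le_trans s1.
have h0 : 0 < s `^ (- beta) by rewrite powR_gt0.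
have sh := sqrt_le_powRN s1.
wlog suff W : / forall (l : nat) (c : int), `|c| <= (2 * N + 5)%N%:Z ->
   `|c + l%:Z| <= (2 * N + 5)%N%:Z ->
   `|F (c + l%:Z) - F c| <= (8 * K + C + 1) * (s `^ (- beta) * (s + l%:R)).
  move=> n c nN cN; have [cn|nc] := leP c n.
    have e := int_distD cn.
    have := W `|n - c|%N c cN; rewrite -e => /(_ nN).
    by rewrite -[(`|n - c|%N)%:R]/((`|n - c|%N%:Z)%:~R) abszE.
  have e := int_distD (ltW nc).
  have := W `|c - n|%N n nN; rewrite -e => /(_ cN).
  by rewrite -[(`|c - n|%N)%:R]/((`|c - n|%N%:Z)%:~R) abszE distrC [in X in _ <= X -> _]distrC.
move=> l c cN lN.
have [L0 L0s HL0] := threshold s1 Ns.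
have [lL0|L0l] := leqP l (2 * L0).+1.
  apply: le_trans (Fsteps c l) _.
  have q1 : 1 <= Num.sqrt s by rewrite -sqrtr1 ler_sqrt// ltW.
  (* Here [l <= 2 * L0 + 1 <= 7 * sqrt s], and [sqrt s <= s^(1 - beta)]. *)
  have l7 : l%:R <= 7 * (s `^ (- beta) * s).
    apply: (@le_trans _ _ (2 * L0 + 1)%N%:R); first by rewrite ler_nat addn1.
    rewrite natrD natrM; lra.
  have hl := mulr_ge0 (ltW h0) (ler0n R l).
  have Kl := ler_wpM2l K0 l7.
  have hs : 0 <= s `^ (- beta) * (s + l%:R) by rewrite mulrDr addr_ge0// mulr_ge0 ?(ltW h0) ?(ltW s0).
  have h1 : 8 * K * (s `^ (- beta) * s) <= 8 * K * (s `^ (- beta) * (s + l%:R)).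
    by rewrite ler_wpM2l ?mulr_ge0// mulrDr lerDl.
  have h2 := mulr_ge0 C0 hs.
  have h3 : 0 <= K * (s `^ (- beta) * s) by rewrite !mulr_ge0 ?(ltW h0) ?(ltW s0).
  rewrite !mulrDl mul1r; lra.
set L := l./2.
have L0L : (L0 <= L)%N by exact: leq_half_of_ltn.
have [L_gt0 HL] := HL0 L L0L.
have LR : 0 < L%:R :> R by rewrite ltr0n.
have cL : `|c + L%:Z| <= (10 * N)%N%:Z by exact: ler_int_mid.
have h1 : `|F (c + (2 * L)%N%:Z) - F c| <= C * (s `^ (- beta) * (s + L%:R)).
  have := Fwin _ HL cL; rewrite muln_gt0/= => /(_ N0).
  rewrite addrK -addrA -PoszD addnn -mul2n => /le_trans; apply.
  by rewrite ler_wpM2l// powR_1B_lin.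
have h2 : `|F (c + l%:Z) - F (c + (2 * L)%N%:Z)| <= K.
  have e : l = (2 * L + odd l)%N by rewrite /L mul2n addnC odd_double_half.
  rewrite {1}e PoszD addrA; case: (odd l) => /=; last by rewrite addr0 subrr normr0.
  exact: Fstep.
have -> : F (c + l%:Z) - F c = (F (c + l%:Z) - F (c + (2 * L)%N%:Z)) + (F (c + (2 * L)%N%:Z) - F c) by ring.
apply: le_trans (ler_normD _ _) _.
have q1 : 1 <= Num.sqrt s by rewrite -sqrtr1 ler_sqrt// ltW.
have Ll : L%:R <= l%:R :> R by rewrite ler_nat /L leq_half_double -addnn -addSn leq_addl.
set h := s `^ (- beta) in h0 sh h1 *.
have hL := ler_wpM2l (ltW h0) Ll; have hL0 := mulr_ge0 (ltW h0) (ltW LR).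
have : C * (h * (s + L%:R)) <= C * (h * (s + l%:R)) by rewrite ler_wpM2l// !mulrDr; lra.
have : K * 1 <= K * (h * (s + l%:R)) by rewrite ler_wpM2l// mulrDr; lra.
rewrite mulr1 => k1 k2.
have k4 : 0 <= h * (s + l%:R) by rewrite mulr_ge0// ?(ltW h0) ?addr_ge0 ?(ltW s0).
have k5 : 0 <= K * (h * (s + l%:R)) by rewrite mulr_ge0.
move: (h * (s + l%:R)) k1 k2 k4 k5 => X k1 k2 k4 k5; rewrite !mulrDl; lra.
Qed.

End Window.

(** * The Poisson equation *)

Lemma dist_int_step (n n' c : int) : `|n - n'| <= 1 -> `|n - c| <= `|n' - c| + 1.
Proof. lia. Qed.

Lemma win_left (N j : nat) : (j <= 2 * N + 6)%N -> `|- (N + 3)%N%:Z + j%:Z| <= (2 * N + 5)%N%:Z.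
Proof. lia. Qed.

Lemma win_center (N : nat) (c : int) : `|c| <= (N + 2)%N%:Z -> `|c| <= (2 * N + 5)%N%:Z.
Proof. lia. Qed.

Lemma dist_succ (n : int) (j : nat) : `|(n + j%:Z) - (n + j.+1%:Z)| <= 1.
Proof. lia. Qed.

Lemma above_succ (n n0 : int) : n0 < n -> exists j : nat, n = n0 + j.+1%:Z.
Proof. by move=> n0n; exists (absz (n - n0)%R).-1; lia. Qed.

Lemma absz_addK (n0 : int) (j : nat) : absz (n0 + j%:Z - n0)%R = j.
Proof. lia. Qed.

Lemma win_index (N : nat) (n : int) : `|n| <= (N + 3)%N%:Z ->
  exists2 j : nat, (j <= 2 * N + 6)%N & n = - (N + 3)%N%:Z + j%:Z.
Proof. by move=> nN; exists (absz (n + (N + 3)%N%:Z)%R); lia. Qed.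

Lemma toward_center (N l : nat) (n c : int) : `|c| <= (N + 2)%N%:Z -> `|n| <= (N + 3)%N%:Z ->
  `|n - c| = l.+1%:Z -> exists n', [/\ `|n' - c| = l%:Z, `|n - n'| <= 1 & `|n'| <= (N + 3)%N%:Z].
Proof.
move=> cN nN ncl; have [cn|nc] := leP c n; first by exists (n - 1); split; lia.
by exists (n + 1); split; lia.
Qed.

Lemma int_near (n n' : int) : `|n' - n| <= 1 -> [\/ n' = n, n' = n + 1 | n' = n - 1].
Proof.
move=> h; have [->|] := eqVneq n' n; first by constructor 1.
have [->|] := eqVneq n' (n + 1); first by constructor 2.
by move=> h1 h2; constructor 3; lia.
Qed.

Lemma win_succ (N : nat) (n : int) : `|n| <= (N + 3)%N%:Z -> `|n + 1| <= (N + 3)%N%:Z ->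
  n < (N + 3)%N%:Z.
Proof. lia. Qed.

Lemma below_succ (n n1 : int) : n < n1 -> exists j : nat, n = n1 - j.+1%:Z.
Proof. by move=> nn1; exists (absz (n1 - n)%R).-1; lia. Qed.

Lemma absz_subK (n1 : int) (j : nat) : absz (n1 - (n1 - j%:Z))%R = j.
Proof. lia. Qed.

Lemma win_right (N j : nat) : (j <= 2 * N + 6)%N -> `|(N + 3)%N%:Z - j%:Z| <= (N + 3)%N%:Z.
Proof. lia. Qed.

Lemma win_index_right (N : nat) (n : int) : `|n| <= (N + 3)%N%:Z ->
  exists2 j : nat, (j <= 2 * N + 6)%N & n = (N + 3)%N%:Z - j%:Z.
Proof. by move=> nN; exists (absz ((N + 3)%N%:Z - n)%R); lia. Qed.

Lemma dist_pred (n : int) (j : nat) : `|(n - j%:Z) - (n - j.+1%:Z)| <= 1.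
Proof. lia. Qed.

Lemma win_inner (N : nat) (n : int) : `|n| <= (N + 1)%N%:Z ->
  [/\ - (N + 3)%N%:Z < n, n < (N + 3)%N%:Z & n - 1 < (N + 3)%N%:Z].
Proof. by move=> nN; split; lia. Qed.

Lemma win_weak (N : nat) (n : int) : `|n| <= (N + 2)%N%:Z -> `|n| <= (N + 3)%N%:Z.
Proof. lia. Qed.

Section Corrector.
Variables (R : realType) (k : nat).
Notation M := 'M[R]_k.+1.
Notation cV := 'cV[R]_k.+1.
Notation rV := 'rV[R]_k.+1.
(* The generator factorises: if g n = zeta n *m g (n + 1) + d n, then the equation
   P n *m g (n + 1) + Rm n *m g n + Q n *m g (n - 1) - g n = f n
   becomes d n = A n *m d (n - 1) - S n *m f n. *)
Variables (P Q Rm zeta S A : int -> M) (lam rho : int -> rV) (f : int -> cV).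
Variables (e c1 Bl B Cf C1 beta : R) (Sig : int -> R).
Hypothesis beta01 : 0 < beta <= 4^-1.
Hypothesis e_gt0 : 0 < e.
Hypothesis env_sum : forall n, (P n + Q n + Rm n) *m (const_mx 1 : cV) = const_mx 1.
Hypothesis zeta_st : forall n, stochastic (zeta n).
Hypothesis zeta_ge : forall n i j, e <= zeta n i j.
Hypothesis S_inv : forall n, (1 - Rm n - Q n *m zeta (n - 1)) *m S n = 1.
Hypothesis S_ge0 : forall n, nonneg_mx (S n).
Hypothesis zeta_S : forall n, zeta n = S n *m P n.
Hypothesis A_S : forall n, A n = S n *m Q n.
Hypothesis A_ge : forall n i j, e <= A n i j.
Hypothesis lamS : forall n, lam n *m S n = rho n.
Hypothesis lamA : forall n, lam n *m A n = lam (n - 1).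
Hypothesis c1_gt0 : 0 < c1.
Hypothesis lam_gec : forall n i, c1 <= lam n 0 i.
Hypothesis lam_leB : forall n i, lam n 0 i <= Bl.
Hypothesis rho_ge0 : forall n i, 0 <= rho n 0 i.
Hypothesis rho_leB : forall n i, rho n 0 i <= B.
Hypothesis f_le : forall n i, `|f n i 0| <= Cf.
Hypothesis SigE : forall n, Sig n - Sig (n - 1) = (rho n *m f n) 0 0.
Hypothesis C1_gt0 : 0 < C1.
Hypothesis Sig_le : forall (N : nat) (s : R), (0 < N)%N ->
  1 <= s -> N%:R <= s ^+ 4 -> forall n c : int,
  `|n| <= (2 * N + 5)%N%:Z -> `|c| <= (2 * N + 5)%N%:Z ->
  `|Sig n - Sig c| <= C1 * (s `^ (- beta) * (s + `|n - c|%:~R)).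

Let Bl_gt0 : 0 < Bl.
Proof. by apply: lt_le_trans (lam_leB 0 ord0); exact: lt_le_trans (lam_gec 0 ord0). Qed.
Let lam_gt0 n i : 0 < lam n 0 i. Proof. exact: lt_le_trans (lam_gec n i). Qed.
Let Cf_ge0 : 0 <= Cf. Proof. exact: le_trans (f_le 0 ord0). Qed.
Let B_ge0 : 0 <= B. Proof. exact: le_trans (rho_ge0 0 ord0) (rho_leB 0 ord0). Qed.

(** With these weights [A n] does not expand from layer [n - 1] to layer [n], since
    [lam n *m A n = lam (n - 1)]. *)
Definition wnorm n (d : cV) := \sum_i lam n 0 i * `|d i 0|.

Lemma wnorm_ge n (d : cV) i : `|d i 0| <= c1^-1 * wnorm n d.
Proof.
rewrite ler_pdivlMl//; apply: (@le_trans _ _ (lam n 0 i * `|d i 0|)).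
  by rewrite ler_wpM2r.
rewrite /wnorm (bigD1 i)//= lerDl sumr_ge0// => j _; rewrite mulr_ge0//.
exact: ltW.
Qed.

(** A Doeblin constant: each row of [A n] dominates [kap] times [lam (n - 1)]. Then [th] is a common
    contraction rate, [kap * c1] for [A] in [wnorm] and [e] for [zeta] in oscillation. *)
Let kap := e / Bl.
Let th := Num.min (kap * c1) e.

Let kap_gt0 : 0 < kap. Proof. exact: divr_gt0. Qed.

Let A_kap n i j : kap * lam (n - 1) 0 j <= A n i j.
Proof.
apply: le_trans (A_ge n i j); rewrite /kap mulrAC ler_pdivrMr//.
by rewrite ler_wpM2l ?(ltW e_gt0).
Qed.

Let kap_sum n : c1 <= \sum_i lam n 0 i.
Proof.
by rewrite (bigD1 ord0)//= ler_wpDr// sumr_ge0// => i _; exact: ltW.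
Qed.

Let kap_sum_le1 n : kap * \sum_i lam n 0 i <= 1.
Proof.
have h : \sum_i lam n 0 i * (kap * lam (n - 1) 0 ord0) <= lam (n - 1) 0 ord0.
  rewrite -[X in _ <= X](congr1 (fun v : rV => v 0 ord0) (lamA n)) mxE.
  by apply: ler_sum => i _; rewrite ler_wpM2l ?(ltW (lam_gt0 _ _)).
rewrite -mulr_suml mulrA [X in X * _]mulrC in h.
by rewrite -(ler_pM2r (lam_gt0 (n - 1) ord0)) mul1r.
Qed.

(* A n exceeds the rank one matrix kap *: const_mx 1 *m lam (n - 1), so it contracts
   wnorm on the kernel of lam (n - 1). *)
Lemma wnorm_step n (d : cV) : wnorm n (A n *m d - S n *m f n) <=
  (1 - th) * wnorm (n - 1) d + `|(lam (n - 1) *m d) 0 0| + (k.+1)%:R * B * Cf.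
Proof.
set L := \sum_i lam n 0 i.
have SF : \sum_i lam n 0 i * `|(S n *m f n) i 0| <= (k.+1)%:R * B * Cf.
  apply: (@le_trans _ _ (\sum_i \sum_j lam n 0 i * S n i j * Cf)).
    apply: ler_sum => i _; rewrite mxE.
    apply: le_trans (ler_wpM2l (ltW (lam_gt0 n i)) (ler_norm_sum _ _ _)) _.
    rewrite mulr_sumr; apply: ler_sum => j _.
    rewrite normrM (ger0_norm (S_ge0 n i j)) mulrA ler_wpM2l//.
    by rewrite mulr_ge0 ?(ltW (lam_gt0 n i)) ?S_ge0.
  rewrite exchange_big/=.
  apply: (@le_trans _ _ (\sum_(j < k.+1) B * Cf)).
    apply: ler_sum => j _; rewrite -mulr_suml ler_wpM2r//.
    by rewrite (le_trans _ (rho_leB n j))// -lamS mxE.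
  by rewrite sumr_const card_ord -[leLHS]mulr_natl mulrA.
have AD : \sum_i lam n 0 i * `|(A n *m d) i 0| <=
  (1 - kap * L) * wnorm (n - 1) d + kap * L * `|(lam (n - 1) *m d) 0 0|.
  set s := `|_|.
  apply: (@le_trans _ _ (\sum_i (\sum_j lam n 0 i * ((A n i j - kap * lam (n - 1) 0 j) * `|d j 0|) + lam n 0 i * kap * s))).
    apply: ler_sum => i _.
    rewrite -mulr_sumr -mulrA -mulrDr ler_wpM2l ?(ltW (lam_gt0 n i))//.
    have -> : (A n *m d) i 0 = \sum_j (A n i j - kap * lam (n - 1) 0 j) * d j 0 + kap * (lam (n - 1) *m d) 0 0.
      rewrite !mxE mulr_sumr -big_split; apply: eq_bigr => j _ /=; ring.
    apply: le_trans (ler_normD _ _) _; rewrite normrM (ger0_norm (ltW kap_gt0)) lerD2r.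
    apply: le_trans (ler_norm_sum _ _ _) _; apply: ler_sum => j _.
    by rewrite normrM ger0_norm// subr_ge0.
  rewrite big_split/= -mulr_suml -mulr_suml [L * kap]mulrC lerD2r exchange_big/=.
  rewrite mulr_sumr; apply: ler_sum => j _.
  rewrite (eq_bigr (fun i => (lam n 0 i * A n i j - lam n 0 i * (kap * lam (n - 1) 0 j)) * `|d j 0|)); last first.
    by move=> i _; ring.
  rewrite -mulr_suml [leRHS]mulrA ler_wpM2r// sumrB.
  have -> : \sum_i lam n 0 i * A n i j = lam (n - 1) 0 j by rewrite -lamA mxE.
  rewrite -mulr_suml -/L; lra.
have thL : th <= kap * L.
  by rewrite /th ge_min ler_wpM2l ?(ltW kap_gt0)// kap_sum.
have L1 := kap_sum_le1 n; rewrite -/L in L1.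
have w0 : 0 <= wnorm (n - 1) d.
  by rewrite /wnorm sumr_ge0// => i _; rewrite mulr_ge0// ltW.
apply: (@le_trans _ _ ((1 - kap * L) * wnorm (n - 1) d + kap * L * `|(lam (n - 1) *m d) 0 0| + (k.+1)%:R * B * Cf)).
  apply: le_trans (lerD AD SF); rewrite -big_split; apply: ler_sum => i _ /=.
  rewrite -mulrDr ler_wpM2l ?(ltW (lam_gt0 _ _))// mxE [X in _ + X]mxE.
  exact: ler_normB.
rewrite lerD2r lerD//; first by rewrite ler_wpM2r// lerD2l lerN2.
by rewrite ler_piMl.
Qed.

Let th_gt0 : 0 < th.
Proof. by rewrite /th lt_min e_gt0 mulr_gt0. Qed.

Definition env_scale s c n : R := s `^ (- beta) * (s + `|n - c : int|%:~R).
Local Notation Hs := env_scale.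

Let Hs_ge1 s c n : 1 <= s -> 1 <= Hs s c n.
Proof.
move=> s1; have s0 : 0 < s by exact: lt_le_trans s1.
have := sqrt_le_powRN beta01 s1.
have : 1 <= Num.sqrt s by rewrite -sqrtr1 ler_sqrt// ltW.
have : 0 <= s `^ (- beta) * `|n - c|%:~R by rewrite mulr_ge0 ?powR_ge0 ?ler0z.
by rewrite /Hs mulrDr; lra.
Qed.

Let dist_step (n n' c : int) : `|n - n'| <= 1 -> `|n - c|%:~R <= `|n' - c|%:~R + 1 :> R.
Proof. by move=> nn'; rewrite -[1]/(1%:~R) -intrD ler_int dist_int_step. Qed.

(** The admissible size varies by a factor of at least [1 - th / 2] per step, while the recursions
    contract by [1 - th]; half of the contraction remains to absorb the source terms. *)
Let Hs_step s c n n' : 1 <= s -> 2 / th <= s -> `|n - n'| <= 1 ->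
  (1 - th / 2) * Hs s c n <= Hs s c n'.
Proof.
move=> s1; rewrite ler_pdivrMr// => sth nn'.
rewrite /Hs mulrCA ler_wpM2l ?powR_ge0//.
have := dist_step c nn'; have : 0 <= `|n - c|%:~R :> R by rewrite ler0z.
have := th_gt0; nra.
Qed.

Let Hs_le2 s c n n' : 1 <= s -> `|n - n'| <= 1 -> Hs s c n <= 2 * Hs s c n'.
Proof.
move=> s1 nn'; rewrite /Hs mulrCA ler_wpM2l ?powR_ge0//.
have := dist_step c nn'; have : 0 <= `|n' - c|%:~R :> R by rewrite ler0z.
lra.
Qed.

Let C2 := C1 + (k.+1)%:R * B * Cf.
(** The first summand makes [Kd * th / 2] at least [C2], the size of the source in the recursion;
    the second covers the initial value. *)
Let Kd := 2 * C2 / th + C1.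
Let smin := 2 / th + 1.

Let C2_gt0 : 0 < C2.
Proof. by rewrite ltr_pwDl// !mulr_ge0. Qed.

(** The forward recursion, started at the left end of the box. The sequence [d] depends on [N] and
    [c] but not on [s], so that one corrector can serve all scales. *)
Lemma corrector_diff (N : nat) (c : int) : (0 < N)%N -> `|c| <= (N + 2)%N%:Z ->
  exists d : int -> cV, (forall n, - (N + 3)%N%:Z < n -> d n = A n *m d (n - 1) - S n *m f n) /\
   forall s, smin <= s -> N%:R <= s ^+ 4 -> forall n, `|n| <= (N + 3)%N%:Z ->
     forall i, `|d n i 0| <= c1^-1 * Kd * Hs s c n.
Proof.
move=> N0 cN; pose n0 : int := - (N + 3)%N%:Z.
pose L0 := \sum_i lam n0 0 i.
have L00 : 0 < L0 by exact: lt_le_trans (kap_sum n0).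
pose D := fix D (j : nat) : cV := match j with
  (* the value for which lam n *m d n = Sig c - Sig n, small near the center c *)
  | 0 => const_mx ((Sig c - Sig n0) / L0)
  | j'.+1 => A (n0 + j'.+1%:Z) *m D j' - S (n0 + j'.+1%:Z) *m f (n0 + j'.+1%:Z) end.
have pred1 (j : nat) : n0 + j.+1%:Z - 1 = n0 + j%:Z by rewrite -addn1 PoszD addrA addrK.
have DS j : D j.+1 = A (n0 + j.+1%:Z) *m D j - S (n0 + j.+1%:Z) *m f (n0 + j.+1%:Z) by [].
(* The functional [lam n] detects the direction that [A n] fails to contract. Its value is followed
   exactly: the source adds [- rho n *m f n] at each step, which telescopes to the primitive and is
   small by averaging. *)
have lamD j : (lam (n0 + j%:Z) *m D j) 0 0 = Sig c - Sig (n0 + j%:Z).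
  elim: j => [|j IH].
    rewrite addr0 mxE; under eq_bigr do rewrite mxE.
    by rewrite -mulr_suml -/L0 mulrC divfK// gt_eqF.
  rewrite DS mulmxBr !mulmxA lamA lamS mxE pred1 IH mxE -SigE pred1; ring.
have wD s : smin <= s -> N%:R <= s ^+ 4 -> forall j : nat, (j <= 2 * N + 6)%N ->
    wnorm (n0 + j%:Z) (D j) <= Kd * Hs s c (n0 + j%:Z).
  move=> ss Ns.
  have s1 : 1 <= s by apply: le_trans ss; rewrite lerDr divr_ge0// ltW.
  have sth : 2 / th <= s by apply: le_trans ss; rewrite lerDl.
  have SH (j : nat) : (j <= 2 * N + 6)%N -> `|Sig c - Sig (n0 + j%:Z)| <= C1 * Hs s c (n0 + j%:Z).
    move=> jN; rewrite distrC; apply: (Sig_le N0) => //; [exact: win_left|exact: win_center].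
  elim=> [|j IH] jN.
    apply: (@le_trans _ _ (C1 * Hs s c n0)); last first.
      rewrite addr0 ler_wpM2r//; first by apply: le_trans (Hs_ge1 _ _ s1).
      by rewrite lerDr divr_ge0 ?mulr_ge0 ?(ltW C2_gt0) ?(ltW th_gt0).
    have := SH 0%N isT; rewrite addr0; apply: le_trans.
    rewrite /wnorm; under eq_bigr do rewrite mxE.
    by rewrite -mulr_suml -/L0 normrM mulrC normfV (ger0_norm (ltW L00)) divfK// gt_eqF.
  have jN' : (j <= 2 * N + 6)%N by exact: ltnW.
  rewrite DS; apply: le_trans (wnorm_step _ _) _; rewrite pred1 lamD.
  have h1 := SH j jN'; have h2 := IH jN'.
  have h3 : (1 - th / 2) * Hs s c (n0 + j%:Z) <= Hs s c (n0 + j.+1%:Z).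
    by apply: Hs_step => //; exact: dist_succ.
  have H1 := Hs_ge1 c (n0 + j%:Z) s1.
  set H := Hs s c (n0 + j%:Z) in h1 h2 h3 H1 *.
  have Kd0 : 0 <= Kd by rewrite addr_ge0 ?divr_ge0 ?mulr_ge0 ?(ltW C2_gt0) ?(ltW th_gt0) ?(ltW C1_gt0).
  apply: le_trans (ler_wpM2l Kd0 h3).
  have e1 : Kd * th = 2 * C2 + C1 * th by rewrite /Kd mulrDl divfK// gt_eqF.
  have h4 : (1 - th) * wnorm (n0 + j%:Z) (D j) <= (1 - th) * (Kd * H).
    by rewrite ler_wpM2l// subr_ge0 /th; apply: le_trans (kap_sum_le1 n0); rewrite ge_min ler_wpM2l ?(ltW kap_gt0) ?kap_sum.
  have h5 : (k.+1)%:R * B * Cf <= (k.+1)%:R * B * Cf * H by rewrite ler_peMr// !mulr_ge0.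
  have h6 : 0 <= C1 * th * H by apply: mulr_ge0; [by rewrite mulr_ge0 ?(ltW C1_gt0) ?(ltW th_gt0)|exact: le_trans H1].
  have e2 : Kd * ((1 - th / 2) * H) = (1 - th) * (Kd * H) + C2 * H + C1 * th * H / 2.
    rewrite (_ : Kd * ((1 - th / 2) * H) = (1 - th) * (Kd * H) + Kd * th * H / 2); last by field.
    by rewrite e1; field.
  have e3 : C2 * H = C1 * H + (k.+1)%:R * B * Cf * H by rewrite /C2 mulrDl.
  rewrite e2 e3; lra.
exists (fun n => D (absz (n - n0)%R)); split.
  move=> n /above_succ[j ->].
  by rewrite pred1 !absz_addK.
move=> s ss Ns n /win_index[j jN ->] i; apply: le_trans (wnorm_ge _ _ _) _.
rewrite -mulrA ler_wpM2l ?invr_ge0 ?(ltW c1_gt0)//.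
by rewrite absz_addK; exact: wD.
Qed.

(** All rows of [zeta n] put weight at least [e] on the same entry [ord0]; this common part does not
    contribute to the oscillation. *)
Let osc_step n (v : cV) lo o : (forall i, lo <= v i 0 <= lo + o) ->
  exists lo', forall i, lo' <= (zeta n *m v) i 0 <= lo' + (1 - e) * o.
Proof.
move=> vlo; exists (e * v ord0 0 + (1 - e) * lo) => i.
have z1 := stochastic_sum i (zeta_st n).
have [z0 _] := zeta_st n.
have low (w : 'I_k.+1 -> R) : (forall j, 0 <= w j) -> e * w ord0 <= \sum_j zeta n i j * w j.
  move=> w0; rewrite (bigD1 ord0)//= ler_wpDr//; last by rewrite ler_wpM2r.
  by rewrite sumr_ge0// => j _; rewrite mulr_ge0.
have h1 := low (fun j => v j 0 - lo) _.
have h2 := low (fun j => lo + o - v j 0) _.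
rewrite mxE; apply/andP; split.
  have {h1} := h1 _; under eq_bigr do rewrite mulrBr.
  rewrite sumrB -mulr_suml z1 => h1.
  have : e * (v ord0 0 - lo) <= \sum_i0 zeta n i i0 * v i0 0 - 1 * lo.
    by apply: h1 => j; rewrite subr_ge0; case/andP: (vlo j).
  lra.
have {h2} := h2 _; under eq_bigr do rewrite mulrBr.
rewrite sumrB -mulr_suml z1 => h2.
have : e * (lo + o - v ord0 0) <= 1 * (lo + o) - \sum_i0 zeta n i i0 * v i0 0.
  by apply: h2 => j; rewrite subr_ge0; case/andP: (vlo j).
lra.
Qed.

Let avg_le n (v : cV) lo o : (forall i, lo <= v i 0 <= lo + o) ->
  forall i, lo <= (zeta n *m v) i 0 <= lo + o.
Proof.
move=> vlo i; rewrite mxE.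
have [z0 _] := zeta_st n; have z1 := stochastic_sum i (zeta_st n).
have E (x : R) : x = \sum_j zeta n i j * x by rewrite -mulr_suml z1 mul1r.
apply/andP; split; [rewrite [leLHS]E|rewrite [leRHS]E]; apply: ler_sum => j _;
  by rewrite ler_wpM2l//; case/andP: (vlo j).
Qed.

Let C3 := c1^-1 * Kd.
(** Chosen so that [Kg * th / 2 = 2 * C3], twice the bound for [d], because adding [d] widens an
    interval on both sides. *)
Let Kg := 4 * C3 / th.
Let Cg := 2 * Kg + 2 * C3.

Let Kd_gt0 : 0 < Kd.
Proof. by rewrite addr_gt0// divr_gt0// mulr_gt0. Qed.
Let C3_gt0 : 0 < C3. Proof. by rewrite mulr_gt0// invr_gt0. Qed.
Let Kg_gt0 : 0 < Kg. Proof. by rewrite divr_gt0// mulr_gt0. Qed.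

(** The backward recursion, started with 0 at the right end. Averaging by [zeta] controls only
    oscillations, hence increments between neighbouring layers; summed from the centre [c] they give
    the quadratic bound. The boxes [N + 3], [N + 2], [N + 1] leave room for neighbours. *)
Lemma corrector : exists C s0 : R, [/\ 0 < C, 1 <= s0 &
  forall (N : nat) (c : int), (0 < N)%N -> `|c| <= (N + 2)%N%:Z ->
  exists g : int -> cV,
    (forall n, `|n| <= (N + 1)%N%:Z ->
       P n *m g (n + 1) + Rm n *m g n + Q n *m g (n - 1) - g n = f n) /\
    forall s, s0 <= s -> N%:R <= s ^+ 4 -> forall n, `|n| <= (N + 2)%N%:Z -> forall i,
      `|g n i 0| <= C * (s `^ (- beta) * (s + `|n - c|%:~R) ^+ 2) /\
      forall n' j, `|n' - n| <= 1 -> `|n'| <= (N + 2)%N%:Z ->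
        `|g n' j 0 - g n i 0| <= C * (s `^ (- beta) * (s + `|n - c|%:~R))].
Proof.
exists Cg, smin; split.
- by rewrite addr_gt0// mulr_gt0.
- by rewrite lerDr divr_ge0// ltW.
move=> N c N0 cN; have [d [dE dle]] := corrector_diff N0 cN.
pose n1 : int := (N + 3)%N%:Z.
pose G := fix G (j : nat) : cV := match j with
  | 0 => 0
  | j'.+1 => zeta (n1 - j'.+1%:Z) *m G j' + d (n1 - j'.+1%:Z) end.
have GS j : G j.+1 = zeta (n1 - j.+1%:Z) *m G j + d (n1 - j.+1%:Z) by [].
pose g0 n := G (absz (n1 - n)%R).
have succ1 (j : nat) : n1 - j.+1%:Z + 1 = n1 - j%:Z.
  by rewrite -addn1 PoszD opprD addrA subrK.
have g0E n : n < n1 -> g0 n = zeta n *m g0 (n + 1) + d n.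
  by move=> /below_succ[j ->]; rewrite /g0 succ1 !absz_subK.
have osc s : smin <= s -> N%:R <= s ^+ 4 -> forall n, `|n| <= (N + 3)%N%:Z ->
    exists lo, forall i, lo <= g0 n i 0 <= lo + Kg * Hs s c n.
  move=> ss Ns n /win_index_right[j jN ->]; rewrite /g0 absz_subK.
  have s1 : 1 <= s by apply: le_trans ss; rewrite lerDr divr_ge0// ltW.
  have sth : 2 / th <= s by apply: le_trans ss; rewrite lerDl.
  elim: j jN => [|j IH] jN.
    exists 0 => i; rewrite mxE lexx add0r mulr_ge0// ?(ltW Kg_gt0)//.
    exact: le_trans (Hs_ge1 _ _ s1).
  have [lo vlo] := IH (ltnW jN).
  have [lo' vlo'] := osc_step (n1 - j.+1%:Z) vlo.
  have dj i : `|d (n1 - j.+1%:Z) i 0| <= C3 * Hs s c (n1 - j.+1%:Z).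
    by apply: dle => //; exact: win_right.
  have h3 : (1 - th / 2) * Hs s c (n1 - j%:Z) <= Hs s c (n1 - j.+1%:Z).
    by apply: Hs_step => //; exact: dist_pred.
  have H1 := Hs_ge1 c (n1 - j%:Z) s1.
  have H2 := Hs_ge1 c (n1 - j.+1%:Z) s1.
  move: (Hs s c (n1 - j%:Z)) (Hs s c (n1 - j.+1%:Z)) vlo' dj h3 H1 H2 => H H' vlo' dj h3 H1 H2.
  exists (lo' - C3 * H') => i; rewrite GS mxE.
  have /andP[l1 l2] := vlo' i; move: (dj i); rewrite ler_norml => /andP[d1 d2].
  have the : th <= e by rewrite /th ge_min lexx orbT.
  have KgE : Kg * th = 4 * C3 by rewrite /Kg divfK// gt_eqF.
  (* Use [1 - e <= 1 - th <= (1 - th / 2)^2]: one factor pays for passing from [H] to [H'], the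
     other for the source [2 * C3]. *)
  have key : (1 - e) * (Kg * H) + 2 * (C3 * H') <= Kg * H'.
    have k1 : (1 - e) * (Kg * H) <= (1 - th) * (Kg * H).
      apply: ler_wpM2r; last by rewrite lerD2l lerN2.
      by apply: mulr_ge0; [exact: ltW|exact: le_trans H1].
    have k2 : Kg * ((1 - th / 2) * H) <= Kg * H' by rewrite ler_wpM2l ?(ltW Kg_gt0).
    have k3 : (1 - th / 2) * (Kg * H') = Kg * H' - 2 * (C3 * H').
      have -> : (1 - th / 2) * (Kg * H') = Kg * H' - Kg * th * H' / 2 by field.
      by rewrite KgE; field.
    have th1 : th <= 1.
      by rewrite /th; apply: le_trans (kap_sum_le1 n1); rewrite ge_min ler_wpM2l ?(ltW kap_gt0) ?kap_sum.
    have k4 : (1 - th / 2) * (Kg * ((1 - th / 2) * H)) <= (1 - th / 2) * (Kg * H').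
      by rewrite ler_wpM2l//; lra.
    have k5 : (1 - th) * (Kg * H) <= (1 - th / 2) * (Kg * ((1 - th / 2) * H)).
      rewrite -subr_ge0.
      have -> : (1 - th / 2) * (Kg * ((1 - th / 2) * H)) - (1 - th) * (Kg * H) =
        (th / 2) ^+ 2 * (Kg * H) by field.
      by apply: mulr_ge0; [exact: sqr_ge0|apply: mulr_ge0; [exact: ltW|exact: le_trans H1]].
    lra.
  apply/andP; split; lra.
have same s : smin <= s -> N%:R <= s ^+ 4 -> forall n i j, `|n| <= (N + 3)%N%:Z ->
    `|g0 n i 0 - g0 n j 0| <= Kg * Hs s c n.
  move=> ss Ns n i j nN; have [lo vlo] := osc s ss Ns n nN.
  have /andP[a1 a2] := vlo i; have /andP[b1 b2] := vlo j.
  by rewrite ler_norml; apply/andP; split; lra.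
have up s : smin <= s -> N%:R <= s ^+ 4 -> forall n i j, `|n| <= (N + 3)%N%:Z ->
    `|n + 1| <= (N + 3)%N%:Z ->
    `|g0 n i 0 - g0 (n + 1) j 0| <= Kg * Hs s c (n + 1) + C3 * Hs s c n.
  move=> ss Ns n i j nN nN'; have [lo vlo] := osc s ss Ns (n + 1) nN'.
  have /andP[a1 a2] := avg_le n vlo i; have /andP[b1 b2] := vlo j.
  have := dle s ss Ns n nN i; rewrite -/C3 ler_norml => /andP[d1 d2].
  rewrite (g0E n) ?(win_succ nN nN')// mxE ler_norml; apply/andP; split; lra.
have grad s : smin <= s -> N%:R <= s ^+ 4 -> forall n n' i j, `|n' - n| <= 1 ->
    `|n| <= (N + 3)%N%:Z -> `|n'| <= (N + 3)%N%:Z ->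
    `|g0 n' j 0 - g0 n i 0| <= Cg * Hs s c n.
  move=> ss Ns n n' i j nn' nN nN'.
  have s1 : 1 <= s by apply: le_trans ss; rewrite lerDr divr_ge0// ltW.
  have H1 := Hs_ge1 c n s1.
  have H2 := Hs_le2 c s1 nn'.
  have KH : 0 <= Kg * Hs s c n by apply: mulr_ge0; [exact: ltW|exact: le_trans H1].
  have CH : 0 <= C3 * Hs s c n by apply: mulr_ge0; [exact: ltW|exact: le_trans H1].
  have KH2 := ler_wpM2l (ltW Kg_gt0) H2; have CH2 := ler_wpM2l (ltW C3_gt0) H2.
  rewrite /Cg mulrDl -2!(mulrA 2).
  have [e'|e'|e'] := int_near nn'.
  - rewrite e'; apply: le_trans (same s ss Ns n j i nN) _; lra.
  - rewrite e' in nN' KH2 CH2 *; rewrite distrC.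
    apply: le_trans (up s ss Ns n i j nN nN') _; lra.
  - have en : n = n' + 1 by rewrite e' subrK.
    have nN2 := nN; rewrite {1}en in nN2.
    have := up s ss Ns n' j i nN' nN2; rewrite -en; lra.
(* Normalisation at the centre; constants solve the homogeneous equation because the rows of
   [P + Q + Rm] sum to 1. *)
exists (fun n => g0 n - const_mx (g0 c ord0 0)); split.
  move=> n /win_inner[nl nr nr'].
  have e1 : g0 (n - 1) = zeta (n - 1) *m g0 n + d (n - 1) by rewrite g0E ?subrK.
  set o := const_mx _.
  have o1 : P n *m o + Rm n *m o + Q n *m o = o.
    have -> : o = g0 c ord0 0 *: (const_mx 1 : cV).
      by apply/colP => i; rewrite !mxE mulr1.
    rewrite -!scalemxAr -!scalerDr -[in RHS](env_sum n) !mulmxDl; congr (_ *: _).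
    by rewrite addrAC.
  rewrite !mulmxBr.
  have -> : P n *m g0 (n + 1) - P n *m o + (Rm n *m g0 n - Rm n *m o) +
     (Q n *m g0 (n - 1) - Q n *m o) - (g0 n - o) =
     P n *m g0 (n + 1) + Rm n *m g0 n + Q n *m g0 (n - 1) - g0 n.
    rewrite -[X in - (_ - X)]o1.
    move: (g0 n) (P n *m g0 (n + 1)) (Rm n *m g0 n) (Q n *m g0 (n - 1)) (P n *m o) (Rm n *m o) (Q n *m o).
    by move=> x1 x2 x3 x4 x5 x6 x7; apply/matrixP => i j; rewrite !mxE; ring.
  pose U := 1 - Rm n - Q n *m zeta (n - 1).
  have PU : P n = U *m zeta n by rewrite zeta_S mulmxA S_inv mul1mx.
  have QU : Q n = U *m A n by rewrite A_S mulmxA S_inv mul1mx.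
  have fU : f n = U *m (S n *m f n) by rewrite mulmxA S_inv mul1mx.
  have -> : P n *m g0 (n + 1) + Rm n *m g0 n + Q n *m g0 (n - 1) - g0 n =
    P n *m g0 (n + 1) + Q n *m d (n - 1) - U *m g0 n.
    rewrite e1 /U !mulmxBl mul1mx mulmxDr mulmxA.
    move: (g0 n) (P n *m g0 (n + 1)) (Rm n *m g0 n) (Q n *m zeta (n - 1) *m g0 n) (Q n *m d (n - 1)).
    by move=> x1 x2 x3 x4 x5; apply/matrixP => i j; rewrite !mxE; ring.
  rewrite PU {1}QU -!mulmxA -mulmxDr -mulmxBr fU; congr (_ *m _).
  rewrite (g0E n nr) (dE n nl).
  move: (zeta n *m _) (A n *m _) (S n *m _) => x1 x2 x3.
  by apply/matrixP => i j; rewrite !mxE; ring.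
move=> s ss Ns n nN i; split; last first.
  move=> n' j nn' nN'; rewrite [X in `|X|](_ : _ = g0 n' j 0 - g0 n i 0).
    by apply: grad => //; exact: win_weak.
  by rewrite !mxE; ring.
have s1 : 1 <= s by apply: le_trans ss; rewrite lerDr divr_ge0// ltW.
have h0 : 0 <= s `^ (- beta) by exact: powR_ge0.
have Cg0 : 0 <= Cg by apply: addr_ge0; apply: mulr_ge0 => //; exact: ltW.
(* There are [l] steps between layers and one more inside layer [c], which explains [l.+1]. *)
have chain (l : nat) : forall m j, `|m - c| = l%:Z -> `|m| <= (N + 3)%N%:Z ->
    `|g0 m j 0 - g0 c ord0 0| <= Cg * (l.+1%:R * (s `^ (- beta) * (s + l%:R))).
  elim: l => [|l IH] m j ml mN.
    have -> : m = c by apply/eqP; rewrite -subr_eq0 -normr_eq0 ml.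
    rewrite mul1r addr0; apply: le_trans (grad s ss Ns c c ord0 j _ _ _) _ => //.
    - by rewrite subrr.
    - exact: win_weak.
    - exact: win_weak.
    - by rewrite /Hs subrr normr0 addr0.
  have [m' [m'c mm' m'N]] := toward_center cN mN ml.
  have h1 := IH m' j m'c m'N.
  have h2 : `|g0 m j 0 - g0 m' j 0| <= Cg * (s `^ (- beta) * (s + l%:R)).
    by have := grad s ss Ns m' m j j mm' m'N mN; rewrite /Hs m'c.
  have -> : g0 m j 0 - g0 c ord0 0 = (g0 m j 0 - g0 m' j 0) + (g0 m' j 0 - g0 c ord0 0) by ring.
  apply: le_trans (ler_normD _ _) _; apply: le_trans (lerD h2 h1) _.
  rewrite -mulrDr ler_wpM2l// -[X in X + _]mul1r -mulrDl -(natrD _ 1) add1n.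
  by rewrite ler_wpM2l// ler_wpM2l// lerD2l ler_nat.
have [l nc] : exists l : nat, `|n - c| = l%:Z by exists (absz (n - c)%R); rewrite abszE.
rewrite !mxE nc; apply: le_trans (chain l n i nc (win_weak nN)) _.
rewrite ler_wpM2l// mulrCA ler_wpM2l// expr2 ler_wpM2r ?addr_ge0 ?(le_trans ler01 s1)//.
by rewrite -natr1 addrC lerD2r.
Qed.

End Corrector.

(** * Expectations along the walk *)

Section Walk.
Variables (R : realType) (k : nat).
Variables (P Q Rm : int -> 'M[R]_k.+1).
Hypothesis env_ge0 : forall n, nonneg_mx (P n) /\ nonneg_mx (Q n) /\ nonneg_mx (Rm n).
Hypothesis env_sum : forall n, (P n + Q n + Rm n) *m (const_mx 1 : 'cV[R]_k.+1) = const_mx 1.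
Implicit Types F G : int -> 'I_k.+1 -> R.

Definition walk_step F n i : R :=
  \sum_j (P n i j * F (n + 1) j + Rm n i j * F n j + Q n i j * F (n - 1) j).

Let near1 n : [/\ `|(n + 1) - n : int| <= 1, `|n - n : int| <= 1 & `|(n - 1) - n : int| <= 1].
Proof. by split; lia. Qed.

Lemma walk_step_le F G n i : (forall n' j, `|n' - n| <= 1 -> F n' j <= G n' j) ->
  walk_step F n i <= walk_step G n i.
Proof.
move=> FG; have [p0 [q0 r0]] := env_ge0 n; have [a b c] := near1 n.
by apply: ler_sum => j _; rewrite !lerD// ler_wpM2l// FG.
Qed.

Lemma walk_stepD F G n i :
  walk_step (fun n i => F n i + G n i) n i = walk_step F n i + walk_step G n i.
Proof. by rewrite -big_split; apply: eq_bigr => j _ /=; ring. Qed.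

Lemma walk_stepZ c F n i : walk_step (fun n i => c * F n i) n i = c * walk_step F n i.
Proof. by rewrite mulr_sumr; apply: eq_bigr => j _ /=; ring. Qed.

Lemma walk_step_cst c n i : walk_step (fun _ _ => c) n i = c.
Proof.
have := congr1 (fun v : 'cV_k.+1 => v i 0) (env_sum n).
rewrite mulmx1E mxE => e; rewrite -[RHS]mul1r -e mulr_suml.
by apply: eq_bigr => j _; rewrite !mxE; ring.
Qed.

Lemma iter_walk_le t F G n i : (forall n' j, `|n' - n| <= t%:Z -> F n' j <= G n' j) ->
  iter t walk_step F n i <= iter t walk_step G n i.
Proof.
elim: t n i => [|t IH] n i FG; first by rewrite FG ?subrr.
apply: walk_step_le => n' j nn'; apply: IH => n'' j'' h; apply: FG; lia.
Qed.

Variable i0 : 'I_k.+1.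
(** The expectation through the backward equation: the Markov property is unfolding an iteration,
    and comparison is monotonicity of one step. [box_sum_dist] identifies it with the forward law
    [dist]. *)
Definition Ex t F : R := iter t walk_step F 0 i0.

Lemma ExS t F : Ex t.+1 F = Ex t (walk_step F).
Proof. by rewrite /Ex iterSr. Qed.

Lemma Ex_le t F G : (forall n i, `|n| <= t%:Z -> F n i <= G n i) -> Ex t F <= Ex t G.
Proof. by move=> FG; apply: iter_walk_le => n' j; rewrite subr0; exact: FG. Qed.

Lemma ExD t F G : Ex t (fun n i => F n i + G n i) = Ex t F + Ex t G.
Proof.
elim: t F G => // t IH F G; rewrite !ExS -IH; congr (Ex t _).
by apply/funext => n; apply/funext => i; exact: walk_stepD.
Qed.

Lemma ExZ t c F : Ex t (fun n i => c * F n i) = c * Ex t F.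
Proof.
elim: t F => // t IH F; rewrite !ExS -IH; congr (Ex t _).
by apply/funext => n; apply/funext => i; exact: walk_stepZ.
Qed.

Lemma ExB t F G : Ex t (fun n i => F n i - G n i) = Ex t F - Ex t G.
Proof.
rewrite -[- Ex t G]mulN1r -ExZ -ExD; congr (Ex t _).
by apply/funext => n; apply/funext => i; rewrite mulN1r.
Qed.

Lemma Ex_cst t c : Ex t (fun _ _ => c) = c.
Proof.
elim: t => // t IH; rewrite ExS -[RHS]IH; congr (Ex t _).
by apply/funext => n; apply/funext => i; exact: walk_step_cst.
Qed.

Lemma Ex_norm t F G : (forall n i, `|n| <= t%:Z -> `|F n i| <= G n i) -> `|Ex t F| <= Ex t G.
Proof.
move=> FG; rewrite ler_norml -[- Ex t G]mulN1r -ExZ; apply/andP; split; apply: Ex_le => n i nt.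
  by have := FG n i nt; rewrite ler_norml mulN1r => /andP[].
by have := FG n i nt; rewrite ler_norml => /andP[].
Qed.

Lemma dist_support t (n : int) : t%:Z < `|n| -> dist P Q Rm i0 t n = 0.
Proof.
elim: t n => [|t IH] n tn /=.
  by case: eqP tn => // ->; rewrite normr0 ltxx.
by rewrite !IH ?mul0mx ?addr0//; lia.
Qed.

Definition box_sum W (h : int -> R) := \sum_(l < (W + W).+1) h (l%:Z - W%:Z).

Let box_sum_shift W (h : int -> R) : h (- W%:Z - 1) = 0 -> h W%:Z = 0 ->
  box_sum W (fun n => h (n - 1)) = box_sum W h.
Proof.
move=> h1 h2; rewrite /box_sum big_ord_recl big_ord_recr /=.
rewrite sub0r h1 add0r PoszD addrK h2 addr0.
apply: eq_bigr => l _; congr h; rewrite /bump /= add1n; lia.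
Qed.

Let box_sum_shiftr W (h : int -> R) : h (- W%:Z) = 0 -> h (W%:Z + 1) = 0 ->
  box_sum W (fun n => h (n + 1)) = box_sum W h.
Proof.
move=> h1 h2; rewrite -(@box_sum_shift W (fun n => h (n + 1))).
- by rewrite /box_sum; apply: eq_bigr => l _; rewrite subrK.
- by rewrite subrK.
- by [].
Qed.

(** Duality of the forward and backward equations. The box stays fixed while [t] varies, and the
    shifts of the summation index lose nothing because the law vanishes beyond distance [t]. *)
Lemma box_sum_dist W t F : (t <= W)%N ->
  box_sum W (fun n => \sum_j dist P Q Rm i0 t n 0 j * F n j) = Ex t F.
Proof.
elim: t F => [|t IH] F tW.
  rewrite /box_sum /Ex /=.
  have WW : (W < (W + W).+1)%N by rewrite ltnS leq_addr.
  rewrite (bigD1 (Ordinal WW))//= subrr eqxx -[RHS]addr0; congr (_ + _).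
    rewrite (bigD1 i0)//= mxE !eqxx mul1r -[RHS]addr0; congr (_ + _).
    by rewrite big1// => j ji0; rewrite mxE (negbTE ji0) andbF mul0r.
  rewrite big1// => l lW; rewrite big1// => j _; case: eqP => [e|]; last by rewrite mxE mul0r.
  by case/eqP: lW; apply/val_inj => /=; lia.
rewrite ExS -IH ?(ltnW tW)//.
pose D := dist P Q Rm i0 t.
pose hP n := \sum_i D n 0 i * \sum_j P n i j * F (n + 1) j.
pose hR n := \sum_i D n 0 i * \sum_j Rm n i j * F n j.
pose hQ n := \sum_i D n 0 i * \sum_j Q n i j * F (n - 1) j.
have vanish (h : int -> 'I_k.+1 -> R) (n : int) : t%:Z < `|n| -> \sum_i D n 0 i * h n i = 0.
  by move=> tn; rewrite big1// => i _; rewrite /D dist_support// mxE mul0r.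
have mulE (v : 'rV[R]_k.+1) (B : 'M[R]_k.+1) (w : 'I_k.+1 -> R) :
    \sum_j (v *m B) 0 j * w j = \sum_i v 0 i * \sum_j B i j * w j.
  transitivity (\sum_j \sum_i v 0 i * B i j * w j).
    by apply: eq_bigr => j _; rewrite mxE mulr_suml.
  by rewrite exchange_big; apply: eq_bigr => i _; rewrite mulr_sumr; apply: eq_bigr => j _; rewrite mulrA.
transitivity (box_sum W (fun n => hP (n - 1)) + box_sum W hR + box_sum W (fun n => hQ (n + 1))).
  rewrite /box_sum -!big_split; apply: eq_bigr => l _ /=.
  move: (l%:Z - W%:Z) => n; rewrite /hP /hR /hQ subrK addrK -!mulE -!big_split.
  by apply: eq_bigr => j _ /=; rewrite !mxE; ring.
rewrite box_sum_shift ?box_sum_shiftr; first last.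
- by apply: (vanish (fun n i => \sum_j P n i j * F (n + 1) j)); lia.
- by apply: (vanish (fun n i => \sum_j P n i j * F (n + 1) j)); lia.
- by apply: (vanish (fun n i => \sum_j Q n i j * F (n - 1) j)); lia.
- by apply: (vanish (fun n i => \sum_j Q n i j * F (n - 1) j)); lia.
rewrite /box_sum -!big_split; apply: eq_bigr => l _ /=.
rewrite /hP /hR /hQ -!big_split; apply: eq_bigr => i _ /=.
rewrite -!mulrDr; congr (_ * _); rewrite -!big_split; apply: eq_bigr => j _ /=.
by ring.
Qed.

End Walk.

(** * The drift of the corrected kernel in one step *)

Section OneStep.
Variables (R : realType) (k : nat).
Variables (P Q Rm : int -> 'M[R]_k.+1) (mm : int -> 'cV[R]_k.+1) (K D Cg : R).
Hypothesis env_ge0 : forall n, nonneg_mx (P n) /\ nonneg_mx (Q n) /\ nonneg_mx (Rm n).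
Hypothesis env_sum : forall n, (P n + Q n + Rm n) *m (const_mx 1 : 'cV[R]_k.+1) = const_mx 1.
Hypothesis mm_harm : forall n, mm n = P n *m mm (n + 1) + Rm n *m mm n + Q n *m mm (n - 1).
Hypothesis mm_step : forall (n1 n2 : int) (i1 i2 : 'I_k.+1),
     `|n1 - n2| <= 1 -> `|mm n1 i1 0 - mm n2 i2 0| <= K.
Hypothesis D_gt0 : 0 < D.
Hypothesis Cg_gt0 : 0 < Cg.
Local Notation step := (walk_step P Q Rm).

Let K_ge0 : 0 <= K.
Proof. by apply: le_trans (mm_step (n1 := 0) (n2 := 0) ord0 ord0 _); rewrite ?subrr ?normr0. Qed.

Definition corrected j u x (g : int -> 'I_k.+1 -> R) n i : R :=
  heat j u (x - mm n i 0) - 2^-1 * heat j.+2 u (x - mm n i 0) * g n i.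

Let step_mm n i : step (fun n' j => mm n i 0 - mm n' j 0) n i = 0.
Proof.
have -> : (fun n' j => mm n i 0 - mm n' j 0) = (fun n' j => mm n i 0 + (-1) * mm n' j 0).
  by apply/funext => n'; apply/funext => j; rewrite mulN1r.
rewrite walk_stepD walk_step_cst// walk_stepZ mulN1r; apply/eqP; rewrite subr_eq0; apply/eqP.
by rewrite {1}mm_harm !mxE /walk_step -!big_split; apply: eq_bigr => j _ /=; ring.
Qed.

Let step_mm2 n i : step (fun n' j => (mm n i 0 - mm n' j 0) ^+ 2) n i = qvec P Q Rm mm n i 0.
Proof. by rewrite mxE; apply: eq_bigr => j _; ring. Qed.

(** After the cancellation by the Poisson equation three errors remain: the Taylor remainder
    [s^(-j-3)], bounded through [s^-1 <= h]; a second order remainder [s^(-j-4)] times [g], of size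
    [h s^2]; and [heat j.+3] times an increment of [g], of size [h s]. Powers of [|z| / s] are
    absorbed by widening the Gaussian from 4 to 8. *)
Lemma corrected_step j : exists2 C : R, 0 < C & forall (g : int -> 'I_k.+1 -> R) n i x s h,
  1 <= s -> 2 * D <= s ^+ 2 -> s^-1 <= h ->
  `|g n i| <= Cg * (h * (s + `|x - mm n i 0|) ^+ 2) ->
  (forall n' i', `|n' - n| <= 1 ->
     `|g n' i' - g n i| <= Cg * (h * (s + `|x - mm n i 0|))) ->
  step g n i - g n i = qvec P Q Rm mm n i 0 - D ->
  `|step (corrected j (s ^+ 2 - D) x g) n i - corrected j (s ^+ 2) x g n i| <=
    C * (h * s ^- j.+2 * gauss (8 * s ^+ 2) (x - mm n i 0)).
Proof.
have [C3 C30 HT3] := heat_Taylor3 K_ge0 D_gt0 j.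
have [C2 C20 HT2] := heat_Taylor2 K_ge0 D_gt0 j.+2.
have [C1 C10 H1] := heat_gauss (R := R) j.+2.
have [Ca Ca0 HCa] := gauss_absorb 2 (ltr0Sn R 3).
have [Cb Cb0 HCb] := gauss_absorb 1 (ltr0Sn R 3).
pose C := C3 + C2 * (Cg * Ca) + 2^-1 * K * C1 * (Cg * Cb).
exists C.
  by rewrite ltr_pwDl ?addr_gt0 ?mulr_ge0 ?mulr_gt0 ?invr_ge0// ltW.
move=> g n i x s h s1 sD sh gle gstep poisson.
set z := x - mm n i 0 in gle gstep *.
have s0 : 0 < s by exact: lt_le_trans s1.
have h0 : 0 < h by apply: lt_le_trans sh; rewrite invr_gt0.
pose a0 := heat j (s ^+ 2) z - D / 2 * heat j.+2 (s ^+ 2) z - 2^-1 * heat j.+2 (s ^+ 2) z * g n i.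
pose a1 := heat j.+1 (s ^+ 2) z - 2^-1 * heat j.+3 (s ^+ 2) z * g n i.
pose a2 := 2^-1 * heat j.+2 (s ^+ 2) z.
pose d n' i' := mm n i 0 - mm n' i' 0.
pose F := corrected j (s ^+ 2 - D) x g.
(* The part whose expectation is computed exactly: the linear term vanishes by harmonicity, the
   quadratic one gives [qvec], and the increment of [g] gives [qvec - D]. *)
pose main n' i' := a0 + (a1 * d n' i' + (a2 * d n' i' ^+ 2 + (- a2) * (g n' i' + - g n i))).
pose b := C * (h * s ^- j.+2 * gauss (8 * s ^+ 2) z).
have stepmain : step main n i = corrected j (s ^+ 2) x g n i.
  rewrite /main (walk_stepD _ _ _ (fun _ _ => a0)) walk_step_cst//.
  rewrite (walk_stepD _ _ _ (fun n' i' => a1 * d n' i')) walk_stepZ step_mm mulr0 add0r.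
  rewrite (walk_stepD _ _ _ (fun n' i' => a2 * d n' i' ^+ 2)) !walk_stepZ step_mm2.
  rewrite (walk_stepD _ _ _ g) walk_step_cst// poisson /corrected -/z /a0 /a2.
  by field.
have err n' i' : `|n' - n| <= 1 -> `|F n' i' - main n' i'| <= b.
  move=> nn'.
  have dK : `|d n' i'| <= K by apply: mm_step; rewrite distrC.
  have zE : x - mm n' i' 0 = z + d n' i' by rewrite /z /d; ring.
  pose T3 := heat j (s ^+ 2 - D) (z + d n' i') - heat j (s ^+ 2) z - d n' i' * heat j.+1 (s ^+ 2) z
     - (d n' i' ^+ 2 - D) / 2 * heat j.+2 (s ^+ 2) z.
  pose T2 := heat j.+2 (s ^+ 2 - D) (z + d n' i') - heat j.+2 (s ^+ 2) z - d n' i' * heat j.+3 (s ^+ 2) z.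
  have -> : F n' i' - main n' i' = T3 - 2^-1 * (T2 * g n' i') -
      2^-1 * d n' i' * heat j.+3 (s ^+ 2) z * (g n' i' - g n i).
    by rewrite /F /corrected zE /main /a0 /a1 /a2 /T3 /T2; field.
  set g4 := gauss (4 * s ^+ 2) z; set g8 := gauss (8 * s ^+ 2) z.
  have g40 : 0 < g4 by exact: gauss_gt0.
  have g80 : 0 < g8 by exact: gauss_gt0.
  have s20 : 0 < s ^+ 2 by rewrite exprn_gt0.
  have g48 : g4 <= g8 by apply: ler_gauss; rewrite ?mulr_gt0// ler_pM2r// ler_nat.
  have sz : 1 <= s + `|z| by rewrite ler_wpDr.
  have T3le : `|T3| <= C3 * (h * s ^- j.+2 * g8).
    apply: le_trans (HT3 s z _ s1 sD dK) _; rewrite ler_wpM2l ?(ltW C30)//.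
    apply: ler_pM => //; rewrite ?invr_ge0 ?exprn_ge0 ?(ltW s0) ?(ltW g40)//.
    by rewrite exprS invfM ler_wpM2r// invr_ge0 exprn_ge0 ?(ltW s0).
  have gle' : `|g n' i'| <= 2 * Cg * h * (s + `|z|) ^+ 2.
    have -> : g n' i' = g n i + (g n' i' - g n i) by ring.
    apply: le_trans (ler_normD _ _) _; apply: le_trans (lerD gle (gstep _ _ nn')) _.
    have : Cg * (h * (s + `|z|)) <= Cg * (h * (s + `|z|) ^+ 2).
      by rewrite !ler_wpM2l ?(ltW Cg_gt0) ?(ltW h0)// expr2 ler_peMl// (le_trans _ sz).
    lra.
  have T2le : `|2^-1 * (T2 * g n' i')| <= C2 * (Cg * Ca) * (h * s ^- j.+2 * g8).
    rewrite normrM ger0_norm ?invr_ge0//.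
    apply: le_trans (ler_wpM2l _ (ler_normM (HT2 s z _ s1 sD dK) gle')) _.
      by rewrite invr_ge0.
    rewrite -/g4.
    have -> : 2^-1 * (C2 * (s ^- j.+4 * g4) * (2 * Cg * h * (s + `|z|) ^+ 2)) =
      C2 * Cg * h * s ^- j.+4 * ((s + `|z|) ^+ 2 * g4) by field; rewrite expf_neq0// gt_eqF.
    have := HCa s z s0; rewrite -natrM -/g4 -/g8 => HCa'.
    apply: le_trans (ler_wpM2l _ HCa') _.
      by rewrite !mulr_ge0 ?invr_ge0 ?exprn_ge0 ?(ltW C20) ?(ltW Cg_gt0) ?(ltW h0) ?(ltW s0).
    rewrite le_eqVlt; apply/orP; left; apply/eqP.
    rewrite (exprD s 2 j.+2 : s ^+ j.+4 = _).
    by field; rewrite !gt_eqF ?exprn_gt0.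
  have T1le : `|2^-1 * d n' i' * heat j.+3 (s ^+ 2) z * (g n' i' - g n i)| <=
      2^-1 * K * C1 * (Cg * Cb) * (h * s ^- j.+2 * g8).
    have h3 : `|heat j.+3 (s ^+ 2) z| <= C1 * s ^- j.+3 * g4.
      apply: le_trans (H1 s z s0) _; rewrite ler_wpM2l//.
        by rewrite mulr_ge0 ?invr_ge0 ?exprn_ge0 ?(ltW C10) ?(ltW s0).
      by apply: ler_gauss; rewrite ?mulr_gt0// ler_pM2r// ler_nat.
    have h2 : `|2^-1 * d n' i'| <= 2^-1 * K by rewrite ler_normM// ger0_norm// invr_ge0.
    apply: le_trans (ler_normM (ler_normM h2 h3) (gstep _ _ nn')) _.
    have -> : 2^-1 * K * (C1 * s ^- j.+3 * g4) * (Cg * (h * (s + `|z|))) =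
      2^-1 * K * C1 * Cg * h * s ^- j.+3 * ((s + `|z|) ^+ 1 * g4) by rewrite expr1; ring.
    have := HCb s z s0; rewrite -natrM -/g4 -/g8 => HCb'.
    apply: le_trans (ler_wpM2l _ HCb') _.
      by rewrite !mulr_ge0 ?invr_ge0 ?exprn_ge0 ?(ltW C10) ?(ltW Cg_gt0) ?(ltW h0) ?(ltW s0).
    rewrite le_eqVlt; apply/orP; left; apply/eqP.
    rewrite expr1 (exprS s j.+2).
    by field; rewrite !gt_eqF ?exprn_gt0.
  apply: le_trans (ler_normB _ _) _; rewrite /b /C -/g8 !(mulrDl _ _ (h * s ^- j.+2 * g8)).
  apply: lerD => //; apply: le_trans (ler_normB _ _) _; exact: lerD.
have -> : step F n i - corrected j (s ^+ 2) x g n i = step (fun n' i' => F n' i' + (-1) * main n' i') n i.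
  by rewrite walk_stepD walk_stepZ mulN1r stepmain.
rewrite ler_norml; apply/andP; split.
  rewrite -[X in X <= _](walk_step_cst env_sum _ n i); apply: walk_step_le => // n' i' nn'.
  by have := err n' i' nn'; rewrite mulN1r ler_norml => /andP[].
rewrite -[X in _ <= X](walk_step_cst env_sum _ n i); apply: walk_step_le => // n' i' nn'.
by have := err n' i' nn'; rewrite mulN1r ler_norml => /andP[].
Qed.

Lemma corrected_heat j : exists2 C : R, 0 < C & forall (g : int -> 'I_k.+1 -> R) n i x s h,
  0 < s -> 0 < h ->
  `|g n i| <= Cg * (h * (s + `|x - mm n i 0|) ^+ 2) ->
  `|corrected j (s ^+ 2) x g n i - heat j (s ^+ 2) (x - mm n i 0)| <=
    C * (h * s ^- j * gauss (8 * s ^+ 2) (x - mm n i 0)).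
Proof.
have [C1 C10 H1] := heat_gauss (R := R) j.+1.
have [Ca Ca0 HCa] := gauss_absorb 2 (ltr0Sn R 3).
exists (2^-1 * C1 * Cg * Ca); first by rewrite !mulr_gt0.
move=> g n i x s h s0 h0 gle; rewrite /corrected; set z := x - mm n i 0 in gle *.
rewrite addrC addKr normrN -mulrA normrM ger0_norm ?invr_ge0//.
have s20 : 0 < s ^+ 2 by rewrite exprn_gt0.
have h3 : `|heat j.+2 (s ^+ 2) z| <= C1 * s ^- j.+2 * gauss (4 * s ^+ 2) z.
  apply: le_trans (H1 s z s0) _; rewrite ler_wpM2l//.
    by rewrite mulr_ge0 ?invr_ge0 ?exprn_ge0 ?(ltW C10) ?(ltW s0).
  by apply: ler_gauss; rewrite ?mulr_gt0// ler_pM2r// ler_nat.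
apply: le_trans (ler_wpM2l _ (ler_normM h3 gle)) _; first by rewrite invr_ge0.
have -> : 2^-1 * (C1 * s ^- j.+2 * gauss (4 * s ^+ 2) z * (Cg * (h * (s + `|z|) ^+ 2))) =
  2^-1 * C1 * Cg * h * s ^- j.+2 * ((s + `|z|) ^+ 2 * gauss (4 * s ^+ 2) z) by ring.
have := HCa s z s0; rewrite -natrM => HCa'.
apply: le_trans (ler_wpM2l _ HCa') _.
  by rewrite !mulr_ge0 ?invr_ge0 ?exprn_ge0 ?(ltW C10) ?(ltW Cg_gt0) ?(ltW h0) ?(ltW s0).
rewrite le_eqVlt; apply/orP; left; apply/eqP.
rewrite (exprD s 2 j : s ^+ j.+2 = _).
by field; rewrite !gt_eqF ?exprn_gt0.
Qed.

End OneStep.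

(** * Summation over time *)

Section PowerSums.
Context {R : realType}.
Implicit Types (u v w D p q : R).

(** The comparison of a sum with an integral, in discrete form: for [w = v + D],
    [(1 - D / w)^(-p) >= 1 + p D / w]. *)
Lemma powR_negstep p v D : 0 < p -> 0 < v -> 0 < D ->
  (v + D) `^ (- (1 + p)) <= (D * p)^-1 * (v `^ (- p) - (v + D) `^ (- p)).
Proof.
move=> p0 v0 D0; set w := v + D.
have w0 : 0 < w by rewrite addr_gt0.
have wn0 : w != 0 by rewrite gt_eqF.
have h : w `^ (- p) * (1 + p * (D / w)) <= v `^ (- p).
  have -> : v `^ (- p) = w `^ (- p) * (v / w) `^ (- p).
    by rewrite -powRM ?(ltW w0) ?divr_ge0 ?(ltW v0) ?(ltW w0)// mulrC divfK.
  rewrite ler_wpM2l ?powR_ge0//.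
  have vw : 0 < v / w by rewrite divr_gt0.
  apply: le_trans (expR_ge1Dx (p * (D / w))) _.
  rewrite -[(v / w) `^ _]lnK ?posrE ?powR_gt0// ler_expR ln_powR mulNr -mulrN ler_wpM2l ?(ltW p0)//.
  have -> : v / w = 1 + (- (D / w)) by rewrite /w; field.
  rewrite lerNr; apply: le_ln1Dx.
  by rewrite ltrN2 ltr_pdivrMr// mul1r /w ltrDr.
have -> : w `^ (- (1 + p)) = w `^ (- p) / w.
  by rewrite opprD addrC powRD ?wn0 ?implybT// powR_inv1 ?(ltW w0).
rewrite ler_pdivlMl ?mulr_gt0//.
have -> : D * p * (w `^ (- p) / w) = w `^ (- p) * (1 + p * (D / w)) - w `^ (- p) by field.
by rewrite lerD2r.
Qed.

(** Here [(1 - D / w)^q <= exp (- y) <= 1 - y / 2] with [y = q D / w <= 1]; the factor 2 comes from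
    the last inequality. *)
Lemma powR_posstep q v D : 0 < q <= 1 -> 0 < v -> 0 < D ->
  (v + D) `^ (q - 1) <= 2 * (D * q)^-1 * ((v + D) `^ q - v `^ q).
Proof.
move=> /andP[q0 q1] v0 D0; set w := v + D.
have w0 : 0 < w by rewrite addr_gt0.
have wn0 : w != 0 by rewrite gt_eqF.
set y := q * (D / w).
have y0 : 0 < y by rewrite mulr_gt0// divr_gt0.
have y1 : y <= 1.
  have Dw : D / w <= 1 by rewrite ler_pdivrMr// mul1r /w lerDr ltW.
  by rewrite -[leRHS]mul1r; apply: ler_pM; rewrite ?(ltW q0) ?divr_ge0 ?(ltW D0) ?(ltW w0).
have h : v `^ q <= w `^ q * (1 - y / 2).
  have -> : v `^ q = w `^ q * (v / w) `^ q.
    by rewrite -powRM ?(ltW w0) ?divr_ge0 ?(ltW v0) ?(ltW w0)// mulrC divfK.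
  rewrite ler_wpM2l ?powR_ge0//.
  have vw : 0 < v / w by rewrite divr_gt0.
  apply: (@le_trans _ _ (expR (- y))).
    rewrite -[(v / w) `^ _]lnK ?posrE ?powR_gt0// ler_expR ln_powR /y -mulrN ler_wpM2l ?(ltW q0)//.
    have -> : v / w = 1 + (- (D / w)) by rewrite /w; field.
    by apply: le_ln1Dx; rewrite ltrN2 ltr_pdivrMr// mul1r /w ltrDr.
  rewrite expRN -[leRHS]invrK lef_pV2 ?posrE ?expR_gt0 ?invr_gt0//; last by lra.
  apply: le_trans (expR_ge1Dx y).
  rewrite -[leLHS]mul1r ler_pdivrMr; last by lra.
  nra.
have -> : w `^ (q - 1) = w `^ q / w.
  by rewrite powRD ?wn0 ?implybT// powR_inv1 ?(ltW w0).
have -> : w `^ q / w = 2 * (D * q)^-1 * (w `^ q * (y / 2)).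
  by rewrite /y; field; rewrite wn0 !gt_eqF.
rewrite ler_wpM2l ?mulr_ge0 ?invr_ge0 ?mulr_ge0 ?(ltW D0) ?(ltW q0)//; lra.
Qed.

Lemma sum_powR_neg p u D (N : nat) : 0 < p -> 0 < u -> 0 < D ->
  \sum_(i < N) (u + D * i.+1%:R) `^ (- (1 + p)) <= (D * p)^-1 * u `^ (- p).
Proof.
move=> p0 u0 D0.
suff : \sum_(i < N) (u + D * i.+1%:R) `^ (- (1 + p)) <=
    (D * p)^-1 * (u `^ (- p) - (u + D * N%:R) `^ (- p)).
  move/le_trans; apply; rewrite ler_wpM2l ?invr_ge0 ?mulr_ge0 ?(ltW D0) ?(ltW p0)//.
  by rewrite gerBl powR_ge0.
elim: N => [|N IH]; first by rewrite big_ord0 mulr0 addr0 subrr mulr0.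
rewrite big_ord_recr/=; apply: le_trans (lerD IH _) _.
  have v0 : 0 < u + D * N%:R by rewrite ltr_wpDr// mulr_ge0// ltW.
  have := powR_negstep p0 v0 D0.
  have -> : u + D * N%:R + D = u + D * N.+1%:R by rewrite -natr1; ring.
  by apply.
by rewrite -mulrDr addrA subrK.
Qed.

Lemma sum_powR_pos q u D (N : nat) : 0 < q <= 1 -> 0 < u -> 0 < D ->
  \sum_(i < N) (u + D * i.+1%:R) `^ (q - 1) <= 2 * (D * q)^-1 * (u + D * N%:R) `^ q.
Proof.
move=> q01 u0 D0; have /andP[q0 _] := q01.
suff : \sum_(i < N) (u + D * i.+1%:R) `^ (q - 1) <=
    2 * (D * q)^-1 * ((u + D * N%:R) `^ q - u `^ q).
  move/le_trans; apply; rewrite ler_wpM2l ?mulr_ge0 ?invr_ge0 ?mulr_ge0 ?(ltW D0) ?(ltW q0)//.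
  by rewrite gerBl powR_ge0.
elim: N => [|N IH]; first by rewrite big_ord0 mulr0 addr0 subrr mulr0.
rewrite big_ord_recr/=; apply: le_trans (lerD IH _) _.
  have v0 : 0 < u + D * N%:R by rewrite ltr_wpDr// mulr_ge0// ltW.
  have := powR_posstep q01 v0 D0.
  have -> : u + D * N%:R + D = u + D * N.+1%:R by rewrite -natr1; ring.
  by apply.
by rewrite -mulrDr addrC addrA subrK.
Qed.

End PowerSums.

(** * Telescoping the corrected kernel over time *)

Section Duhamel.
Variables (R : realType) (k : nat).
Variables (P Q Rm : int -> 'M[R]_k.+1) (mm : int -> 'cV[R]_k.+1) (i0 : 'I_k.+1).
Variables (K D Cg beta s1 : R).
Hypothesis beta01 : 0 < beta <= 4^-1.
Hypothesis env_ge0 : forall n, nonneg_mx (P n) /\ nonneg_mx (Q n) /\ nonneg_mx (Rm n).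
Hypothesis env_sum : forall n, (P n + Q n + Rm n) *m (const_mx 1 : 'cV[R]_k.+1) = const_mx 1.
Hypothesis mm_harm : forall n, mm n = P n *m mm (n + 1) + Rm n *m mm n + Q n *m mm (n - 1).
Hypothesis mm_step : forall (n1 n2 : int) (i1 i2 : 'I_k.+1),
     `|n1 - n2| <= 1 -> `|mm n1 i1 0 - mm n2 i2 0| <= K.
Hypothesis D_gt0 : 0 < D.
Hypothesis Cg_gt0 : 0 < Cg.
Hypothesis s1_ge1 : 1 <= s1.
Hypothesis s1D : 2 * D <= s1 ^+ 2.
Local Notation E := (Ex P Q Rm i0).

(* The bounds hold simultaneously on all scales s, since the heat kernel runs
   through all of them. *)
Definition good_corrector (N : nat) (x : R) (g : int -> 'I_k.+1 -> R) :=
  forall n i, `|n| <= N%:Z ->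
    walk_step P Q Rm g n i - g n i = qvec P Q Rm mm n i 0 - D /\
    forall s, s1 <= s -> N%:R <= s ^+ 4 ->
      `|g n i| <= Cg * (s `^ (- beta) * (s + `|x - mm n i 0|) ^+ 2) /\
      (forall n' i', `|n' - n| <= 1 ->
        `|g n' i' - g n i| <= Cg * (s `^ (- beta) * (s + `|x - mm n i 0|))).

(** The index counts remaining time: at time [N - i] the kernel has variance [s0^2 + D i]. The
    expectation of the corrected kernel would be constant in time if its drift vanished, and the sum
    collects the one step errors. *)
Lemma duhamel j : exists2 C : R, 0 < C & forall (N : nat) x g s0,
  good_corrector N x g -> s1 <= s0 -> N%:R <= s0 ^+ 4 ->
  `|E N (corrected mm j (s0 ^+ 2) x g) - corrected mm j (s0 ^+ 2 + D * N%:R) x g 0 i0| <=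
  C * \sum_(i < N) (Num.sqrt (s0 ^+ 2 + D * i.+1%:R) `^ (- beta) * Num.sqrt (s0 ^+ 2 + D * i.+1%:R) ^- j.+2
     * E (N - i.+1)%N (fun n i' => gauss (8 * (s0 ^+ 2 + D * i.+1%:R)) (x - mm n i' 0))).
Proof.
have [C C0 HC] := corrected_step env_ge0 env_sum mm_harm mm_step D_gt0 Cg_gt0 j.
exists C => // N x g s0 gg s10 Ns.
have s00 : 0 < s0 by apply: lt_le_trans s10; exact: lt_le_trans s1_ge1.
have s020 : 0 < s0 ^+ 2 by rewrite exprn_gt0.
pose U (i : nat) := s0 ^+ 2 + D * i%:R.
have U0 i : 0 < U i by rewrite ltr_wpDr// mulr_ge0// ltW.
suff H i : (i <= N)%N -> `|E N (corrected mm j (U 0%N) x g) - E (N - i)%N (corrected mm j (U i) x g)| <=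
   C * \sum_(l < i) (Num.sqrt (U l.+1) `^ (- beta) * Num.sqrt (U l.+1) ^- j.+2
     * E (N - l.+1)%N (fun n i' => gauss (8 * U l.+1) (x - mm n i' 0))).
  by have := H N (leqnn N); rewrite subnn /U mulr0 addr0.
elim: i => [|i IH] iN; first by rewrite subn0 subrr normr0 big_ord0 mulr0.
rewrite big_ord_recr/= mulrDr.
have -> : E N (corrected mm j (U 0%N) x g) - E (N - i.+1)%N (corrected mm j (U i.+1) x g) =
  (E N (corrected mm j (U 0%N) x g) - E (N - i)%N (corrected mm j (U i) x g)) +
  (E (N - i)%N (corrected mm j (U i) x g) - E (N - i.+1)%N (corrected mm j (U i.+1) x g)) by ring.
apply: le_trans (ler_normD _ _) _; apply: lerD; first exact: IH (ltnW iN).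
have -> : (N - i = (N - i.+1).+1)%N by rewrite subnSK.
rewrite ExS -ExB mulrA -ExZ; apply: Ex_norm => // n i' nN.
set s := Num.sqrt (U i.+1).
have s0U : U i.+1 = s ^+ 2 by rewrite sqr_sqrtr// ltW.
have s_gt0 : 0 < s by rewrite sqrtr_gt0.
have ss0 : s0 <= s.
  rewrite -(@ler_pXn2r _ 2) ?nnegrE ?(ltW s00) ?(ltW s_gt0)// -s0U /U lerDl.
  by rewrite mulr_ge0// ltW.
have s1s : s1 <= s by exact: le_trans ss0.
have UiE : U i = s ^+ 2 - D by rewrite -s0U /U -natr1; ring.
have nN' : `|n| <= N%:Z by apply: le_trans nN _; rewrite lez_nat leq_subr.
have [pois gb] := gg n i' nN'.
have Ns' : N%:R <= s ^+ 4.
  by apply: le_trans Ns _; rewrite lerXn2r ?nnegrE ?(ltW s00) ?(ltW s_gt0).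
have [g1 g2] := gb s s1s Ns'.
have s1' : 1 <= s by exact: le_trans s1s.
have h : s^-1 <= s `^ (- beta).
  rewrite powRN lef_pV2 ?posrE ?powR_gt0//.
  by apply: ler1_powR => //; have /andP[_ /le_trans] := beta01; apply; lra.
rewrite UiE s0U -mulrA; apply: HC => //.
apply: le_trans s1D _; rewrite lerXn2r ?nnegrE ?(ltW s_gt0)//.
exact: le_trans s1_ge1.
Qed.

End Duhamel.

(** * The corrector of the environment *)

Lemma exists_powRN_le (R : realType) (beta c : R) : 0 < beta -> 0 < c ->
  exists2 s1 : R, 1 <= s1 & forall s, s1 <= s -> s `^ (- beta) <= c.
Proof.
move=> b0 c0; exists (1 + c^-1 `^ beta^-1); first by rewrite lerDl powR_ge0.
move=> s hs.
have s0 : 0 < s by apply: lt_le_trans hs; rewrite ltr_pwDl// powR_ge0.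
rewrite powRN -[leRHS]invrK lef_pV2 ?posrE ?invr_gt0 ?powR_gt0//.
rewrite -[leLHS]powRr1 ?invr_ge0 ?(ltW c0)// -(mulVf (lt0r_neq0 b0)) powRrM.
rewrite ge0_ler_powR ?nnegrE ?powR_ge0 ?(ltW b0) ?(ltW s0)//.
by apply: le_trans hs; rewrite lerDr.
Qed.

Lemma box_le (W l : nat) : (l < (W + W).+1)%N -> `|l%:Z - W%:Z| <= W%:Z.
Proof. lia. Qed.

Lemma box_index (W : nat) (n : int) : `|n| <= W%:Z ->
  exists2 l : nat, (l < (W + W).+1)%N & n = l%:Z - W%:Z.
Proof. by move=> nW; exists (absz (n + W%:Z)%R); lia. Qed.

Lemma ler_int_addn (N m : nat) (n : int) : `|n| <= N%:Z -> `|n| <= (N + m)%N%:Z.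
Proof. lia. Qed.

Lemma ler_int_near2 (N : nat) (n n' : int) : `|n| <= N%:Z -> `|n' - n| <= 1 -> `|n'| <= (N + 2)%N%:Z.
Proof. lia. Qed.

Section Primitive.
Variables (R : realType) (sigma : int -> R).

Definition primitive (n : int) : R :=
  match n with
  | Posz m => \sum_(l < m) sigma (l.+1)%:Z
  | Negz m => - \sum_(l < m.+1) sigma (- l%:Z)
  end.

Lemma primitiveE n : primitive n - primitive (n - 1) = sigma n.
Proof.
case: n => [[|m]|m].
- by rewrite sub0r -[- 1]/(Negz 0) /primitive big_ord0 big_ord_recl big_ord0 addr0 opprK add0r oppr0.
- have -> : m.+1%:Z - 1 = m%:Z by rewrite -addn1 PoszD addrK.
  by rewrite /primitive big_ord_recr/= addrAC subrr add0r.
- have -> : Negz m - 1 = Negz m.+1 by rewrite !NegzE -[m.+2]addn1 PoszD opprD.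
  rewrite /primitive [X in - - X]big_ord_recr/= opprK addKr.
  by rewrite NegzE.
Qed.

Lemma primitive_window (c : int) (l : nat) :
  primitive (c + l%:Z) - primitive (c - 1) = \sum_(i < l.+1) sigma (c + i%:Z).
Proof.
elim: l => [|l IH]; first by rewrite addr0 big_ord_recl big_ord0 !addr0 primitiveE.
rewrite big_ord_recr/= -IH -(primitiveE (c + l.+1%:Z)).
have -> : c + l.+1%:Z - 1 = c + l%:Z by rewrite -addn1 PoszD addrA addrK.
ring.
Qed.

End Primitive.

(** * Correctors from the standing assumptions *)

Section StandingAssumptions.
Variables (R : realType) (k : nat).
Notation M := 'M[R]_k.+1.
Notation cV := 'cV[R]_k.+1.
Notation rV := 'rV[R]_k.+1.
Variables (P Q Rm zeta zm : int -> M) (mm : int -> cV) (rho : int -> rV).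
Variables (eps : R) (k0 : nat) (K B C beta1 a b : R).
Hypothesis env_ge0 : forall n, nonneg_mx (P n) /\ nonneg_mx (Q n) /\ nonneg_mx (Rm n).
Hypothesis env_sum : forall n, (P n + Q n + Rm n) *m (const_mx 1 : cV) = const_mx 1.
Hypothesis eps_gt0 : 0 < eps.
Hypothesis env_elliptic : forall n, mxnorm (Rm n ^+ k0) <= 1 - eps /\
     (forall i j, eps <= (invmx (1 - Rm n) *m P n) i j) /\
     (forall i j, eps <= (invmx (1 - Rm n) *m Q n) i j).
Hypothesis zetaP : is_zeta P Q Rm zeta.
Hypothesis mm_step : forall (n1 n2 : int) (i1 i2 : 'I_k.+1),
     `|n1 - n2| <= 1 -> `|mm n1 i1 0 - mm n2 i2 0| <= K.
Hypothesis zm_stochastic : forall n, stochastic (zm n).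
Hypothesis rho_gt0 : forall n j, 0 < rho n 0 j.
Hypothesis rho_le : forall n j, rho n 0 j <= B.
Hypothesis rho_alpha : forall n, rho n = rho (n + 1) *m alpha Q Rm zeta n.
Hypothesis rho_norm : forall n, (rho n *m P n *m (mm (n + 1) - zm (n + 1) *m mm n)) 0 0
             = (2 * (k.+1)%:R)^-1.
Hypotheses (C_gt0 : 0 < C) (beta1_01 : 0 < beta1 < 1) (a_gt0 : 0 < a) (b_gt0 : 0 < b).
Hypothesis windows : forall (N L : nat) (c : int), (0 < N)%N ->
     (N%:R : R) `^ (100%:R^-1) <= L%:R -> `|c| <= N%:Z ->
     `|mm (c + L%:Z) ord0 0 - mm (c - L%:Z) ord0 0 - 2 * L%:R|
        <= C * (L%:R `^ (1 - beta1)) /\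
     `|\sum_(l < (L + L).+1) (rho (c - L%:Z + l%:Z) *m (const_mx 1 : 'cV[R]_k.+1)) 0 0
        - 2 * L%:R * a| <= C * (L%:R `^ (1 - beta1)) /\
     `|\sum_(l < (L + L).+1) (rho (c - L%:Z + l%:Z)
                               *m qvec P Q Rm mm (c - L%:Z + l%:Z)) 0 0
        - 2 * L%:R * b| <= C * (L%:R `^ (1 - beta1)).

Let D := b / a.
Definition rate_exp : R := Num.min 4^-1 beta1.
Local Notation beta := rate_exp.

Lemma rate_exp01 : 0 < beta <= 4^-1.
Proof.
by rewrite /beta lt_min ge_min lexx invr_gt0 ltr0n andbT; case/andP: beta1_01.
Qed.
Let beta01 := rate_exp01.

Let D_gt0 : 0 < D. Proof. exact: divr_gt0. Qed.

Let windowL (N L : nat) : (0 < N)%N -> (N%:R : R) `^ (100%:R^-1) <= L%:R ->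
  1 <= L%:R `^ (1 - beta) :> R /\ L%:R `^ (1 - beta1) <= L%:R `^ (1 - beta) :> R.
Proof.
move=> N0 NL; have L1 : 1 <= L%:R :> R.
  by apply: le_trans NL; rewrite -[leLHS](powRr0 N%:R) ler_powR ?ler1n// invr_ge0.
have /andP[b0 b4] := beta01.
split; last by rewrite ler_powR// lerD2l lerN2 /beta ge_min lexx orbT.
by rewrite -[leLHS](powRr0 L%:R) ler_powR//; lra.
Qed.

Lemma mm_window : exists2 C' : R, 0 < C' & forall (N : nat) (s : R), (0 < N)%N ->
  1 <= s -> N%:R <= s ^+ 4 -> forall n c : int,
  `|n| <= (2 * N + 5)%N%:Z -> `|c| <= (2 * N + 5)%N%:Z ->
  `|(mm n ord0 0 - n%:~R) - (mm c ord0 0 - c%:~R)| <= C' * (s `^ (- beta) * (s + `|n - c|%:~R)).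
Proof.
apply: (@window_bound R beta beta01 (fun n => mm n ord0 0 - n%:~R) (K + 1) C).
- exact: ltW.
- move=> n; have -> : mm (n + 1) ord0 0 - (n + 1)%:~R - (mm n ord0 0 - n%:~R) =
    (mm (n + 1) ord0 0 - mm n ord0 0) - 1 by rewrite intrD; ring.
  apply: le_trans (ler_normB _ _) _; rewrite normr1 lerD2r; apply: mm_step.
  by rewrite addrAC subrr add0r normr1.
- move=> N L c N0 NL cN; have [h _] := windows N0 NL cN.
  have [_ h'] := windowL N0 NL.
  rewrite intrD intrB.
  have -> : mm (c + L%:Z) ord0 0 - (c%:~R + L%:Z%:~R) - (mm (c - L%:Z) ord0 0 - (c%:~R - L%:Z%:~R)) =
    mm (c + L%:Z) ord0 0 - mm (c - L%:Z) ord0 0 - 2 * L%:R by rewrite -pmulrn; ring.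
  by apply: le_trans h _; rewrite ler_wpM2l// ltW.
Qed.

Lemma qvec_le n i : 0 <= qvec P Q Rm mm n i 0 <= K ^+ 2.
Proof.
have -> : qvec P Q Rm mm n i 0 = walk_step P Q Rm (fun n' j => (mm n i 0 - mm n' j 0) ^+ 2) n i.
  by rewrite mxE; apply: eq_bigr => j _; ring.
apply/andP; split.
  rewrite -[leLHS](walk_step_cst env_sum _ n i); apply: walk_step_le => // n' j _.
  exact: sqr_ge0.
rewrite -[leRHS](walk_step_cst env_sum _ n i); apply: walk_step_le => // n' j nn'.
rewrite -real_normK ?num_real// lerXn2r ?nnegrE//; last by apply: mm_step; rewrite distrC.
by apply: le_trans (mm_step (n1 := n) (n2 := n) ord0 ord0 _); rewrite ?subrr ?normr0.
Qed.

Let f n : cV := qvec P Q Rm mm n - const_mx D.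
Let sigma n := (rho n *m f n) 0 0.
Let Cf := K ^+ 2 + D.

Let f_le n i : `|f n i 0| <= Cf.
Proof.
have /andP[q0 q1] := qvec_le n i.
have -> : f n i 0 = qvec P Q Rm mm n i 0 - D by rewrite !mxE.
apply: le_trans (ler_normB _ _) _.
by rewrite (ger0_norm q0) (ger0_norm (ltW D_gt0)) lerD2r.
Qed.

Let sigma_le n : `|sigma n| <= (k.+1)%:R * (B * Cf).
Proof.
rewrite /sigma mxE; apply: le_trans (ler_norm_sum _ _ _) _.
apply: (@le_trans _ _ (\sum_(j < k.+1) B * Cf)); last first.
  by rewrite sumr_const card_ord -[leLHS]mulr_natl.
apply: ler_sum => j _; apply: ler_normM => //.
by rewrite ger0_norm ?(ltW (rho_gt0 _ _)).
Qed.

Let sigmaE n : sigma n = (rho n *m qvec P Q Rm mm n) 0 0 - D * (rho n *m (const_mx 1 : cV)) 0 0.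
Proof.
rewrite /sigma /f mulmxBr mxE [X in _ + X]mxE; congr (_ - _).
have -> : const_mx D = D *: (const_mx 1 : cV) by apply/colP => i; rewrite !mxE mulr1.
by rewrite -scalemxAr mxE.
Qed.

(** The choice [D = b / a] is made here: it cancels the linear parts [2 L b] and [D * 2 L a] of the
    two averages. *)
Lemma Sig_window : exists2 C' : R, 0 < C' & forall (N : nat) (s : R), (0 < N)%N ->
  1 <= s -> N%:R <= s ^+ 4 -> forall n c : int,
  `|n| <= (2 * N + 5)%N%:Z -> `|c| <= (2 * N + 5)%N%:Z ->
  `|primitive sigma n - primitive sigma c| <= C' * (s `^ (- beta) * (s + `|n - c|%:~R)).
Proof.
have Cs0 : 0 <= (k.+1)%:R * (B * Cf) by apply: le_trans (sigma_le 0).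
have CD0 : 0 <= C * (1 + D) by rewrite mulr_ge0 ?addr_ge0 ?(ltW C_gt0) ?(ltW D_gt0).
apply: (@window_bound R beta beta01 _ ((k.+1)%:R * (B * Cf)) (C * (1 + D) + (k.+1)%:R * (B * Cf))).
- by rewrite addr_ge0.
- by move=> n; rewrite -[X in _ - primitive _ X](addrK 1 n) primitiveE.
move=> N L c N0 NL cN; have [_ [h1 h2]] := windows N0 NL cN.
have [hL1 hL] := windowL N0 NL.
(* The window has [2 L + 1] terms, the increment of the primitive one fewer; the bounded first term
   is absorbed since [1 <= L^(1 - beta)]. *)
have E : primitive sigma (c + L%:Z) - primitive sigma (c - L%:Z) =
    \sum_(l < (L + L).+1) sigma (c - L%:Z + l%:Z) - sigma (c - L%:Z).
  rewrite -primitive_window -(primitiveE sigma (c - L%:Z)) PoszD addrA subrK; ring.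
rewrite E mulrDl; apply: le_trans (ler_normB _ _) _; apply: lerD; last first.
  by apply: le_trans (sigma_le _) _; rewrite ler_peMr.
under eq_bigr do rewrite sigmaE.
rewrite sumrB -mulr_sumr.
set S1 := \sum_(l < _) _ in h1 *; set S2 := \sum_(l < _) _ in h2 *.
have -> : S2 - D * S1 = (S2 - 2 * L%:R * b) - D * (S1 - 2 * L%:R * a).
  by rewrite /D; field; rewrite gt_eqF.
rewrite [leRHS](_ : _ = C * L%:R `^ (1 - beta) + D * (C * L%:R `^ (1 - beta))); last by ring.
apply: le_trans (ler_normB _ _) _; apply: lerD.
  by apply: le_trans h2 _; rewrite ler_wpM2l// ltW.
rewrite normrM (ger0_norm (ltW D_gt0)) ler_wpM2l ?(ltW D_gt0)//.
by apply: le_trans h1 _; rewrite ler_wpM2l// ltW.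
Qed.

Let K_gt0 : 0 < K.
Proof.
have h := lam_ge env_ge0 env_sum eps_gt0 env_elliptic zetaP mm_step zm_stochastic rho_gt0
  rho_alpha rho_norm 0 ord0.
have : 0 < K * lam Q rho 0 0 ord0 by apply: lt_le_trans h; rewrite divr_gt0.
have l0 : 0 <= lam Q rho 0 0 ord0.
  rewrite mxE sumr_ge0// => j _; rewrite mulr_ge0 ?(ltW (rho_gt0 _ _))//.
  by have [_ []] := env_ge0 (0 + 1).
have K0 : 0 <= K by apply: le_trans (mm_step (n1 := 0) (n2 := 0) ord0 ord0 _); rewrite ?subrr ?normr0.
move=> h1; rewrite lt_neqAle K0 andbT; apply/eqP => e.
by rewrite -e mul0r ltxx in h1.
Qed.

Lemma good_corrector_exists : exists Cg s1, [/\ 0 < Cg, 1 <= s1, 2 * D <= s1 ^+ 2 &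
  forall (N : nat) (x : R), (0 < N)%N -> exists g, good_corrector P Q Rm mm D Cg beta s1 N x g].
Proof.
have [C1 C10 HSig] := Sig_window.
have [C' C'0 Hw] := mm_window.
have c10 : 0 < eps / (2 * k.+1%:R) / K by rewrite !divr_gt0.
have lge n i : eps / (2 * k.+1%:R) / K <= lam Q rho n 0 i.
  rewrite ler_pdivrMr// [leRHS]mulrC.
  exact: (lam_ge env_ge0 env_sum eps_gt0 env_elliptic zetaP mm_step zm_stochastic rho_gt0 rho_alpha rho_norm).
have Sinv n : (1 - Rm n - Q n *m zeta (n - 1)) *m resolvent Q Rm zeta n = 1.
  exact/mulmxV/(unitmx_resolventE env_ge0 env_sum eps_gt0 env_elliptic zetaP).
have [Cc [sc [Cc0 sc1 Hc]]] := corrector beta01 eps_gt0 env_sum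
  (zeta_stochastic env_ge0 env_sum eps_gt0 env_elliptic zetaP)
  (zeta_ge env_ge0 env_sum eps_gt0 env_elliptic zetaP) Sinv
  (resolventn_ge0 env_ge0 env_sum eps_gt0 env_elliptic zetaP)
  (zetaE env_ge0 env_sum eps_gt0 env_elliptic zetaP) (AmxE Q Rm zeta)
  (Amx_ge env_ge0 env_sum eps_gt0 env_elliptic zetaP)
  (lam_resolvent rho_alpha) (lam_Amx rho_alpha) c10 lge
  (lam_le env_ge0 env_sum eps_gt0 env_elliptic zetaP rho_gt0 rho_le rho_alpha)
  (fun n i => ltW (rho_gt0 n i)) rho_le f_le (primitiveE sigma) C10 HSig.
have /andP[b0 b4] := beta01.
have c0 : 0 < (2 * C')^-1 by rewrite invr_gt0 mulr_gt0.
have [sb sb1 Hb] := exists_powRN_le b0 c0.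
(* Once [s^(-beta) <= 1 / (2 C')], which [sb] ensures, [mm n - n] varies by at most half of
   [s + |n - c|]. Solving for [|n - c|] gives [s + |n - c| <= L * (s + |x - mm n i 0|)] with this
   [L]. *)
pose L := 4 + 4 * K.
have L1 : 1 <= L by rewrite /L; have := K_gt0; lra.
pose s1 := sc + sb + 2 * D.
have s1D : 2 * D <= s1 by rewrite /s1; lra.
have s11 : 1 <= s1 by rewrite /s1; have := D_gt0; lra.
exists (Cc * L ^+ 2), s1; split => //.
- by rewrite mulr_gt0// exprn_gt0// (lt_le_trans _ L1).
- by apply: le_trans s1D _; rewrite expr2 ler_peMl// (le_trans _ s11).
move=> N x N0.
pose W := (N + 2)%N.
(* c is chosen so that |n - c| is comparable with |x - mm n i 0| *)
pose lc := [arg min_(l < (ord0 : 'I_(W + W).+1)) `|mm (l%:Z - W%:Z) ord0 0 - x|]%O.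
pose c : int := (lc : nat)%:Z - W%:Z.
have cW : `|c| <= (N + 2)%N%:Z by exact: box_le (ltn_ord lc).
have cmin n : `|n| <= (N + 2)%N%:Z -> `|mm c ord0 0 - x| <= `|mm n ord0 0 - x|.
  move=> nW; rewrite /c /lc; case: arg_minP => // l _ lmin.
  have [l' l'W ->] := box_index nW.
  exact: lmin (Ordinal l'W) isT.
have [g [gE gle]] := Hc N c N0 cW.
exists (fun n i => g n i 0) => n i nN.
have nW1 := ler_int_addn 1 nN.
have nW2 := ler_int_addn 2 nN.
split.
  have := congr1 (fun v : cV => v i 0) (gE n nW1).
  have -> : f n i 0 = qvec P Q Rm mm n i 0 - D by rewrite !mxE.
  move=> <-; rewrite mxE [X in _ = _ + X]mxE.
  congr (_ - _); rewrite !mxE /walk_step -!big_split; apply: eq_bigr => j _ /=; ring.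
move=> s s1s Ns.
have ssc : sc <= s by apply: le_trans s1s; rewrite /s1; have := D_gt0; lra.
have ssb : sb <= s by apply: le_trans s1s; rewrite /s1; have := D_gt0; lra.
have s1' : 1 <= s by exact: le_trans ssb.
have h0 : 0 <= s `^ (- beta) by exact: powR_ge0.
have dz : s + `|n - c|%:~R <= L * (s + `|x - mm n i 0|).
  have w := Hw N s N0 s1' Ns n c (win_center nW2) (win_center cW).
  have hb : C' * s `^ (- beta) <= 2^-1.
    have := Hb s ssb; rewrite -(ler_pM2l C'0); congr (_ <= _).
    by field; rewrite gt_eqF.
  set l := `|n - c|%:~R in w *.
  have l0 : 0 <= l :> R by rewrite /l ler0z.
  have w2 : `|(mm n ord0 0 - n%:~R) - (mm c ord0 0 - c%:~R)| <= 2^-1 * (s + l).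
    by apply: le_trans w _; rewrite mulrA ler_wpM2r// addr_ge0// (le_trans _ s1').
  have le : l = `|n%:~R - c%:~R| :> R by rewrite /l -intrB intr_norm.
  have ln : l <= `|mm n ord0 0 - mm c ord0 0| + 2^-1 * (s + l).
    apply: le_trans (lerD (lexx _) w2); rewrite le.
    have -> : n%:~R - c%:~R = (mm n ord0 0 - mm c ord0 0) - ((mm n ord0 0 - n%:~R) - (mm c ord0 0 - c%:~R)) by ring.
    exact: ler_normB.
  have mc : `|mm n ord0 0 - mm c ord0 0| <= 2 * `|mm n ord0 0 - x|.
    have -> : mm n ord0 0 - mm c ord0 0 = (mm n ord0 0 - x) - (mm c ord0 0 - x) by ring.
    apply: le_trans (ler_normB _ _) _; have := cmin n nW2; lra.
  have mi : `|mm n ord0 0 - x| <= K + `|x - mm n i 0|.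
    have -> : mm n ord0 0 - x = (mm n ord0 0 - mm n i 0) - (x - mm n i 0) by ring.
    apply: le_trans (ler_normB _ _) _; rewrite lerD2r; apply: mm_step.
    by rewrite subrr normr0.
  have Ks : K <= K * s by rewrite ler_peMr// ltW.
  have Kz : 0 <= K * `|x - mm n i 0| by rewrite mulr_ge0// ltW.
  have z0 : 0 <= `|x - mm n i 0| by [].
  rewrite /L; lra.
have dz0 : 0 <= s + `|n - c|%:~R by rewrite addr_ge0 ?(le_trans _ s1')// ler0z.
have z0 : 0 <= s + `|x - mm n i 0| by rewrite addr_ge0 ?(le_trans _ s1').
have L2 : L <= L ^+ 2 by rewrite expr2 ler_peMl// (le_trans _ L1).
have [g1 g2] := gle s ssc Ns n nW2 i.
split.
  apply: le_trans g1 _; rewrite -[leRHS]mulrA ler_wpM2l ?(ltW Cc0)// [leRHS]mulrCA ler_wpM2l//.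
  by rewrite -exprMn lerXn2r ?nnegrE// mulr_ge0// (le_trans _ L1).
move=> n' i' nn'.
have nW' := ler_int_near2 nN nn'.
apply: le_trans (g2 n' i' nn' nW') _.
rewrite -[leRHS]mulrA ler_wpM2l ?(ltW Cc0)// [leRHS]mulrCA ler_wpM2l//.
by apply: le_trans dz _; rewrite ler_wpM2r.
Qed.

End StandingAssumptions.

(** * Concentration *)

Lemma leq_double_of_half (N i : nat) : (2 * (N - i.+1) <= N)%N -> (i < N)%N -> (N <= 2 * i.+1)%N.
Proof. lia. Qed.

Lemma ltn_double_gt0 (N t : nat) : (N < 2 * t)%N -> (0 < t)%N.
Proof. lia. Qed.

Section Concentration.
Variables (R : realType) (k : nat).
Variables (P Q Rm : int -> 'M[R]_k.+1) (mm : int -> 'cV[R]_k.+1) (i0 : 'I_k.+1).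
Variables (K D Cg beta s1 : R).
Hypothesis beta01 : 0 < beta <= 4^-1.
Hypothesis env_ge0 : forall n, nonneg_mx (P n) /\ nonneg_mx (Q n) /\ nonneg_mx (Rm n).
Hypothesis env_sum : forall n, (P n + Q n + Rm n) *m (const_mx 1 : 'cV[R]_k.+1) = const_mx 1.
Hypothesis mm_harm : forall n, mm n = P n *m mm (n + 1) + Rm n *m mm n + Q n *m mm (n - 1).
Hypothesis mm_step : forall (n1 n2 : int) (i1 i2 : 'I_k.+1),
     `|n1 - n2| <= 1 -> `|mm n1 i1 0 - mm n2 i2 0| <= K.
Hypothesis D_gt0 : 0 < D.
Hypothesis Cg_gt0 : 0 < Cg.
Hypothesis s1_ge1 : 1 <= s1.
Hypothesis s1D : 2 * D <= s1 ^+ 2.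
Hypothesis correctors : forall (N : nat) (x : R), (0 < N)%N ->
  exists g, good_corrector P Q Rm mm D Cg beta s1 N x g.
Local Notation E := (Ex P Q Rm i0).
Local Notation bump s x := (fun n i => gauss (s : R) (x - mm n i 0)).

Let Ex_gauss_le1 N u x : 0 <= u -> E N (bump u x) <= 1.
Proof.
move=> u0; rewrite -[leRHS](Ex_cst env_sum i0 N 1); apply: Ex_le => // n i _.
exact: gauss_le1.
Qed.

Let Ex_gauss3 N s x : 0 < s -> E N (bump (8 * s ^+ 2) x) <= E N (bump ((3 * s) ^+ 2) x).
Proof.
move=> s0; apply: Ex_le => // n i _; have s20 : 0 < s ^+ 2 by rewrite exprn_gt0.
by apply: ler_gauss; [rewrite mulr_gt0|rewrite exprMn ler_pM2r//; lra].
Qed.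

(** An estimate of local limit type: the chance that the martingale is within [s] of [x] is at most
    of order [s / sqrt N], uniformly in [x], down to [s = N^(1/4)]. *)
Definition concentrated A N := forall s x, 1 <= s -> N%:R <= s ^+ 4 ->
  E N (bump (s ^+ 2) x) <= A * (s / Num.sqrt N%:R).

(** If more than half of the time has elapsed, the induction hypothesis applies at scale [3 v], and
    [9 N <= 25 t] gives the factor 5. Otherwise [v >= sqrt (D N / 2)] and the trivial bound 1
    suffices. *)
Lemma Ex_gauss_before A N s x i : 0 < A -> (forall t, (0 < t < N)%N -> concentrated A t) ->
  1 <= s -> N%:R <= s ^+ 4 -> (i < N)%N ->
  E (N - i.+1)%N (bump (8 * (s ^+ 2 + D * i.+1%:R)) x) <=
    (5 * A + Num.sqrt (2 / D)) * (Num.sqrt (s ^+ 2 + D * i.+1%:R) / Num.sqrt N%:R).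
Proof.
move=> A0 IH s1' Ns iN; have N0 : (0 < N)%N by exact: leq_trans iN.
have s0 : 0 < s by exact: lt_le_trans s1'.
set u := s ^+ 2 + D * i.+1%:R; set v := Num.sqrt u; set t := (N - i.+1)%N.
have u0 : 0 < u by rewrite ltr_pwDl ?exprn_gt0// mulr_ge0// ltW.
have v0 : 0 < v by rewrite sqrtr_gt0.
have uv : u = v ^+ 2 by rewrite sqr_sqrtr// ltW.
have NR : 0 < N%:R :> R by rewrite ltr0n.
have rN0 : 0 < Num.sqrt N%:R :> R by rewrite sqrtr_gt0.
have sv : s <= v.
  rewrite -(@ler_pXn2r _ 2) ?nnegrE ?(ltW s0) ?(ltW v0)// -uv /u lerDl.
  by rewrite mulr_ge0// ltW.
have vN0 : 0 <= v / Num.sqrt N%:R by rewrite divr_ge0// ltW.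
have [tN|Nt] := leqP (2 * t) N.
  apply: (@le_trans _ _ (Num.sqrt (2 / D) * (v / Num.sqrt N%:R))); last first.
    by rewrite ler_wpM2r// lerDr mulr_ge0// ltW.
  apply: le_trans (Ex_gauss_le1 _ _ _) _; first by rewrite mulr_ge0// ltW.
  rewrite mulrA ler_pdivlMr// mul1r -sqrtrM ?divr_ge0 ?(ltW D_gt0)// ler_sqrt; last first.
    by rewrite mulr_ge0 ?divr_ge0 ?(ltW u0) ?(ltW D_gt0).
  have h : N%:R <= 2 * i.+1%:R :> R.
    by rewrite -natrM ler_nat; exact: leq_double_of_half.
  have -> : 2 / D * u = 2 / D * s ^+ 2 + 2 * i.+1%:R by rewrite /u; field; rewrite gt_eqF.
  by apply: le_trans h _; rewrite lerDr mulr_ge0 ?sqr_ge0// divr_ge0// ltW.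
have t0 := ltn_double_gt0 Nt.
have tN : (t < N)%N by rewrite /t ltn_subrL N0.
have tR : 0 < t%:R :> R by rewrite ltr0n.
rewrite uv; apply: le_trans (Ex_gauss3 _ _ v0) _.
have v3 : 1 <= 3 * v by apply: le_trans s1' _; apply: le_trans sv _; lra.
have Nv : t%:R <= (3 * v) ^+ 4.
  apply: le_trans (_ : N%:R <= _); first by rewrite ler_nat ltnW.
  apply: le_trans Ns _; rewrite lerXn2r ?nnegrE ?mulr_ge0 ?(ltW s0) ?(ltW v0)//.
  by apply: le_trans sv _; lra.
apply: le_trans (IH t _ (3 * v) x v3 Nv) _; first by rewrite t0 tN.
apply: (@le_trans _ _ (5 * A * (v / Num.sqrt N%:R))); last first.
  by rewrite ler_wpM2r// lerDl sqrtr_ge0.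
have rt0 : 0 < Num.sqrt t%:R :> R by rewrite sqrtr_gt0.
have h : 3 * Num.sqrt N%:R <= 5 * Num.sqrt t%:R :> R.
  rewrite -(@ler_pXn2r _ 2) ?nnegrE ?mulr_ge0 ?sqrtr_ge0//.
  rewrite !exprMn !sqr_sqrtr ?ler0n//.
  have : N%:R <= 2 * t%:R :> R by rewrite -natrM ler_nat ltnW.
  lra.
rewrite mulrA ler_pdivrMr//.
have -> : 5 * A * (v / Num.sqrt N%:R) * Num.sqrt t%:R =
   A * v * (5 * Num.sqrt t%:R) / Num.sqrt N%:R by field; rewrite gt_eqF.
rewrite ler_pdivlMr// -mulrA -!(mulrA A) ler_wpM2l ?(ltW A0)//.
have -> : 3 * v * Num.sqrt N%:R = v * (3 * Num.sqrt N%:R) by ring.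
by rewrite ler_wpM2l// ltW.
Qed.

(** The case [j = 1], where [heat 1] is the Gaussian divided by [s]. The value at time 0 is of order
    [1 / sqrt N], its variance being at least [D N]; the summed drift and the final correction
    reproduce [A / sqrt N] with a factor [s^(-beta)]. *)
Lemma concentration : exists2 A : R, 0 < A & forall N, (0 < N)%N -> concentrated A N.
Proof.
have [CD CD0 HD] := duhamel i0 beta01 env_ge0 env_sum mm_harm mm_step D_gt0 Cg_gt0 s1_ge1 s1D 1.
have [CH CH0 HH] := corrected_heat mm Cg_gt0 1.
have /andP[b0 b4] := beta01.
pose Cs := (D * (beta / 2))^-1.
have Cs0 : 0 < Cs by rewrite invr_gt0 mulr_gt0// divr_gt0.
have rD0 : 0 < Num.sqrt D by rewrite sqrtr_gt0.
(* To be closed at the end is [B1 + h * B2 * A <= A] with [h = s^(-beta)]. The threshold [s2] gives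
   [h * B2 <= 1/2]; then [2 * B1] in [A] suffices, while [s2 ^+ 2] in [A] covers the scales below
   [s2], where [sqrt N <= s2 ^+ 2]. *)
pose B1 := (1 + CH) / Num.sqrt D + CD * Cs * Num.sqrt (2 / D).
pose B2 := 3 * CH + 5 * CD * Cs.
have B20 : 0 < B2 by rewrite addr_gt0 ?mulr_gt0.
have B10 : 0 < B1 by rewrite ltr_pwDl ?divr_gt0 ?addr_gt0// !mulr_ge0 ?sqrtr_ge0 ?(ltW CD0) ?(ltW Cs0).
have c0 : 0 < (2 * B2)^-1 by rewrite invr_gt0 mulr_gt0.
have [sb sb1 Hb] := exists_powRN_le b0 c0.
pose s2 := s1 + sb.
have s21 : 1 <= s2 by rewrite /s2; have := s1_ge1; lra.
pose A := s2 ^+ 2 + 2 * B1.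
have A1 : 1 <= A.
  by rewrite ler_wpDr ?mulr_ge0 ?(ltW B10)// exprn_ege1.
have A0 : 0 < A by exact: lt_le_trans A1.
exists A => // N; elim/ltn_ind: N => N IHN N0.
have IH t : (0 < t < N)%N -> concentrated A t by move=> /andP[t0 tN]; exact: IHN.
have NR : 0 < N%:R :> R by rewrite ltr0n.
rewrite /concentrated; set rN := Num.sqrt N%:R.
have rN0 : 0 < rN by rewrite sqrtr_gt0.
(* Descending induction on the scale s: the error at scale s involves the same
   expectation at scale 3 * s, and scales above rN are trivial. *)
suff H m : forall s x, 1 <= s -> N%:R <= s ^+ 4 -> rN <= s * 3 ^+ m ->
    E N (bump (s ^+ 2) x) <= A * (s / rN).
  move=> s x s1' Ns; apply: (H N) => //.
  have : N%:R <= 3 ^+ N :> R by rewrite -natrX ler_nat ltnW// ltn_expl.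
  have : rN <= N%:R.
    have : 1 <= N%:R :> R by rewrite ler1n.
    by move=> N1; rewrite -[leRHS]ger0_norm// -sqrtr_sqr ler_sqrt ?exprn_gt0// expr2 ler_peMl.
  move=> h1 h2; apply: le_trans h1 _; apply: le_trans h2 _.
  by rewrite ler_peMl// exprn_ge0.
elim: m => [|m IHm] s x s1' Ns sm.
  rewrite expr0 mulr1 in sm.
  apply: le_trans (Ex_gauss_le1 _ _ _) _; first exact: sqr_ge0.
  rewrite -[leLHS]mulr1; apply: ler_pM => //.
  by rewrite ler_pdivlMr// mul1r.
have s0 : 0 < s by exact: lt_le_trans s1'.
have [ss2|s2s] := ltP s s2.
  apply: le_trans (Ex_gauss_le1 _ _ _) _; first exact: sqr_ge0.
  have rNs : rN <= s2 ^+ 2.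
    rewrite -(@ler_pXn2r _ 2) ?nnegrE ?sqr_ge0 ?(ltW rN0)// sqr_sqrtr ?ler0n// -exprM.
    have s2p : 0 <= s2 by apply: le_trans s21.
    by apply: le_trans Ns _; rewrite -[(2 * 2)%N]/4%N lerXn2r ?nnegrE ?(ltW s0) ?(ltW ss2).
  rewrite mulrA ler_pdivlMr// mul1r; apply: le_trans rNs _.
  rewrite -[leLHS]mulr1; apply: ler_pM => //; first exact: sqr_ge0.
  by rewrite lerDl mulr_ge0 ?(ltW B10).
have ss1 : s1 <= s by apply: le_trans s2s; rewrite /s2; lra.
have ssb : sb <= s by apply: le_trans s2s; rewrite /s2; have := s1_ge1; lra.
set h := s `^ (- beta).
have hB : h <= (2 * B2)^-1 by exact: Hb.
have h0 : 0 < h by rewrite powR_gt0.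
have [g gg] := correctors x N0.
have s20 : 0 < s ^+ 2 by rewrite exprn_gt0.
set Psi := corrected mm 1 (s ^+ 2) x g.
have wide : E N (bump (8 * s ^+ 2) x) <= 3 * A * (s / rN).
  apply: le_trans (Ex_gauss3 _ _ s0) _.
  rewrite (_ : 3 * A * (s / rN) = A * (3 * s / rN)); last by field; rewrite gt_eqF.
  apply: IHm; first by lra.
    by apply: le_trans Ns _; rewrite lerXn2r ?nnegrE ?(ltW s0) ?mulr_ge0 ?(ltW s0)//; lra.
  by apply: le_trans sm _; rewrite exprS mulrCA mulrA.
have step1 : s^-1 * E N (bump (s ^+ 2) x) <= E N Psi + CH * (h * s ^- 1 * (3 * A * (s / rN))).
  apply: (@le_trans _ _ (E N Psi + CH * (h * s ^- 1) * E N (bump (8 * s ^+ 2) x))); last first.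
    rewrite lerD2l -[leLHS]mulrA ler_wpM2l ?(ltW CH0)// ler_wpM2l//.
    by rewrite mulr_ge0 ?(ltW h0)// invr_ge0 exprn_ge0 ?(ltW s0).
  rewrite -!ExZ -ExD; apply: Ex_le => // n i nN.
  have [_ /(_ s ss1 Ns)[g1 _]] := gg n i nN.
  have := HH g n i x s h s0 h0 g1.
  rewrite heat1// distrC => hh; rewrite -mulrA.
  have := le_trans (ler_norm _) hh; rewrite /Psi; lra.
have step2 : E N Psi <= corrected mm 1 (s ^+ 2 + D * N%:R) x g 0 i0 +
    CD * (Cs * h * ((5 * A + Num.sqrt (2 / D)) / rN)).
  have := HD N x g s gg ss1 Ns => hh.
  have {}hh := le_trans (ler_norm _) hh.
  rewrite -lerBlDl; apply: le_trans hh _; rewrite ler_wpM2l ?(ltW CD0)//.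
  apply: (@le_trans _ _ (\sum_(i < N) (s ^+ 2 + D * i.+1%:R) `^ (- (1 + beta / 2)) * ((5 * A + Num.sqrt (2 / D)) / rN))).
    apply: ler_sum => i _.
    have u0 : 0 < s ^+ 2 + D * i.+1%:R by rewrite ltr_pwDl// mulr_ge0// ltW.
    apply: le_trans (ler_wpM2l _ (Ex_gauss_before x A0 IH s1' Ns (ltn_ord i))) _.
      by rewrite mulr_ge0 ?powR_ge0// invr_ge0 exprn_ge0// sqrtr_ge0.
    set u := s ^+ 2 + D * i.+1%:R in u0 *; set v := Num.sqrt u.
    have v0 : 0 < v by rewrite sqrtr_gt0.
    have -> : u `^ (- (1 + beta / 2)) = v `^ (- beta) * v ^- 2.
      have un0 : u != 0 by rewrite gt_eqF.
      rewrite (_ : - (1 + beta / 2) = - (beta / 2) + -1); last by ring.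
      rewrite powRD ?un0 ?implybT// powR_inv1 ?(ltW u0)//.
      rewrite sqr_sqrtr ?(ltW u0)// /v -powR12_sqrt ?(ltW u0)// -powRrM.
      by congr (_ `^ _ * _); field.
    rewrite le_eqVlt; apply/orP; left; apply/eqP.
    by rewrite -/rN; field; rewrite !gt_eqF.
  rewrite -mulr_suml ler_wpM2r ?divr_ge0 ?addr_ge0 ?mulr_ge0 ?sqrtr_ge0 ?(ltW A0) ?(ltW rN0)//.
  have b20 : 0 < beta / 2 by rewrite divr_gt0.
  apply: le_trans (sum_powR_neg N b20 s20 D_gt0) _.
  rewrite -/Cs ler_wpM2l ?(ltW Cs0)// /h -powR_mulrn ?(ltW s0)// -powRrM.
  by rewrite le_eqVlt; apply/orP; left; apply/eqP; congr (_ `^ _); field.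
have step3 : corrected mm 1 (s ^+ 2 + D * N%:R) x g 0 i0 <= (1 + CH) / (Num.sqrt D * rN).
  have u0 : 0 < s ^+ 2 + D * N%:R by rewrite ltr_pwDl// mulr_ge0// ltW.
  set v := Num.sqrt (s ^+ 2 + D * N%:R).
  have v0 : 0 < v by rewrite sqrtr_gt0.
  have uv : s ^+ 2 + D * N%:R = v ^+ 2 by rewrite sqr_sqrtr// ltW.
  have sv : s <= v.
    rewrite -(@ler_pXn2r _ 2) ?nnegrE ?(ltW s0) ?(ltW v0)// -uv lerDl.
    by rewrite mulr_ge0// ltW.
  have v1 : 1 <= v by exact: le_trans sv.
  have hv0 : 0 < v `^ (- beta) by rewrite powR_gt0.
  have /andP[_ hv1] := powRN_le1 beta01 v1.
  have Nv : N%:R <= v ^+ 4 by apply: le_trans Ns _; rewrite lerXn2r ?nnegrE ?(ltW s0) ?(ltW v0).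
  have n0 : `|0 : int| <= N%:Z by rewrite normr0.
  have [_ /(_ v (le_trans ss1 sv) Nv)[g1 _]] := gg 0 i0 n0.
  have := le_trans (ler_norm _) (HH g 0 i0 x v _ v0 hv0 g1).
  rewrite heat1// uv => hh.
  have rDN : Num.sqrt D * rN <= v.
    by rewrite -sqrtrM ?(ltW D_gt0)//; apply: ler_wsqrtr; rewrite lerDr ltW.
  apply: (@le_trans _ _ ((1 + CH) * v^-1)); last first.
    rewrite ler_wpM2l ?addr_ge0 ?(ltW CH0)// lef_pV2 ?posrE ?mulr_gt0//.
  have gl1 := gauss_le1 (x - mm 0 i0 0) (ltW (exprn_gt0 2 v0)).
  have gl8 : gauss (8 * v ^+ 2) (x - mm 0 i0 0) <= 1.
    by apply: gauss_le1; rewrite mulr_ge0// sqr_ge0.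
  have vi : 0 < v^-1 by rewrite invr_gt0.
  have e1 : v^-1 * gauss (v ^+ 2) (x - mm 0 i0 0) <= v^-1 * 1 by rewrite ler_wpM2l// ltW.
  have e2 : CH * (v `^ (- beta) * v ^- 1 * gauss (8 * v ^+ 2) (x - mm 0 i0 0)) <= CH * (1 * v^-1 * 1).
    rewrite ler_wpM2l ?(ltW CH0)// expr1; apply: ler_pM => //.
    - by rewrite mulr_ge0 ?(ltW hv0) ?(ltW vi).
    - exact: ltW (gauss_gt0 _ _).
    - by rewrite ler_wpM2r// ltW.
  lra.
have final : s^-1 * E N (bump (s ^+ 2) x) <= A / rN.
  apply: le_trans step1 _; apply: le_trans (lerD step2 (lexx _)) _.
  apply: le_trans (lerD (lerD step3 (lexx _)) (lexx _)) _.
  have -> : (1 + CH) / (Num.sqrt D * rN) + CD * (Cs * h * ((5 * A + Num.sqrt (2 / D)) / rN)) +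
      CH * (h * s ^- 1 * (3 * A * (s / rN))) =
      ((1 + CH) / Num.sqrt D + CD * Cs * Num.sqrt (2 / D) * h + h * B2 * A) / rN.
    by rewrite /B2 expr1; field; rewrite !gt_eqF.
  rewrite ler_wpM2r ?invr_ge0 ?(ltW rN0)//.
  have h1 : h <= 1 by have /andP[] := powRN_le1 beta01 s1'.
  have e1 : CD * Cs * Num.sqrt (2 / D) * h <= CD * Cs * Num.sqrt (2 / D) * 1.
    by rewrite ler_wpM2l// !mulr_ge0 ?sqrtr_ge0 ?(ltW CD0) ?(ltW Cs0).
  have e2 : h * B2 * A <= A / 2.
    rewrite mulrC ler_wpM2l ?(ltW A0)//; apply: le_trans (ler_wpM2r (ltW B20) hB) _.
    by rewrite invfM mulfVK// gt_eqF.
  have e3 : B1 <= A / 2 by rewrite /A; have := sqr_ge0 s2; lra.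
  move: e3; rewrite /B1; lra.
have := ler_wpM2l (ltW s0) final.
by rewrite mulVKf ?gt_eqF// => /le_trans; apply; rewrite mulrCA.
Qed.

End Concentration.

(** * The rate of convergence *)

Section PhiPerturbation.
Context {R : realType}.
Implicit Types p q x y : R.

Lemma normal_pdf01 y : normal_pdf 0 1 y = normal_peak 1 * gauss 1 y :> R.
Proof.
by rewrite normal_pdfE ?oner_neq0// /normal_fun /gauss subr0 expr1n mulr1.
Qed.

(** The error may grow linearly in [q], since the density decays. With [c <= 1/2] an intermediate
    point [y] satisfies [|q| <= 2 |y| + 1], so [1 + |q|] is absorbed by the Gaussian at [y]. *)
Lemma Phi_perturb p q (c : R) : 0 <= c <= 2^-1 -> `|p - q| <= c * (1 + `|q|) ->
  `|Phi p - Phi q| <= normal_peak 1 * (4 * c).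
Proof.
move=> /andP[c0 c2] pq.
have pk0 : 0 <= normal_peak (1 : R) by exact: normal_peak_ge0.
have key y : `|y - q| <= `|p - q| -> `|normal_pdf 0 1 y * (p - q)| <= normal_peak 1 * (4 * c).
  move=> yq; rewrite normal_pdf01 -mulrA normrM ger0_norm// ler_wpM2l//.
  rewrite normrM (ger0_norm (ltW (gauss_gt0 _ _))).
  have qy : `|q| <= 2 * `|y| + 1.
    have : `|q| <= `|y| + `|y - q|.
      have -> : `|q| = `|y - (y - q)| by congr `|_|; ring.
      exact: ler_normB.
    have : c * (1 + `|q|) <= 2^-1 * (1 + `|q|) by rewrite ler_wpM2r// addr_ge0.
    lra.
  have g1 : gauss 1 y * (1 + y ^+ 2 / 2) <= 1.
    rewrite /gauss mulr1 mulNr expRN mulrC ler_pdivrMr ?expR_gt0// mul1r.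
    exact: expR_ge1Dx.
  have y2 : `|y| ^+ 2 = y ^+ 2 by rewrite real_normK ?num_real.
  have y3 := sqr_ge0 (`|y| - 1).
  have h1 : 1 + `|q| <= 4 * (1 + y ^+ 2 / 2).
    rewrite -y2; move: y3 qy; rewrite expr2; nra.
  apply: le_trans (ler_wpM2l (ltW (gauss_gt0 _ _)) pq) _.
  apply: le_trans (ler_wpM2l (ltW (gauss_gt0 _ _)) (ler_wpM2l c0 h1)) _.
  have -> : gauss 1 y * (c * (4 * (1 + y ^+ 2 / 2))) = 4 * c * (gauss 1 y * (1 + y ^+ 2 / 2)) by ring.
  by rewrite -[leRHS]mulr1 ler_wpM2l// mulr_ge0.
have MVTPhi (u v : R) : u <= v -> exists2 y, y \in `[u, v]%R & Phi v - Phi u = normal_pdf 0 1 y * (v - u).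
  move=> uv; apply: MVT_segment => //; first by move=> t _; exact: is_derive_Phi.
  by apply: derivable_within_continuous => t _; have [] := is_derive_Phi t.
have [pleq|qltp] := leP p q.
  have [y ypq e] := MVTPhi p q pleq.
  rewrite distrC e -normrN -mulrN opprB; apply: key.
  move: ypq; rewrite in_itv/= => /andP[y1 y2].
  by rewrite distrC (distrC p) !ger0_norm ?subr_ge0// lerD2l lerN2.
have [y ypq ->] := MVTPhi q p (ltW qltp).
apply: key; move: ypq; rewrite in_itv/= => /andP[y1 y2].
by rewrite !ger0_norm ?subr_ge0 ?(ltW qltp)// lerD2r.
Qed.

(** The event [b] agrees with the sign of [z] except for [|z| <= t * s]. Where they agree the tail
    bounds apply; elsewhere the right side is at least 1, by the factor [expR (t ^+ 2 / 2)]. *)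
Lemma Phi_indicator (b : bool) (z s t : R) : 0 < s -> 0 <= t ->
  (b -> - (t * s) <= z) -> (~~ b -> z <= t * s) ->
  `|b%:R - Phi (z / s)| <= expR (t ^+ 2 / 2) * gauss (s ^+ 2) z.
Proof.
move=> s0 t0 bz nbz.
have e1 : 1 <= expR (t ^+ 2 / 2) by rewrite -expR0 ler_expR divr_ge0 ?sqr_ge0.
have g0 := gauss_gt0 (s ^+ 2) z.
have gE : expR (- (z / s) ^+ 2 / 2) = gauss (s ^+ 2) z.
  by rewrite /gauss; congr expR; field; rewrite gt_eqF.
have P0 := Phi_ge0 (z / s); have P1 := Phi_le1 (z / s).
have one : `|z| <= t * s -> 1 <= expR (t ^+ 2 / 2) * gauss (s ^+ 2) z.
  move=> zt; rewrite /gauss -expRD -[leLHS]expR0 ler_expR.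
  have -> : t ^+ 2 / 2 + - z ^+ 2 / (2 * s ^+ 2) = ((t * s) ^+ 2 - z ^+ 2) / (2 * s ^+ 2).
    by field; rewrite gt_eqF.
  apply: divr_ge0; last by rewrite mulr_ge0 ?sqr_ge0.
  rewrite subr_ge0.
  by rewrite -real_normK ?num_real// lerXn2r ?nnegrE// mulr_ge0// ltW.
have [z0|z0] := leP 0 z.
  case: b bz nbz => [_ _|_ /(_ isT) zt].
    rewrite ger0_norm ?subr_ge0//; apply: (@le_trans _ _ (gauss (s ^+ 2) z)).
      by rewrite -gE; apply: Phi_right_tail; rewrite divr_ge0// ltW.
    by rewrite ler_peMl// ltW.
  rewrite sub0r normrN ger0_norm//; apply: le_trans P1 _; apply: one.
  by rewrite ger0_norm.
case: b bz nbz => [/(_ isT) zt _|_ _].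
  rewrite ger0_norm ?subr_ge0//; apply: (@le_trans _ _ 1); first by rewrite lerBlDr lerDl.
  by apply: one; rewrite ltr0_norm//; lra.
rewrite sub0r normrN ger0_norm//; apply: (@le_trans _ _ (gauss (s ^+ 2) z)).
  by rewrite -gE; apply: Phi_left_tail; rewrite pmulr_lle0 ?invr_gt0// ltW.
by rewrite ler_peMl// ltW.
Qed.

(** A substitute for the floor of [y] inside the box, where averaging of [mm] is available. The
    order relations are asked only for [n] in the box, which contains the support of the walk. *)
Lemma clamp_floor (N : nat) (y : R) : exists c : int, [/\ `|c| <= N%:Z, `|c%:~R| <= `|y| + 1 &
  forall n : int, `|n| <= N%:Z ->
    (n%:~R <= y -> n <= c /\ c%:~R <= y) /\ (y < n%:~R -> c <= n /\ y <= c%:~R + 1)].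
Proof.
have bnd (n : int) : `|n| <= N%:Z -> - (N%:R : R) <= n%:~R <= (N%:R : R).
  by rewrite ler_norml -[N%:R]/(N%:Z%:~R) -rmorphN !ler_int.
have [yN|Ny] := ltP y (- N%:R).
  exists (- N%:Z); split.
  - by rewrite normrN.
  - rewrite rmorphN normrN /= ger0_norm//; have := ler_norm (- y); rewrite normrN.
    by rewrite -[N%:Z%:~R]/(N%:R); lra.
  move=> n nN; have /andP[n1 n2] := bnd n nN; split=> h.
    by move: (le_lt_trans (le_trans n1 h) yN); rewrite ltxx.
  split; first by move: nN; rewrite ler_norml => /andP[].
  by rewrite rmorphN /= -[N%:Z%:~R]/(N%:R); lra.
have [yN|yN] := leP N%:R y.
  exists N%:Z; split => //.
    by rewrite -[N%:Z%:~R]/(N%:R) ger0_norm//; have := ler_norm y; lra.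
  move=> n nN; have /andP[n1 n2] := bnd n nN; split=> h.
    by split => //; move: nN; rewrite ler_norml => /andP[].
  by move: (lt_le_trans h (le_trans n2 yN)); rewrite ltxx.
have /andP[f1 f2] := floor_itv y.
exists (Num.floor y); split.
- rewrite ler_norml; apply/andP; split.
    by rewrite -ltzD1 -(ltr_int R) rmorphN /=; apply: le_lt_trans f2.
  by rewrite -(ler_int R) ltW//; exact: le_lt_trans f1 yN.
- have := ler_norm y; have := ler_norm (- y); rewrite normrN => y1 y2.
  by move: f2; rewrite intrD ler_norml => f2; apply/andP; split; lra.
move=> n nN; split=> h; split => //.
- by rewrite -ltzD1 -(ltr_int R); exact: le_lt_trans f2.
- by rewrite -(ler_int R); apply: le_trans f1 (ltW h).
- by move: f2; rewrite intrD => /ltW.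
Qed.

End PhiPerturbation.

(** Here [w] is the standard deviation [sqrt (D N)], [v] the one enlarged by smoothing, and [h] the
    deviation of [mm] from the identity. The change of variance costs
    [(v - w) / v <= rN / w^2 = 1 / (D * rN)]. *)
Lemma center_le (R : realFieldType) (D rD rN w v m0 C r x h : R) : 0 < D -> 0 < rD -> rD ^+ 2 = D ->
  1 <= rN -> w = rD * rN -> w <= v -> v ^+ 2 - w ^+ 2 = rN -> rN^-1 <= r -> 0 <= m0 -> 0 <= C ->
  `|h| <= m0 + C * (r * (rN + (`|x| * w + 1))) ->
  `|(x * w + h) / v - x| <= ((m0 + 2 * C) / rD + C + D^-1) * r * (1 + `|x|).
Proof.
move=> D0 rD0 rDD rN1 wE wv vw rNr m00 C0 hh.
have rN0 : 0 < rN by exact: lt_le_trans rN1.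
have w0 : 0 < w by rewrite wE mulr_gt0.
have v0 : 0 < v by exact: lt_le_trans wv.
have r0 : 0 <= r by apply: le_trans rNr; rewrite invr_ge0 ltW.
have -> : (x * w + h) / v - x = h / v - x * ((v - w) / v) by field; rewrite gt_eqF.
have h1 : `|h / v| <= ((m0 + 2 * C) / rD + C * `|x|) * r.
  rewrite normrM (ger0_norm (_ : 0 <= v^-1)) ?invr_ge0 ?(ltW v0)//.
  apply: (@le_trans _ _ ((m0 + C * (r * (rN + (`|x| * w + 1)))) / w)).
    apply: ler_pM => //; first by rewrite invr_ge0 ltW.
    by rewrite lef_pV2 ?posrE.
  have -> : (m0 + C * (r * (rN + (`|x| * w + 1)))) / w =
      m0 / rD * rN^-1 + C / rD * r + C / rD * r * rN^-1 + C * `|x| * r.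
    by rewrite wE; field; rewrite !gt_eqF.
  have p1 : m0 / rD * rN^-1 <= m0 / rD * r by rewrite ler_wpM2l// divr_ge0// ltW.
  have p2 : C / rD * r * rN^-1 <= C / rD * r.
    by rewrite ler_piMr ?mulr_ge0 ?invr_ge0 ?(ltW rD0)// invf_le1.
  have -> : ((m0 + 2 * C) / rD + C * `|x|) * r =
      m0 / rD * r + C / rD * r + C / rD * r + C * `|x| * r by field; rewrite gt_eqF.
  lra.
have h2 : `|x * ((v - w) / v)| <= `|x| * (D^-1 * r).
  rewrite normrM ler_wpM2l// ger0_norm ?divr_ge0 ?subr_ge0 ?(ltW v0)//.
  apply: (@le_trans _ _ (rN / w ^+ 2)).
    rewrite ler_pdivrMr// mulrAC ler_pdivlMr ?exprn_gt0//.
    rewrite -vw; have : 0 <= (v - w) * (v - w) * w by rewrite mulr_ge0 ?(ltW w0)// -expr2 sqr_ge0.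
    have : 0 <= (v - w) * v * v by rewrite !mulr_ge0 ?(ltW v0)// subr_ge0.
    nra.
  have -> : rN / w ^+ 2 = D^-1 * rN^-1 by rewrite wE exprMn rDD; field; rewrite !gt_eqF.
  by rewrite ler_wpM2l// invr_ge0 ltW.
apply: le_trans (ler_normB _ _) _; apply: le_trans (lerD h1 h2) _.
have q1 : 0 <= (m0 + 2 * C) / rD * r * `|x|.
  by rewrite !mulr_ge0 ?addr_ge0 ?mulr_ge0 ?invr_ge0 ?(ltW rD0).
have q2 : 0 <= C * r by rewrite mulr_ge0.
have q3 : 0 <= D^-1 * r by rewrite mulr_ge0// invr_ge0 ltW.
have -> : ((m0 + 2 * C) / rD + C + D^-1) * r * (1 + `|x|) =
  ((m0 + 2 * C) / rD + C * `|x|) * r + `|x| * (D^-1 * r) + (m0 + 2 * C) / rD * r * `|x| + C * r + D^-1 * r by ring.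
lra.
Qed.

Lemma ler_dist01 (R : realDomainType) (x y : R) : 0 <= x <= 1 -> 0 <= y <= 1 -> `|x - y| <= 1.
Proof. by move=> /andP[? ?] /andP[? ?]; rewrite ler_norml; apply/andP; split; lra. Qed.

(** * Assembly of the rate *)

Section Rate.
Variables (R : realType) (k : nat).
Variables (P Q Rm : int -> 'M[R]_k.+1) (mm : int -> 'cV[R]_k.+1) (i0 : 'I_k.+1).
Variables (K D Cg C' beta s1 : R).
Hypothesis beta01 : 0 < beta <= 4^-1.
Hypothesis env_ge0 : forall n, nonneg_mx (P n) /\ nonneg_mx (Q n) /\ nonneg_mx (Rm n).
Hypothesis env_sum : forall n, (P n + Q n + Rm n) *m (const_mx 1 : 'cV[R]_k.+1) = const_mx 1.
Hypothesis mm_harm : forall n, mm n = P n *m mm (n + 1) + Rm n *m mm n + Q n *m mm (n - 1).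
Hypothesis mm_step : forall (n1 n2 : int) (i1 i2 : 'I_k.+1),
     `|n1 - n2| <= 1 -> `|mm n1 i1 0 - mm n2 i2 0| <= K.
Hypothesis D_gt0 : 0 < D.
Hypothesis Cg_gt0 : 0 < Cg.
Hypothesis s1_ge1 : 1 <= s1.
Hypothesis s1D : 2 * D <= s1 ^+ 2.
Hypothesis correctors : forall (N : nat) (x : R), (0 < N)%N ->
  exists g, good_corrector P Q Rm mm D Cg beta s1 N x g.
Hypothesis C'_gt0 : 0 < C'.
Hypothesis mm_lin : forall (N : nat) (s : R), (0 < N)%N ->
  1 <= s -> N%:R <= s ^+ 4 -> forall n c : int,
  `|n| <= (2 * N + 5)%N%:Z -> `|c| <= (2 * N + 5)%N%:Z ->
  `|(mm n ord0 0 - n%:~R) - (mm c ord0 0 - c%:~R)| <= C' * (s `^ (- beta) * (s + `|n - c|%:~R)).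
Local Notation E := (Ex P Q Rm i0).
Local Notation rate N := ((N%:R : R) `^ (- (beta / 2))).

Let root4 (N : nat) : (0 < N)%N -> exists s0 : R, [/\ 1 <= s0, s0 ^+ 2 = Num.sqrt N%:R & s0 ^+ 4 = N%:R].
Proof.
move=> N0; exists (Num.sqrt (Num.sqrt N%:R)).
have N1 : 1 <= N%:R :> R by rewrite ler1n.
have r1 : 1 <= Num.sqrt N%:R :> R by rewrite -[leLHS]sqrtr1; exact: ler_wsqrtr.
have e2 : Num.sqrt (Num.sqrt N%:R) ^+ 2 = Num.sqrt N%:R :> R by rewrite sqr_sqrtr ?sqrtr_ge0.
split => //; first by rewrite -[leLHS]sqrtr1; exact: ler_wsqrtr.
by rewrite (exprM _ 2 2) e2 sqr_sqrtr// ler0n.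
Qed.

Let inv_le_rate (N : nat) (s0 : R) : (0 < N)%N -> 1 <= s0 -> s0 ^+ 4 = N%:R -> s0^-1 <= rate N.
Proof.
move=> N0 s01 s04; have s0p : 0 < s0 by exact: lt_le_trans s01.
rewrite -s04 -powR_mulrn ?(ltW s0p)// -powRrM -powR_inv1 ?(ltW s0p)//.
by rewrite ler_powR//; have := beta01; lra.
Qed.

(** The case [j = 0]. Weighted by the local estimate, the drift at variance [u] is of order
    [u^(q - 1) / sqrt N] with [q = (1 - beta) / 2], and the sum over time is
    [N^(q - 1/2) = N^(-beta/2)]. *)
Let heat_estimate : exists2 B : R, 0 < B & forall (N : nat) (s0 x : R), (0 < N)%N ->
  s1 <= s0 -> s0 ^+ 4 = N%:R ->
  `|E N (fun n i => heat 0 (s0 ^+ 2) (x - mm n i 0)) - heat 0 (s0 ^+ 2 + D * N%:R) (x - mm 0 i0 0)|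
   <= B * rate N.
Proof.
have [CD CD0 HD] := duhamel i0 beta01 env_ge0 env_sum mm_harm mm_step D_gt0 Cg_gt0 s1_ge1 s1D 0.
have [CH CH0 HH] := corrected_heat mm Cg_gt0 0.
have [A A0 HA] := concentration i0 beta01 env_ge0 env_sum mm_harm mm_step D_gt0 Cg_gt0 s1_ge1 s1D correctors.
have /andP[b0 b4] := beta01.
pose q := (1 - beta) / 2.
have q01 : 0 < q <= 1 by rewrite /q; apply/andP; split; lra.
have /andP[q0 q1] := q01.
pose Cq := 2 * (D * q)^-1 * (1 + D).
have Cq0 : 0 < Cq.
  by rewrite /Cq mulr_gt0 ?addr_gt0// divr_gt0// mulr_gt0.
pose A' := 5 * A + Num.sqrt (2 / D).
have A'0 : 0 < A' by rewrite ltr_pwDl ?mulr_gt0// sqrtr_ge0.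
exists (3 * CH * A + CH * D `^ (- (beta / 2)) + CD * Cq * A').
  apply: addr_gt0; first by rewrite addr_gt0 ?mulr_gt0 ?powR_gt0.
  by apply: mulr_gt0 => //; exact: mulr_gt0.
move=> N s0 x N0 s10 s04.
have s01 : 1 <= s0 by exact: le_trans s10.
have s0p : 0 < s0 by exact: lt_le_trans s01.
have Ns : N%:R <= s0 ^+ 4 by rewrite s04.
have NR : 0 < N%:R :> R by rewrite ltr0n.
have N1 : 1 <= N%:R :> R by rewrite ler1n.
pose rN := Num.sqrt (N%:R : R).
have rN0 : 0 < rN by rewrite sqrtr_gt0.
have rNE : rN = s0 ^+ 2.
  by rewrite /rN -s04 (exprM _ 2 2) sqrtr_sqr ger0_norm// exprn_ge0 ?(ltW s0p).
have s020 : 0 < s0 ^+ 2 by rewrite exprn_gt0.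
have [g gg] := correctors x N0.
have inv_rate := inv_le_rate N0 s01 s04.
have rate0 : 0 < rate N by rewrite powR_gt0.
have u0 : 0 < s0 ^+ 2 + D * N%:R by rewrite ltr_pwDl// mulr_ge0// ltW.
set v := Num.sqrt (s0 ^+ 2 + D * N%:R).
have v0 : 0 < v by rewrite sqrtr_gt0.
have uv : s0 ^+ 2 + D * N%:R = v ^+ 2 by rewrite sqr_sqrtr// ltW.
have sv : s0 <= v.
  rewrite -(@ler_pXn2r _ 2) ?nnegrE ?(ltW s0p) ?(ltW v0)// -uv lerDl.
  by rewrite mulr_ge0// ltW.
set T1 := E N (fun n i => heat 0 (s0 ^+ 2) (x - mm n i 0)).
set T2 := heat 0 (s0 ^+ 2 + D * N%:R) (x - mm 0 i0 0).
set P1 := E N (corrected mm 0 (s0 ^+ 2) x g).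
set P2 := corrected mm 0 (s0 ^+ 2 + D * N%:R) x g 0 i0.
have e1 : `|T1 - P1| <= 3 * CH * A * rate N.
  rewrite /T1 /P1 -ExB; apply: (@le_trans _ _ (E N (fun n i => CH * gauss ((3 * s0) ^+ 2) (x - mm n i 0)))).
    apply: Ex_norm => // n i nN; have [_ /(_ s0 s10 Ns)[g1 _]] := gg n i nN.
    rewrite distrC; apply: le_trans (HH g n i x s0 _ s0p (powR_gt0 _ s0p) g1) _.
    rewrite ler_wpM2l ?(ltW CH0)// expr0 invr1 mulr1.
    have /andP[h0 h1] := powRN_le1 beta01 s01.
    apply: (@le_trans _ _ (1 * gauss (8 * s0 ^+ 2) (x - mm n i 0))).
      by rewrite ler_wpM2r// ltW// gauss_gt0.
    by rewrite mul1r; apply: ler_gauss; [rewrite mulr_gt0|rewrite exprMn ler_pM2r//; lra].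
  rewrite ExZ [3 * CH]mulrC -!mulrA ler_wpM2l ?(ltW CH0)//.
  apply: le_trans (HA N N0 (3 * s0) x _ _) _.
  - by lra.
  - by apply: le_trans Ns _; rewrite lerXn2r ?nnegrE ?(ltW s0p) ?mulr_ge0 ?(ltW s0p)//; lra.
  rewrite -/rN rNE [leLHS](_ : _ = 3 * (A * s0^-1)); last by field; rewrite gt_eqF.
  by rewrite ler_wpM2l// ler_wpM2l// ltW.
have e2 : `|P2 - T2| <= CH * D `^ (- (beta / 2)) * rate N.
  have n0 : `|0 : int| <= N%:Z by rewrite normr0.
  have Nv : N%:R <= v ^+ 4 by apply: le_trans Ns _; rewrite lerXn2r ?nnegrE ?(ltW s0p) ?(ltW v0).
  have [_ /(_ v (le_trans s10 sv) Nv)[g1 _]] := gg 0 i0 n0.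
  rewrite /P2 /T2 uv; apply: le_trans (HH g 0 i0 x v _ v0 (powR_gt0 _ v0) g1) _.
  rewrite -[leRHS]mulrA ler_wpM2l ?(ltW CH0)// expr0 invr1 mulr1.
  have DN : v `^ (- beta) <= D `^ (- (beta / 2)) * rate N.
    rewrite -powRM ?(ltW D_gt0) ?(ltW NR)//.
    have rDN : 0 < Num.sqrt (D * N%:R) by rewrite sqrtr_gt0 mulr_gt0.
    apply: (@le_trans _ _ (Num.sqrt (D * N%:R) `^ (- beta))).
      by apply: ler_powRN => //; apply: ler_wsqrtr; rewrite lerDr ltW.
    rewrite -powR12_sqrt ?mulr_ge0 ?(ltW D_gt0)// -powRrM.
    by rewrite le_eqVlt; apply/orP; left; apply/eqP; congr (_ `^ _); field.
  apply: le_trans DN; rewrite -[leRHS]mulr1 ler_wpM2l ?powR_ge0//.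
  by apply: gauss_le1; rewrite mulr_ge0// sqr_ge0.
have e3 : `|P1 - P2| <= CD * Cq * A' * rate N.
  apply: le_trans (HD N x g s0 gg s10 Ns) _.
  rewrite -!mulrA ler_wpM2l ?(ltW CD0)//.
  have IH t : (0 < t < N)%N -> concentrated P Q Rm mm i0 A t by move=> /andP[t0 _]; exact: HA.
  apply: (@le_trans _ _ (\sum_(i < N) (s0 ^+ 2 + D * i.+1%:R) `^ (q - 1) * (A' / rN))).
    apply: ler_sum => i _.
    have ui0 : 0 < s0 ^+ 2 + D * i.+1%:R by rewrite ltr_pwDl// mulr_ge0// ltW.
    apply: le_trans (ler_wpM2l _ (Ex_gauss_before env_ge0 env_sum D_gt0 x A0 IH s01 Ns (ltn_ord i))) _.
      by rewrite mulr_ge0 ?powR_ge0// invr_ge0 exprn_ge0// sqrtr_ge0.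
    set u := s0 ^+ 2 + D * i.+1%:R in ui0 *; set w := Num.sqrt u.
    have w0 : 0 < w by rewrite sqrtr_gt0.
    have -> : u `^ (q - 1) = w `^ (- beta) * w^-1.
      rewrite -(powR_inv1 (ltW w0)) -powRD ?(gt_eqF w0) ?implybT//.
      rewrite /w -powR12_sqrt ?(ltW ui0)// -powRrM.
      by congr (_ `^ _); rewrite /q; field.
    rewrite le_eqVlt; apply/orP; left; apply/eqP.
    by rewrite -/rN -/A'; field; rewrite !gt_eqF.
  rewrite -mulr_suml.
  apply: le_trans (ler_wpM2r _ (sum_powR_pos N q01 s020 D_gt0)) _.
    by rewrite divr_ge0 ?(ltW A'0) ?(ltW rN0).
  have big : (s0 ^+ 2 + D * N%:R) `^ q <= (1 + D) * N%:R `^ q.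
    have s2N : s0 ^+ 2 <= N%:R by rewrite -s04 ler_weXn2l.
    apply: (@le_trans _ _ (((1 + D) * N%:R) `^ q)).
      rewrite ge0_ler_powR ?nnegrE ?(ltW q0) ?(ltW u0) ?mulr_ge0 ?addr_ge0 ?(ltW D_gt0)//.
      by rewrite mulrDl mul1r lerD2r.
    rewrite powRM ?addr_ge0 ?(ltW D_gt0) ?(ltW NR)// ler_wpM2r ?powR_ge0//.
    by apply: ler1_powR => //; rewrite lerDl ltW.
  have rE : N%:R `^ q = rate N * rN.
    rewrite /rN -powR12_sqrt ?(ltW NR)// -powRD ?(gt_eqF NR) ?implybT//.
    by congr (_ `^ _); rewrite /q; field.
  apply: (@le_trans _ _ (2 * (D * q)^-1 * ((1 + D) * N%:R `^ q) * (A' / rN))).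
    rewrite ler_wpM2r ?divr_ge0 ?(ltW A'0) ?(ltW rN0)// ler_wpM2l//.
    by rewrite mulr_ge0// invr_ge0 mulr_ge0 ?(ltW D_gt0) ?(ltW q0).
  rewrite rE le_eqVlt; apply/orP; left; apply/eqP.
  by rewrite /Cq; field; rewrite !gt_eqF.
have -> : T1 - T2 = (T1 - P1) + (P1 - P2) + (P2 - T2) by ring.
set r := rate N in e1 e2 e3 *.
apply: (@le_trans _ _ (`|T1 - P1| + `|P1 - P2| + `|P2 - T2|)).
  by apply: le_trans (ler_normD _ _) _; rewrite lerD2r ler_normD.
by rewrite !mulrDl; lra.
Qed.

Let probXE (N : nat) (x : R) : (0 < N)%N ->
  probX P Q Rm i0 N D x =
  E N (fun n _ => (n%:~R <= x * Num.sqrt (D * N%:R) :> R)%R%:R).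
Proof.
move=> N0; have w0 : 0 < Num.sqrt (D * N%:R) by rewrite sqrtr_gt0 mulr_gt0// ltr0n.
rewrite -(box_sum_dist P Q Rm i0 _ (leqnn N)) /probX /box_sum big_mkcond /=.
apply: eq_bigr => l _; rewrite ler_pdivrMr//; case: ifP => _.
  by apply: eq_bigr => j _; rewrite mulr1.
by rewrite big1// => j _; rewrite mulr0.
Qed.

(** Smoothing the indicator on scale [s0 = N^(1/4)] costs [s0 / sqrt N = N^(-1/4)] by the local
    estimate. Then come the heat estimate and the comparison of the initial value with [Phi x]. *)
Lemma berry_esseen : exists B : R, forall (N : nat) (x : R), (0 < N)%N ->
  `|probX P Q Rm i0 N D x - Phi x| <= B * rate N.
Proof.
have [B1 B10 HB1] := heat_estimate.
have [A A0 HA] := concentration i0 beta01 env_ge0 env_sum mm_harm mm_step D_gt0 Cg_gt0 s1_ge1 s1D correctors.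
have /andP[b0 b4] := beta01.
have c0 : 0 < (2 * C')^-1 by rewrite invr_gt0 mulr_gt0.
have [sb sb1 Hb] := exists_powRN_le b0 c0.
have K0 : 0 <= K by apply: le_trans (mm_step (n1 := 0) (n2 := 0) ord0 ord0 _); rewrite ?subrr ?normr0.
pose s2 := s1 + sb.
pose t := C' + K + 1.
have t0 : 0 <= t by rewrite !addr_ge0 ?(ltW C'_gt0).
(* The preceding [t] measures, in units of [s0], how far the order of [X_N] and [y] can differ from
   that of the martingale and its level: [C'] from the nonlinearity of [mm], [K] from the position
   within a layer, 1 from rounding. *)
pose m0 := `|mm 0 ord0 0| + `|mm 0 i0 0|.
have m00 : 0 <= m0 by rewrite addr_ge0.
pose rD := Num.sqrt D.
have rD0 : 0 < rD by rewrite sqrtr_gt0.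
pose B3 := (m0 + 2 * C') / rD + C' + D^-1.
have B30 : 0 <= B3 by rewrite !addr_ge0 ?divr_ge0 ?addr_ge0 ?mulr_ge0 ?invr_ge0 ?(ltW rD0) ?(ltW D_gt0) ?(ltW C'_gt0).
pose pk := normal_peak (1 : R).
have pk0 : 0 < pk by rewrite normal_peak_gt0// oner_neq0.
pose e := expR (t ^+ 2 / 2).
have e0 : 0 < e by exact: expR_gt0.
(* The summands stand for small [N] (that is [s0 < s2]), smoothing, the heat estimate and
   recentering; in the last one the 2 covers the case [B3 * rate N > 1/2], where the difference is
   bounded by 1. *)
exists (s2 ^+ 4 + e * A + pk * B1 + (pk * 4 + 2) * B3) => N x N0.
have NR : 0 < N%:R :> R by rewrite ltr0n.
have N1 : 1 <= N%:R :> R by rewrite ler1n.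
have rate0 : 0 < rate N by rewrite powR_gt0.
have [s0 [s01 s02 s04]] := root4 N0.
have s0p : 0 < s0 by exact: lt_le_trans s01.
have inv_rate := inv_le_rate N0 s01 s04.
have s21 : 1 <= s2 by rewrite /s2; have := s1_ge1; lra.
have s2p : 0 <= s2 by exact: le_trans s21.
have Phi0 := Phi_ge0 x; have Phi1 := Phi_le1 x.
have rest0 : 0 <= e * A + pk * B1 + (pk * 4 + 2) * B3.
  apply: addr_ge0; first by rewrite addr_ge0// mulr_ge0// ltW.
  by apply: mulr_ge0 => //; rewrite addr_ge0// mulr_ge0// ltW.
rewrite probXE//; set y := x * _; set p := E N _.
have p0 : 0 <= p by rewrite -(Ex_cst env_sum i0 N 0); apply: Ex_le => // n i _; rewrite ler0n.
have p1 : p <= 1.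
  by rewrite -[leRHS](Ex_cst env_sum i0 N 1); apply: Ex_le => // n i _; case: (_ <= y).
have [s0s2|s2s0] := ltP s0 s2.
  apply: (@le_trans _ _ 1); first by apply: ler_dist01; apply/andP.
  have h1 : 1 <= s2 ^+ 4 * rate N.
    apply: (@le_trans _ _ (s0 * s0^-1)); first by rewrite divff ?gt_eqF.
    apply: ler_pM => //; rewrite ?invr_ge0 ?(ltW s0p)//.
    apply: le_trans (ltW s0s2) _; rewrite -[leLHS]expr1; exact: ler_weXn2l.
  by apply: le_trans h1 _; apply: ler_wpM2r; [exact: ltW|lra].
have s10 : s1 <= s0 by apply: le_trans s2s0; rewrite /s2; lra.
have sb0 : sb <= s0 by apply: le_trans s2s0; rewrite /s2; have := s1_ge1; lra.
set w := Num.sqrt (D * N%:R) in y p p0 p1 *.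
have w0 : 0 < w by rewrite sqrtr_gt0 mulr_gt0.
have [c [cN cy cn]] := clamp_floor N y.
(* the level of mm which corresponds to the level y of the first coordinate *)
pose xh := mm c ord0 0 + (y - c%:~R).
have Ns : N%:R <= s0 ^+ 4 by rewrite s04.
have win (n : int) : `|n| <= N%:Z -> `|n| <= (2 * N + 5)%N%:Z.
  by move=> nN; apply: le_trans nN _; rewrite lez_nat mul2n -addnn -addnA leq_addr.
have smooth : `|p - E N (fun n i => Phi ((xh - mm n i 0) / s0))| <= e * A * rate N.
  rewrite /p -ExB; apply: (@le_trans _ _ (E N (fun n i => e * gauss (s0 ^+ 2) (xh - mm n i 0)))).
    apply: Ex_norm => // n i nN; have [n1 n2] := cn n nN.
    have := mm_lin N0 s01 Ns (win c cN) (win n nN).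
    have hb : C' * s0 `^ (- beta) <= 2^-1.
      apply: le_trans (ler_wpM2l (ltW C'_gt0) (Hb s0 sb0)) _.
      by rewrite invfM mulrCA divff ?mulr1// gt_eqF.
    have /andP[h0 h1] := powRN_le1 beta01 s01.
    have lin0 : 0 <= `|c - n|%:~R :> R by rewrite ler0z.
    have b1 : C' * (s0 `^ (- beta) * (s0 + `|c - n|%:~R)) <= C' * s0 + 2^-1 * `|c - n|%:~R.
      rewrite mulrDr mulrDr; apply: lerD.
        by rewrite ler_wpM2l ?(ltW C'_gt0)// -[leRHS]mul1r ler_wpM2r ?(ltW s0p).
      by rewrite mulrA ler_wpM2r.
    move=> /le_trans /(_ b1); rewrite ler_norml => /andP[l1 l2].
    have := mm_step ord0 i (_ : `|n - n| <= 1); rewrite subrr normr0 => /(_ isT).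
    rewrite ler_norml => /andP[k1 k2].
    have ts : t * s0 = C' * s0 + K * s0 + s0 by rewrite /t; ring.
    have Ks : K <= K * s0 by rewrite ler_peMr.
    apply: Phi_indicator => //.
      move=> /n1[nc cy']; rewrite ts.
      have e1 : `|c - n|%:~R = c%:~R - n%:~R :> R by rewrite ger0_norm ?subr_ge0// intrB.
      have nc' : n%:~R <= c%:~R :> R by rewrite ler_int.
      rewrite e1 in l1; rewrite /xh; lra.
    rewrite -ltNge => /n2[nc cy']; rewrite ts.
    have e1 : `|c - n|%:~R = n%:~R - c%:~R :> R.
      by rewrite distrC ger0_norm ?subr_ge0// intrB.
    have nc' : c%:~R <= n%:~R :> R by rewrite ler_int.
    rewrite e1 in l2; rewrite /xh; lra.
  rewrite ExZ -mulrA ler_wpM2l ?(ltW e0)//.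
  apply: le_trans (HA N N0 s0 xh s01 Ns) _; rewrite ler_wpM2l ?(ltW A0)//.
  rewrite -s02 expr2 invfM mulrA divff ?mul1r// gt_eqF//.
have heatP : `|E N (fun n i => Phi ((xh - mm n i 0) / s0)) -
    Phi ((xh - mm 0 i0 0) / Num.sqrt (s0 ^+ 2 + D * N%:R))| <= pk * B1 * rate N.
  have := HB1 N s0 xh N0 s10 s04.
  have u0 : 0 < s0 ^+ 2 + D * N%:R by rewrite ltr_pwDl ?exprn_gt0// mulr_ge0// ltW.
  have uv : s0 ^+ 2 + D * N%:R = Num.sqrt (s0 ^+ 2 + D * N%:R) ^+ 2 by rewrite sqr_sqrtr// ltW.
  rewrite [in X in X -> _]uv heat0 ?sqrtr_gt0//.
  have -> : (fun n i => heat 0 (s0 ^+ 2) (xh - mm n i 0)) = (fun n i => pk^-1 * Phi ((xh - mm n i 0) / s0)).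
    by apply/funext => n; apply/funext => i; rewrite heat0// mulrC.
  rewrite ExZ [X in _ - X]mulrC -mulrBr normrM ger0_norm ?invr_ge0 ?(ltW pk0)//.
  by rewrite mulrC ler_pdivrMr// => /le_trans; apply; rewrite mulrC mulrA.
have compare : `|Phi ((xh - mm 0 i0 0) / Num.sqrt (s0 ^+ 2 + D * N%:R)) - Phi x| <= (pk * 4 + 2) * B3 * rate N.
  set v := Num.sqrt (s0 ^+ 2 + D * N%:R); set pp := _ / v.
  have [small|large] := leP (B3 * rate N) 2^-1; last first.
    have P0 := Phi_ge0 pp; have P1 := Phi_le1 pp.
    apply: (@le_trans _ _ 1); first by apply: ler_dist01; apply/andP.
    rewrite -[leRHS]mulrA; apply: (@le_trans _ _ (2 * (B3 * rate N))).
      by rewrite -ler_pdivrMl ?mulr1 ?ltW.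
    by apply: ler_wpM2r; [apply: mulr_ge0 => //; exact: ltW|rewrite lerDr mulr_ge0// ltW].
  apply: (@le_trans _ _ (pk * (4 * (B3 * rate N)))); last first.
    rewrite [leRHS](_ : _ = pk * (4 * (B3 * rate N)) + 2 * (B3 * rate N)); last by ring.
    by rewrite lerDl; apply: mulr_ge0 => //; apply: mulr_ge0 => //; exact: ltW.
  apply: Phi_perturb; first by rewrite small andbT mulr_ge0// ltW.
  have v0 : 0 < v by rewrite sqrtr_gt0 ltr_pwDl ?exprn_gt0// mulr_ge0// ltW.
  have wv : w <= v by apply: ler_wsqrtr; rewrite lerDr ltW// exprn_gt0.
  have wE : w = rD * Num.sqrt N%:R by rewrite /w sqrtrM ?(ltW D_gt0).
  pose rN := Num.sqrt (N%:R : R); rewrite -/rN in wE.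
  have rN1 : 1 <= rN by rewrite -[leLHS]sqrtr1; exact: ler_wsqrtr.
  have rN0 : 0 < rN by exact: lt_le_trans rN1.
  have rN4 : N%:R <= rN ^+ 4.
    by rewrite (exprM _ 2 2) sqr_sqrtr ?ler0n// expr2 ler_peMl.
  have n0 : `|0 : int| <= N%:Z by rewrite normr0.
  have := mm_lin N0 rN1 rN4 (win c cN) (win 0 n0).
  have -> : rN `^ (- beta) = rate N.
    by rewrite /rN -powR12_sqrt ?ler0n// -powRrM; congr (_ `^ _); field.
  rewrite !subr0 => lin.
  have ppE : pp = (x * w + ((mm c ord0 0 - c%:~R - mm 0 ord0 0) + (mm 0 ord0 0 - mm 0 i0 0))) / v.
    by rewrite /pp /xh /y; congr (_ / _); ring.
  rewrite ppE; apply: (@center_le R D rD rN w v m0 C' (rate N)) => //.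
  - by rewrite /rD sqr_sqrtr// ltW.
  - have DN0 : 0 <= D * N%:R by rewrite mulr_ge0// ltW.
    by rewrite !sqr_sqrtr// ?s02 ?addrK// addr_ge0// sqrtr_ge0.
  - apply: le_trans inv_rate; rewrite /rN -s02 lef_pV2 ?posrE ?exprn_gt0//.
    by rewrite -[leLHS]expr1; exact: ler_weXn2l.
  - exact: ltW.
  - rewrite [leRHS]addrC; apply: le_trans (ler_normD _ _) _; apply: lerD; last exact: ler_normB.
    apply: le_trans lin _; rewrite ler_wpM2l ?(ltW C'_gt0)// ler_wpM2l ?(ltW rate0)// lerD2l.
    by apply: le_trans (_ : `|c%:~R| <= _); rewrite ?intr_norm//; apply: le_trans cy _; rewrite /y normrM (ger0_norm (ltW w0)).
have -> : p - Phi x = (p - E N (fun n i => Phi ((xh - mm n i 0) / s0))) +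
  (E N (fun n i => Phi ((xh - mm n i 0) / s0)) - Phi ((xh - mm 0 i0 0) / Num.sqrt (s0 ^+ 2 + D * N%:R))) +
  (Phi ((xh - mm 0 i0 0) / Num.sqrt (s0 ^+ 2 + D * N%:R)) - Phi x) by ring.
apply: (@le_trans _ _ (e * A * rate N + pk * B1 * rate N + (pk * 4 + 2) * B3 * rate N)).
  apply: le_trans (ler_normD _ _) _; apply: lerD => //.
  by apply: le_trans (ler_normD _ _) _; exact: lerD.
rewrite -!mulrDl; apply: ler_wpM2r; first exact: ltW.
by rewrite -!(addrA (s2 ^+ 4)) lerDr exprn_ge0.
Qed.

End Rate.

Theorem theorem6p8 (R : realType) (k : nat)
  (P Q Rm : int -> 'M[R]_k.+1) (i0 : 'I_k.+1)
  (zeta zm : int -> 'M[R]_k.+1) (mm : int -> 'cV[R]_k.+1)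
  (rho : int -> 'rV[R]_k.+1) (C beta1 a b : R) :
  (* environment: nonnegative, (P_n + Q_n + R_n) 1 = 1 *)
  (forall n, nonneg_mx (P n) /\ nonneg_mx (Q n) /\ nonneg_mx (Rm n)) ->
  (forall n, (P n + Q n + Rm n) *m (const_mx 1 : 'cV[R]_k.+1) = const_mx 1) ->
  (* (1) ellipticity *)
  (exists (eps : R) (k0 : nat), 0 < eps /\ forall n,
     mxnorm (Rm n ^+ k0) <= 1 - eps /\
     (forall i j, eps <= (invmx (1 - Rm n) *m P n) i j) /\
     (forall i j, eps <= (invmx (1 - Rm n) *m Q n) i j)) ->
  (* (2) bounded potential *)
  is_zeta P Q Rm zeta ->
  (exists CP : R, forall j : nat, (0 < j)%N ->
     `|ln (mxnorm (prodPos Q Rm zeta j))| <= CP /\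
     `|ln (mxnorm (prodNeg Q Rm zeta j))| <= CP) ->
  (* (3) the vectors m_n *)
  (forall n, mm n = P n *m mm (n + 1) + Rm n *m mm n + Q n *m mm (n - 1)) ->
  (exists K : R, forall (n1 n2 : int) (i1 i2 : 'I_k.+1),
     `|n1 - n2| <= 1 -> `|mm n1 i1 0 - mm n2 i2 0| <= K) ->
  (forall e : R, 0 < e -> exists M0 : nat, forall n : int, M0%:Z <= `|n| ->
     `|(\sum_(j < k.+1) mm n j 0) / n%:~R - (k.+1)%:R| < e) ->
  (* (4) zeta^-, the unique stochastic solution *)
  (forall n, stochastic (zm n)) -> zetam_eq P Q Rm zm ->
  (forall zm' : int -> 'M[R]_k.+1, (forall n, stochastic (zm' n)) ->
     zetam_eq P Q Rm zm' -> zm' = zm) ->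
  (* positive bounded row vectors rho_n *)
  (forall n j, 0 < rho n 0 j) ->
  (exists B : R, forall n j, rho n 0 j <= B) ->
  (forall n, rho n = rho (n - 1) *m P (n - 1) + rho n *m Rm n
                     + rho (n + 1) *m Q (n + 1)) ->
  (forall n, rho n = rho (n + 1) *m alpha Q Rm zeta n) ->
  (forall n, (rho n *m P n *m (mm (n + 1) - zm (n + 1) *m mm n)) 0 0
             = (2 * (k.+1)%:R)^-1) ->
  (* hypotheses of the theorem *)
  0 < C -> 0 < beta1 < 1 -> 0 < a -> 0 < b ->
  (forall (N L : nat) (c : int), (0 < N)%N ->
     (N%:R : R) `^ (100%:R^-1) <= L%:R -> `|c| <= N%:Z ->
     `|mm (c + L%:Z) ord0 0 - mm (c - L%:Z) ord0 0 - 2 * L%:R|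
        <= C * (L%:R `^ (1 - beta1)) /\
     `|\sum_(l < (L + L).+1) (rho (c - L%:Z + l%:Z) *m (const_mx 1 : 'cV[R]_k.+1)) 0 0
        - 2 * L%:R * a| <= C * (L%:R `^ (1 - beta1)) /\
     `|\sum_(l < (L + L).+1) (rho (c - L%:Z + l%:Z)
                               *m qvec P Q Rm mm (c - L%:Z + l%:Z)) 0 0
        - 2 * L%:R * b| <= C * (L%:R `^ (1 - beta1))) ->
  let D := b / a in
  let ups := 2^-1 * Num.min (4^-1) beta1 in
  forall eps : R, 0 < eps -> exists Ceps : R, forall (N : nat) (x : R),
    (0 < N)%N ->
    `|probX P Q Rm i0 N D x - Phi x| <= Ceps * (N%:R `^ (- (ups - eps))).
Proof.
move=> env_ge0 env_sum [eps [k0 [eps0 ell']]] zetaP _ harm [K step] _ zms _ _ rho0 [B rhoB] _ rhoA rhoN.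
have ell n := ell' n.
move=> C0 b1 a0 b0 win D ups e e0.
have D0 : 0 < D by exact: divr_gt0.
have [Cg [s1 [Cg0 s11 s1D cor]]] := good_corrector_exists env_ge0 env_sum eps0 ell zetaP step zms rho0
  rhoB rhoA rhoN C0 b1 a0 b0 win.
have [C' C'0 lin] := mm_window step C0 b1 win.
have [B' HB] := berry_esseen i0 (rate_exp01 b1) env_ge0 env_sum harm step D0 Cg0 s11 s1D cor C'0 lin.
(* The bound obtained has exponent [ups], and [1 <= N] allows lowering it to [ups - e]; the absolute
   value makes the constant nonnegative for this comparison. *)
exists `|B'| => N x N0; apply: le_trans (HB N x N0) _.
apply: le_trans (ler_wpM2r (powR_ge0 _ _) (ler_norm B')) _.
rewrite ler_wpM2l//; apply: ler_powR; first by rewrite ler1n.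
by rewrite /ups /rate_exp; lra.
Qed.
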